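(* Let $m\ge3$ and let $X_n$ be the space requirement (number of nodes) of a uniformly random $m$-ary search tree on $n$ keys, i.e. the additive functional with toll $b_n=1$ for $n\ge m-1$ and initial values $(x_0,x_1,\dots,x_{m-2})=(0,1,\dots,1)$. Let $$d_1:=\frac{m(1-\rho\,m^{1/(m-1)})}{(m-1)\alpha^*},\quad \delta_1:=d_1^2+\sum_{j=1}^{m-2}\big[1-(j+1)d_1\big]^2\rho^j,\quad B_2:=\frac{a_0}{-a_1(m-1)}\Big[\delta_1-\frac{a_0}{m(m-1)}\Big],$$ and $\sigma^2:=2B_2/(-a_1)$. Then $\dfrac{X_n-d_1(n+1)}{\sqrt n}\to N(0,\sigma^2)$ in law and $\dfrac{X_n-\mathbb EX_n}{\sqrt{\operatorname{Var}X_n}}\to N(0,1)$ in law.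
   Context: Fix an integer $m\ge2$. Let $\tau_n$ be the number of $m$-ary search trees on $n$ keys: $\tau_0=\dots=\tau_{m-2}=1$ and $\tau_n=\sum\tau_{j_1}\cdots\tau_{j_m}$ for $n\ge m-1$, summed over $(j_1,\dots,j_m)\ge0$ with $j_1+\dots+j_m=n-(m-1)$. Let $\rho$ be the unique number in $(0,1)$ with $m^m(\sum_{j=1}^{m-1}\rho^j)^{m-1}=(m-1)^{m-1}$. Define $\alpha^*:=m-(m^{m/(m-1)}-1)(\rho^{-1}-1)^{-1}$, $a_0:=m^{-1/(m-1)}\rho^{-1}$, $a_1:=-\sqrt{2m\alpha^*}\,m^{-m/(m-1)}\rho^{-1}$. Additive functional: given a real toll $(b_n)_{n\ge m-1}$ and real initial values $x_0,\dots,x_{m-2}$, $X_j=x_j$ (deterministic) for $0\le j\le m-2$ and, for $n\ge m-1$, $X_n\overset{d}{=}\sum_{k=1}^mX^{(k)}_{J_k}+b_n$, where $X^{(k)}_j\overset{d}{=}X_j$, $\mathbf J$ and the families $(X^{(k)}_j)_j$ are independent, and $\Pr[\mathbf J=(j_1,\dots,j_m)]=\tau_{j_1}\cdots\tau_{j_m}/\tau_n$ for $(j_1,\dots,j_m)\ge0$ with sum $n-(m-1)$ (i.e. $X_n$ is the functional $f$ with $f(T)=\sum_if(L_i(T))+b_{|T|}$ evaluated on a uniformly random $m$-ary search tree on $n$ keys). *)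

(* Defs.v *)
From HB Require Import structures.
From mathcomp Require Import all_boot all_order all_algebra.
From mathcomp Require Import all_classical all_reals all_analysis.
Set Implicit Arguments. Unset Strict Implicit. Unset Printing Implicit Defensive.
Import Order.TTheory GRing.Theory Num.Theory.
Import numFieldNormedType.Exports.
Local Open Scope classical_set_scope.
Local Open Scope ring_scope.

(* Number of m-ary search trees, tau_n, defined by the recursion with fuel. *)
Fixpoint tau_aux (m fuel n : nat) : nat :=
  match fuel with
  | 0 => 0%N
  | f.+1 => if (n < m.-1)%N then 1%N
            else (\sum_(J : {ffun 'I_m -> 'I_n} | (\sum_i (J i : nat) == n - m.-1)%N)
                    \prod_i tau_aux m f (J i))%N
  end.
Definition tau (m n : nat) : nat := tau_aux m n.+1 n.

Section Law.
Variable R : realType.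

Definition dirac_nat (a : nat) : nat -> R := fun k => if k == a then 1 else 0.
Definition conv_nat (p q : nat -> R) : nat -> R :=
  fun k => \sum_(i < k.+1) p i * q (k - i)%N.

(* law_aux m fuel n k = Pr[X_n = k] for the space requirement X_n
   (toll b_n = 1, initial values x_0 = 0, x_1 = ... = x_{m-2} = 1):
   for n >= m-1, X_n = 1 + sum_k X^{(k)}_{J_k} with independent copies,
   Pr[J = j] = tau_{j_1}...tau_{j_m} / tau_n. *)
Fixpoint law_aux (m fuel n : nat) : nat -> R :=
  match fuel with
  | 0 => fun _ => 0
  | f.+1 =>
    if (n < m.-1)%N then (if n == 0%N then dirac_nat 0 else dirac_nat 1)
    else fun k =>
      \sum_(J : {ffun 'I_m -> 'I_n} | (\sum_i (J i : nat) == n - m.-1)%N)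
        ((\prod_i (tau m (J i))%:R) / (tau m n)%:R) *
        (match k with
         | 0 => 0
         | k'.+1 => (\big[conv_nat/dirac_nat 0]_(i < m) law_aux m f (J i)) k'
         end)
  end.
Definition spaceLaw (m n : nat) : nat -> R := law_aux m n.+1 n.

(* E[g(X_n)]; X_n takes values in {0,...,n} *)
Definition Elaw (m n : nat) (g : R -> R) : R :=
  \sum_(k < n.+1) spaceLaw m n k * g k%:R.
Definition meanX (m n : nat) : R := Elaw m n id.
Definition varX (m n : nat) : R := Elaw m n (fun x => (x - meanX m n) ^+ 2).

Definition gauss (z : R) : R := expR (- (z ^+ 2) / 2) / Num.sqrt (2 * pi).

Definition Enormal (s : R) (g : R -> R) : R :=
  Rintegral lebesgue_measure setT (fun z => g (s * z) * gauss z).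

(* convergence in law of the real random variables Y_n (given by their
   expectation operators) to N(0, s^2): E g(Y_n) -> E g(Z) for all bounded
   continuous g *)
Definition conv_law_normal (EY : nat -> (R -> R) -> R) (s : R) : Prop :=
  forall g : R -> R, continuous g -> (exists M : R, forall x, `|g x| <= M) ->
    (fun n => EY n g) @ \oo --> Enormal s g.

Definition mR (m : nat) : R := m%:R.
Definition alphaStar (m : nat) (rho : R) : R :=
  mR m - (mR m `^ (mR m / (mR m - 1)) - 1) / (rho^-1 - 1).
Definition a0c (m : nat) (rho : R) : R := mR m `^ (- (1 / (mR m - 1))) / rho.
Definition a1c (m : nat) (rho : R) : R :=
  - Num.sqrt (2 * mR m * alphaStar m rho) * mR m `^ (- (mR m / (mR m - 1))) / rho.
Definition d1c (m : nat) (rho : R) : R :=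
  mR m * (1 - rho * mR m `^ (1 / (mR m - 1))) / ((mR m - 1) * alphaStar m rho).
Definition delta1c (m : nat) (rho : R) : R :=
  d1c m rho ^+ 2 +
  \sum_(1 <= j < m.-1) (1 - (j.+1)%:R * d1c m rho) ^+ 2 * rho ^+ j.
Definition B2c (m : nat) (rho : R) : R :=
  a0c m rho / (- a1c m rho * (mR m - 1)) *
  (delta1c m rho - a0c m rho / (mR m * (mR m - 1))).
Definition sigma2c (m : nat) (rho : R) : R := 2 * B2c m rho / (- a1c m rho).

End Law.

(* Main.v *)
Require Import Defs.
From HB Require Import structures.
From mathcomp Require Import all_boot all_order all_algebra.
From mathcomp Require Import all_classical all_reals all_analysis.
From mathcomp Require Import measurable_realfun zify ring lra.
Import Order.TTheory GRing.Theory Num.Theory.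
Import numFieldNormedType.Exports.
Local Open Scope classical_set_scope.
Local Open Scope ring_scope.

Set Implicit Arguments. Unset Strict Implicit. Unset Printing Implicit Defensive.

(** The generating function [F = 1 + u (z + .. + z^(m-2)) + u z^(m-1) F^m] and
   the cycle lemma show that there are [(|x| - 1)! / prod_j x_j!] trees with
   [x_j] nodes holding [j] keys ([0 <= j <= m - 1]), where the full nodes have
   [m] children and all others (the leaves, possibly empty) none. Replacing [m - 1] leaves with
   [b] keys by [m - 1] leaves with [b - 1] keys, [m - 1] empty leaves and one
   full node preserves the number [n] of keys, and the weights of the two
   configurations differ by an explicit rational factor: this yields an exact
   identity [E[f(x') U_b(x)] = E[f(x) V_b(x)]] with polynomials [U_b], [V_b].
   Taking [f = V_b - U_b] and its cube bounds the second and fourth moments of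
   [V_b - U_b], and the equations [U_b = V_b] have the unique solution
   [x_j ~ mu_j n] with [mu_j] proportional to [rho^j]; so all proportions are
   within [O(n^(-1/2))] of the [mu_j]. Linearizing the identity at [mu] for a
   function [f] of the rescaled number of nodes [Y] gives Stein's identity
   [E[Y f(Y)] - sigma^2 E[f'(Y)] -> 0], whence the Gaussian limit. The cases
   [f = 1] and [f = id] give the asymptotics of the mean and the variance. *)

(** A tree has [m] counts and two linear constraints (keys and nodes), so the [m - 2] exchanges
    cover all degrees of freedom: to first order the differences [V_b - U_b] determine every
    proportion, and [Y] is a linear combination of them up to quadratic errors. Hence the Stein
    identities of the single exchanges add up to one for [Y], and the variance is a sum of
    coefficients times changes of the number of nodes. Two obstacles shape the proof. The equations
    [U_b = V_b] equate [(m - 1)]-st powers, whose inversion is only Hoelder near 0. A first, weak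
    bound therefore shows that the proportions stay near positive values, and a second pass inverts
    the powers there at Lipschitz rate. Moreover, all that is used of the test function [f] is a
    bounded continuous derivative. So [f(Y)] may grow linearly, and its product with a quadratic
    error is cubic, which calls for fourth moments; and the Taylor remainder of [f] is small only
    relative to [1 + Y^2], which the bounded second moment of [Y] compensates. *)

(** * Stein's equation *)

Section Stein.
Variable R : realType.
Local Notation mu := (@lebesgue_measure R).
Implicit Types (g : R -> R) (x y z : R).

Lemma gauss_normal_pdf : @gauss R = normal_pdf 0 1.
Proof.
apply/funext => z; rewrite normal_pdfE ?oner_neq0// /normal_fun /normal_peak /gauss.
rewrite mulrC subr0 !expr1n mul1r -[pi *+ 2]mulr_natl; congr (_ * expR _).
Qed.

Lemma gauss_gt0 z : 0 < gauss z.
Proof. by rewrite divr_gt0 ?expR_gt0// sqrtr_gt0 mulr_gt0 ?pi_gt0. Qed.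

Lemma gaussN z : gauss (- z) = gauss z.
Proof. by rewrite /gauss sqrrN. Qed.

Lemma is_derive_gauss z : is_derive z 1 (@gauss R) (- z * gauss z).
Proof.
have h : is_derive z 1 (fun z : R => - z ^+ 2 / 2) (- z).
  by apply: is_derive_eq; rewrite /GRing.scale /=; field.
have h2 : is_derive z 1 (fun z : R => expR (- z ^+ 2 / 2)) (- z * expR (- z ^+ 2 / 2)).
  by apply: is_derive_eq; rewrite /GRing.scale /= mulrC.
rewrite /gauss; apply: is_derive_eq.
by rewrite /GRing.scale /=; ring.
Qed.

Lemma continuous_gauss : continuous (@gauss R).
Proof. by rewrite gauss_normal_pdf; apply: continuous_normal_pdf; rewrite oner_neq0. Qed.

Lemma integrable_gauss : mu.-integrable [set: R] (EFin \o @gauss R).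
Proof. by rewrite gauss_normal_pdf; exact: integrable_normal_pdf. Qed.

Lemma Rintegral_gauss : (\int[mu]_z gauss z = 1 :> R)%R.
Proof. by rewrite gauss_normal_pdf /Rintegral integral_normal_pdf. Qed.

Lemma cvg_gauss_pinfty : gauss x @[x --> +oo%R] --> (0 : R).
Proof.
rewrite -[0](mul0r (Num.sqrt (2 * pi))^-1).
apply: cvgM; last exact: cvg_cst.
under eq_fun do rewrite mulNr.
apply: (cvg_comp (fun x => x ^+ 2 / 2) (fun x => expR (- x))).
  by apply: gt0_cvgMly; [rewrite invr_gt0|exact: cvgr_expr2].
exact: cvgr_expR.
Qed.

Lemma is_derive_continuous (f df : R -> R) :
  (forall x, is_derive x 1 f (df x)) -> continuous f.
Proof.
move=> h x; apply: differentiable_continuous; apply/derivable1_diffP.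
exact: (@ex_derive _ _ _ _ _ _ _ (h x)).
Qed.

(** [- gauss] is an antiderivative of [t * gauss t], and [1 <= t / y] on the half-line. *)
Lemma mills y : 0 < y ->
  (\int[mu]_(t in `[y, +oo[) (gauss t)%:E <= (gauss y / y)%:E)%E.
Proof.
move=> y0; have mD : measurable `[y, +oo[%classic by exact: measurable_itv.
have mg (D : set R) : measurable D -> measurable_fun D (@gauss R).
  by move=> mD'; apply: measurable_funS (continuous_measurable_fun continuous_gauss).
have h : (\int[mu]_(t in `[y, +oo[) (t * gauss t)%:E = 0%:E - (- gauss y)%:E)%E.
  apply: (@ge0_continuous_FTC2y _ _ (fun t => - gauss t)).
  - by move=> x yx; rewrite mulr_ge0 ?(ltW (gauss_gt0 _))// (le_trans (ltW y0)).
  - apply: continuous_subspaceT => x; apply: cvgM; first exact: cvg_id.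
    exact: continuous_gauss.
  - rewrite -oppr0; apply: cvgN; exact: cvg_gauss_pinfty.
  - move=> x _; apply: derivableN; exact: (@ex_derive _ _ _ _ _ _ _ (is_derive_gauss x)).
  - apply: cvgN; apply: cvg_at_right_filter; exact: continuous_gauss.
  - move=> x _; rewrite derive1E deriveN; last exact: (@ex_derive _ _ _ _ _ _ _ (is_derive_gauss x)).
    by rewrite (@derive_val _ _ _ _ _ _ _ (is_derive_gauss x)) mulNr opprK.
rewrite -EFinB opprK add0r in h.
rewrite mulrC EFinM -h -ge0_integralZl//=; last 3 first.
- by apply/measurable_EFinP; apply: measurable_funM => //; exact: mg.
- by move=> x; rewrite in_itv/= andbT => yx; rewrite lee_fin mulr_ge0 ?(ltW (gauss_gt0 _))// (le_trans (ltW y0)).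
- by rewrite lee_fin invr_ge0 ltW.
apply: ge0_le_integral => //=.
- by move=> x _; rewrite lee_fin (ltW (gauss_gt0 _)).
- by apply/measurable_EFinP; exact: mg.
- by apply/measurable_EFinP; apply: measurable_funM => //; apply: measurable_funM => //; exact: mg.
move=> x; rewrite in_itv/= andbT => yx; rewrite lee_fin mulrA ler_peMl ?(ltW (gauss_gt0 _))//.
by rewrite mulrC ler_pdivlMr// mul1r.
Qed.

Lemma millsN y : y < 0 ->
  (\int[mu]_(t in `]-oo, y]) (gauss t)%:E <= (gauss y / - y)%:E)%E.
Proof.
move=> y0; rewrite -[y in `]-oo, y]]opprK ge0_integration_by_substitutionNy.
- under eq_integral do rewrite /= gaussN.
  by rewrite -[gauss y]gaussN; apply: mills; rewrite oppr_gt0.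
- exact: continuous_subspaceT continuous_gauss.
- by move=> x _; exact: ltW (gauss_gt0 _).
Qed.

Lemma integrable_Mgauss (h : R -> R) (K : R) (D : set R) :
  measurable D -> continuous h -> (forall x, `|h x| <= K) ->
  mu.-integrable D (EFin \o (fun t => h t * gauss t)).
Proof.
move=> mD ch hK; apply: (@integrableS _ _ _ _ setT) => //.
apply: (@integrableMr _ _ _ mu setT measurableT h (EFin \o @gauss R)).
- exact: continuous_measurable_fun.
- exists K; split; first exact: num_real.
  by move=> x Kx y _ /=; rewrite (le_trans (hK y))// ltW.
- exact: integrable_gauss.
Qed.

Lemma Rintegral_gauss_le (h : R -> R) (K c : R) (D : set R) :
  measurable D -> continuous h -> 0 < K -> (forall x, `|h x| <= K) ->
  (\int[mu]_(t in D) (gauss t)%:E <= c%:E)%E ->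
  `|\int[mu]_(t in D) (h t * gauss t)| <= K * c.
Proof.
move=> mD ch K0 hK hc.
have mg : measurable_fun D (@gauss R).
  by apply: measurable_funS (continuous_measurable_fun continuous_gauss).
have mh : measurable_fun D h.
  by apply: measurable_funS (continuous_measurable_fun ch).
rewrite -lee_fin EFin_normr_Rintegral//; last exact: integrable_Mgauss ch hK.
apply: le_trans (le_abse_integral _ _ _) _ => //.
  by apply/measurable_EFinP; exact: measurable_funM.
apply: (@le_trans _ _ (K%:E * \int[mu]_(t in D) (gauss t)%:E)%E); last first.
  by rewrite EFinM lee_pmul2l// lte_fin.
rewrite -ge0_integralZl//; last 3 first.
- exact/measurable_EFinP.
- by move=> x _; rewrite lee_fin (ltW (gauss_gt0 _)).
- by rewrite lee_fin ltW.
apply: ge0_le_integral => //.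
- by apply/measurable_EFinP; apply: measurableT_comp => //; exact: measurable_funM.
- by apply/measurable_EFinP; exact: measurable_funM.
by move=> x _; rewrite lee_fin normrM (gtr0_norm (gauss_gt0 x)) ler_pM2r ?gauss_gt0.
Qed.

(* The solution is [f y = (int_{-oo}^y (g - Eg) gauss) / gauss y]; Mills' ratio
   bounds [y * f y] on each half-line, since the full integral vanishes. *)
Lemma stein_equation (g : R -> R) (K : R) :
  continuous g -> (forall x, `|g x| <= K) ->
  exists f df : R -> R,
    [/\ forall x : R, is_derive x 1 f (df x), continuous df,
        exists C : R, forall x, `|df x| <= C &
        forall x, df x - x * f x = g x - Enormal 1 g].
Proof.
move=> cg gK; set c := Enormal 1 g; pose h x := g x - c.
have [L L0 hL] : exists2 L, 0 < L & forall x, `|h x| <= L.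
  exists (`|K| + `|c| + 1); first by rewrite ltr_wpDl// addr_ge0.
  move=> x; rewrite (le_trans (ler_normB _ _))// -addrA lerD//.
    by rewrite (le_trans (gK x))// ler_norm.
  by rewrite lerDl.
have ch : continuous h by move=> x; apply: cvgB; [exact: cg|exact: cvg_cst].
pose psi t := h t * gauss t.
have cpsi : continuous psi by move=> x; apply: cvgM; [exact: ch|exact: continuous_gauss].
have ipsi D : measurable D -> mu.-integrable D (EFin \o psi).
  by move=> mD; exact: integrable_Mgauss hL.
have psi0 : \int[mu]_x psi x = 0.
  rewrite (@eq_Rintegral _ _ _ mu _ (fun x => g x * gauss x - c * gauss x)); last first.
    by move=> x _; rewrite /psi /h mulrBl.
  rewrite RintegralB//=; last 2 first.
  - exact: integrable_Mgauss gK.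
  - by apply: (@integrable_Mgauss (fun=> c) `|c|) => //; exact: cst_continuous.
  rewrite RintegralZl//; last exact: integrable_gauss.
  rewrite Rintegral_gauss mulr1 /c /Enormal; apply/eqP; rewrite subr_eq0; apply/eqP.
  by apply: eq_Rintegral => x _; rewrite mul1r.
pose F y := \int[mu]_(t in `]-oo, y]) psi t.
have dF y : is_derive y 1 F (psi y).
  have yu : y < y + 1 by rewrite ltrDl.
  have mi : measurable (`]-oo, y + 1]%classic : set R) by exact: measurable_itv.
  have [d1 d2] := @continuous_FTC1 _ psi -oo%O y (y + 1) yu (ipsi _ mi) (ltNyr _) (cpsi y).
  by split => //; rewrite -derive1E.
pose f y := F y / gauss y.
have g0 y : gauss y != 0 by rewrite gt_eqF ?gauss_gt0.
(* Defined by the equation itself; it remains to see that this is the derivative of [f] and that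
   [y * f y] is bounded. *)
pose df y := y * f y + h y.
have dff y : is_derive y 1 f (df y).
  have h1 := is_derive_gauss y.
  rewrite /f; apply: is_derive_eq.
  rewrite /GRing.scale /df /f /psi /=; field.
  exact: g0.
exists f, df; split => //.
- move=> y; apply: cvgD; last exact: ch.
  by apply: cvgM; [exact: cvg_id|exact: (is_derive_continuous dff)].
- exists (L + L) => y; rewrite (le_trans (ler_normD _ _))// lerD//.
  have [y0|y0|->] := ltgtP y 0; last by rewrite mul0r normr0 ltW.
  + rewrite /f normrM normrM normfV (gtr0_norm (gauss_gt0 y)) mulrA.
    rewrite ler_pdivrMr ?gauss_gt0// ltr0_norm// mulrC -ler_pdivlMr ?oppr_gt0//.
    rewrite -mulrA; apply: Rintegral_gauss_le => //.
    exact: millsN.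
  + rewrite /f; have -> : F y = - \int[mu]_(t in `[y, +oo[) psi t.
      have := Rintegral_itvB (a := -oo%O) (b := +oo%O) (x := y) (f := psi).
      rewrite /= set_itvNyy psi0 => /(_ (ipsi _ _) isT isT).
      rewrite Rintegral_itv_obnd_cbnd; last by apply: ipsi; exact: measurable_itv.
      by move=> <-//; rewrite sub0r opprK.
    rewrite normrM normrM normfV normrN (gtr0_norm (gauss_gt0 y)) mulrA.
    rewrite ler_pdivrMr ?gauss_gt0// gtr0_norm// mulrC -ler_pdivlMr//.
    rewrite -mulrA; apply: Rintegral_gauss_le => //.
    exact: mills.
- by move=> y; rewrite /df addrC addrA addNr add0r.
Qed.

End Stein.

(** * Stein's method for abstract expectations *)

Section SteinMethod.
Variable R : realType.
Implicit Types (g f df : R -> R) (s : R).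

Lemma stein_equation_scaled g (K s : R) : 0 < s ->
  continuous g -> (forall x, `|g x| <= K) ->
  exists f df : R -> R,
    [/\ forall x : R, is_derive x 1 f (df x), continuous df,
        exists C : R, forall x, `|df x| <= C &
        forall x, s ^+ 2 * df x - x * f x = g x - Enormal s g].
Proof.
move=> s0 cg gK.
have cs (r : R) : continuous (fun x : R => r * x).
  by move=> x; apply: cvgM; [exact: cvg_cst|exact: cvg_id].
have [|f [df [h1 h2 [C h3] h4]]] := @stein_equation R (fun x => g (s * x)) K _ (fun x => gK _).
  by move=> x; apply: (continuous_comp (cs s x)); exact: cg.
have sn : s != 0 by rewrite gt_eqF.
exists (fun x => f (s^-1 * x) / s), (fun x => df (s^-1 * x) / s ^+ 2); split.
- move=> x.
  have i1 : is_derive x 1 (fun x : R => s^-1 * x) s^-1.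
    by apply: is_derive_eq; rewrite /GRing.scale /=; ring.
  have i2 := h1 (s^-1 * x).
  have i3 : is_derive x 1 (f \o (fun x : R => s^-1 * x)) (s^-1 * df (s^-1 * x)).
    by apply: is_derive_eq; rewrite mulrC.
  apply: is_derive_eq.
  rewrite /GRing.scale /=; field.
  exact: sn.
- move=> x; apply: cvgM; last exact: cvg_cst.
  by apply: (continuous_comp (cs s^-1 x)); exact: h2.
- exists (C / s ^+ 2) => x; rewrite normrM normfV (@ger0_norm _ (s ^+ 2)) ?sqr_ge0//.
  by rewrite ler_pM2r ?invr_gt0 ?exprn_gt0.
- move=> x; have := h4 (s^-1 * x); rewrite [s * (_ * _)]mulrA mulfV// mul1r.
  rewrite (_ : Enormal 1 _ = Enormal s g); last first.
    by rewrite /Enormal; apply: eq_Rintegral => z _; rewrite mul1r.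
  by move=> <-; field.
Qed.

(** A merely continuous function has no uniform modulus on the line; the weight [1 + y ^+ 2] makes
    up for it, at no cost under a bounded second moment. The displacement may grow with [|y|], so
    that a change of scale is covered too. *)
Lemma bounded_continuous_modulus g (K e : R) : continuous g ->
  (forall x, `|g x| <= K) -> 0 < e ->
  exists2 d, 0 < d & forall y z : R, `|z - y| <= d * (1 + `|y|) ->
    `|g z - g y| <= e * (1 + y ^+ 2).
Proof.
move=> cg gK e0.
have K0 : 0 <= K by exact: le_trans (normr_ge0 _) (gK 0).
(* Outside [[-A, A]] the crude bound [2 * K <= e * A ^+ 2] suffices; inside, compactness gives a
   uniform modulus. *)
pose A : R := Num.sqrt (2 * K / e) + 1.
have A0 : 0 < A by rewrite ltr_wpDl ?sqrtr_ge0.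
have hA : 2 * K <= e * A ^+ 2.
  rewrite -(ler_pdivrMl _ _ e0) mulrC -[leLHS]sqr_sqrtr; last first.
    by rewrite divr_ge0 ?mulr_ge0// ltW.
  by rewrite ler_sqr ?nnegrE ?sqrtr_ge0 ?(ltW A0)// lerDl.
have /compact_near_coveringP cpt := @segment_compact R (- A) A.
have := cpt R (0 : R)^'+ (fun d y => forall z, `|z - y| <= d -> `|g z - g y| <= e) _.
case.
  move=> y _.
  have := cg y => /cvgrPdist_lt /(_ (e / 2)); rewrite divr_gt0// => /(_ isT).
  move=> /nbhs_ballP[r /= r0 hr].
  near=> y' d => z zd.
  have yy' : `|y - y'| < r / 2.
    by near: y'; apply: nbhsx_ballx; rewrite divr_gt0.
  have dr : d < r / 2 by near: d; apply: nbhs_right_lt; rewrite divr_gt0.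
  have h1 : `|g y - g y'| < e / 2.
    by apply: hr; rewrite /ball /= (lt_trans yy')// ltr_pdivrMr// ltr_pMr// ltr1n.
  have h2 : `|g y - g z| < e / 2.
    apply: hr; rewrite /ball /= -(subrK y' y) -addrA [r]splitr.
    by rewrite (le_lt_trans (ler_normD _ _))// ltrD// distrC (le_lt_trans zd).
  rewrite -(subrK (g y) (g z)) -addrA [e]splitr.
  by rewrite (le_trans (ler_normD _ _))// lerD ?(ltW h1)// distrC ltW.
move=> r /= r0 hr.
exists (Num.min 1 (r / 2) / (1 + A)); first by rewrite divr_gt0 ?lt_min ?ltr01 ?divr_gt0// addr_gt0.
move=> y z yz.
have [Ay|Ay] := leP `|y| A.
  have A1 : 0 < 1 + A by rewrite addr_gt0.
  have : `|g z - g y| <= e.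
    apply: (hr (r / 2)).
    - by rewrite /= sub0r normrN gtr0_norm ?divr_gt0// ltr_pdivrMr// ltr_pMr// ltr1n.
    - by rewrite divr_gt0.
    - by rewrite /= in_itv/= -ler_norml.
    - rewrite (le_trans yz)// mulrAC ler_pdivrMr// ler_pM ?addr_ge0 ?le_min ?ler01//= ?divr_ge0 ?(ltW r0)//.
        by rewrite ge_min lexx orbT.
      by rewrite lerD2l.
  by move=> /le_trans; apply; rewrite ler_peMr ?(ltW e0)// lerDl sqr_ge0.
rewrite (le_trans (ler_normB _ _))// (le_trans (lerD (gK _) (gK _)))//.
rewrite -mulr2n -[X in X <= _]mulr_natl (le_trans hA)// ler_pM2l//.
by rewrite ler_wpDl// -(real_normK (num_real y)) ler_sqr ?nnegrE ?(ltW A0)// ltW.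
Unshelve. all: by end_near. Qed.

Section Means.
Variables (X : Type) (E : nat -> (X -> R) -> R) (D : nat -> X -> Prop).

(** Expectations enter only as monotone linear functionals of mass 1; [D n] plays the role of the
    support, on which inequalities are tested. *)
Record is_mean (n : nat) : Prop := IsMean {
  expectD : forall p q, E n (fun x => p x + q x) = E n p + E n q;
  expectZ : forall c p, E n (fun x => c * p x) = c * E n p;
  expect1 : E n (fun=> 1) = 1;
  le_expect : forall p q, (forall x, D n x -> p x <= q x) -> E n p <= E n q }.

Lemma expectN n p : is_mean n -> E n (fun x => - p x) = - E n p.
Proof.
move=> h; rewrite -mulN1r -(expectZ h); congr E.
by apply/funext => x; rewrite mulN1r.
Qed.

Lemma expectB n p q : is_mean n -> E n (fun x => p x - q x) = E n p - E n q.
Proof. by move=> h; rewrite (expectD h) expectN. Qed.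

Lemma expect_cst n c : is_mean n -> E n (fun=> c) = c.
Proof.
move=> h; rewrite -[RHS]mulr1 -(expect1 h) -(expectZ h); congr E.
by apply/funext => x; rewrite mulr1.
Qed.

Lemma eq_expect n p q : is_mean n -> (forall x, D n x -> p x = q x) ->
  E n p = E n q.
Proof.
by move=> h pq; apply/eqP; rewrite eq_le !(le_expect h)// => x Dx; rewrite pq.
Qed.

Lemma ler_norm_expect n p q : is_mean n ->
  (forall x, D n x -> `|p x| <= q x) -> `|E n p| <= E n q.
Proof.
move=> h pq; rewrite ler_norml -expectN// !(le_expect h)// => x /pq.
  by rewrite ler_norml => /andP[].
by rewrite ler_norml => /andP[].
Qed.

(** Stein's equation for [y |-> g (a * y)] turns the assumed identity into the limit of [E g(a Y)];
    passing to [al n * Y + be n] costs a small multiple of [1 + E (a Y)^2], by the weighted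
    modulus. *)
Lemma stein_clt (Y : X -> nat -> R) (s C a : R) (al be : nat -> R) g (K : R) :
  (\forall n \near \oo, is_mean n) ->
  (\forall n \near \oo, E n (fun x => Y x n ^+ 2) <= C) ->
  0 < s ->
  (forall f df, (forall x : R, is_derive x 1 f (df x)) -> continuous df ->
    (exists L : R, forall x, `|df x| <= L) ->
    (fun n => E n (fun x => s ^+ 2 * df (Y x n) - Y x n * f (Y x n))) @ \oo --> (0 : R)) ->
  0 < a -> al @ \oo --> a -> be @ \oo --> (0 : R) ->
  continuous g -> (forall x, `|g x| <= K) ->
  (fun n => E n (fun x => g (al n * Y x n + be n))) @ \oo --> Enormal (a * s) g.
Proof.
move=> hE hC s0 hS a0 ala be0 cg gK.
have cga : continuous (fun y => g (a * y)).
  move=> x; apply: (continuous_comp (f := fun y => a * y)); last exact: cg.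
  by apply: cvgM; [exact: cvg_cst|exact: cvg_id].
have [f [df [h1 h2 h3 h4]]] := stein_equation_scaled s0 cga (fun x => gK _).
have {hS} := hS f df h1 h2 h3.
rewrite (_ : Enormal (a * s) g = Enormal s (fun y => g (a * y))); last first.
  by apply: eq_Rintegral => z _; rewrite mulrA.
set c := Enormal _ _ in h4 *.
move=> /cvgrPdist_le hS; apply/cvgrPdist_le => e e0.
have C0 : 0 < 1 + a ^+ 2 * `|C| by rewrite ltr_pwDl// mulr_ge0 ?sqr_ge0.
have e'0 : 0 < e / 2 / (1 + a ^+ 2 * `|C|) by rewrite !divr_gt0.
have [d d0 hd] := bounded_continuous_modulus cg gK e'0.
have dm0 : 0 < d * Num.min 1 a by rewrite mulr_gt0// lt_min ltr01.
near=> n.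
have En : is_mean n by near: n.
have Cn : E n (fun x => Y x n ^+ 2) <= C by near: n.
have an : `|a - al n| <= d * Num.min 1 a.
  by near: n; move: ala => /cvgrPdist_le; exact.
have bn : `|be n| <= d.
  by near: n; move: be0 => /cvgrPdist_le /(_ d d0); apply: filterS => k; rewrite sub0r normrN.
have hn : `|E n (fun x => g (a * Y x n)) - c| <= e / 2.
  rewrite -{1}(expect_cst c En) -expectB//.
  under eq_fun do rewrite -h4.
  by rewrite -normrN -sub0r; near: n; apply: hS; rewrite divr_gt0.
have hn2 : `|E n (fun x => g (al n * Y x n + be n)) - E n (fun x => g (a * Y x n))| <= e / 2.
  rewrite -expectB//.
  apply: (@le_trans _ _ (E n (fun x => e / 2 / (1 + a ^+ 2 * `|C|) * (1 + (a * Y x n) ^+ 2)))).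
    apply: ler_norm_expect => // x _; apply: hd.
    rewrite addrAC -mulrBl mulrDr mulr1 (le_trans (ler_normD _ _))// addrC lerD//.
    rewrite normrM distrC (le_trans (ler_wpM2r _ an))// normrM (gtr0_norm a0).
    by rewrite -mulrA ler_pM2l// ler_wpM2r// ge_min lexx orbT.
  rewrite (expectZ En) -(mulrA (e / 2)) ler_piMr ?divr_ge0 ?(ltW e0)//.
  rewrite ler_pdivrMl// mulr1 (expectD En) (expect1 En) lerD2l.
  under eq_fun do rewrite exprMn.
  by rewrite (expectZ En) ler_wpM2l ?sqr_ge0// (le_trans Cn)// ler_norm.
rewrite distrC -(subrK (E n (fun x => g (a * Y x n))) (E n _)) -addrA [e]splitr.
by rewrite (le_trans (ler_normD _ _))// lerD.
Unshelve. all: by end_near. Qed.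

End Means.
End SteinMethod.

(** * Trees as vectors of node counts *)

Section Configurations.
Variable q : nat.
Local Notation m := q.+2.
Local Notation M := q.+1.
Local Notation cfg := {ffun 'I_m -> nat}.
Implicit Types (x y : cfg) (i j : 'I_m).

Definition csize x : nat := (\sum_j x j)%N.
Definition keys x : nat := (\sum_(j < m) j * x j)%N.
(** Type 0 is the empty leaf, which the space requirement does not count. *)
Definition nodes x : nat := (\sum_(j < m | j != ord0) x j)%N.
Definition cinc x j (s : nat) : cfg := [ffun i => (x i + (i == j) * s)%N].
Definition cdec x j (s : nat) : cfg := [ffun i => (x i - (i == j) * s)%N].

Lemma cincK x j s : cdec (cinc x j s) j s = x.
Proof. by apply/ffunP => i; rewrite !ffunE addnK. Qed.

Lemma sum_cinc (P : pred 'I_m) (c : 'I_m -> nat) x j s :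
  (\sum_(i | P i) c i * cinc x j s i = \sum_(i | P i) c i * x i + P j * (c j * s))%N.
Proof.
under eq_bigr do rewrite ffunE mulnDr.
rewrite big_split /=; congr (_ + _)%N.
have [Pj|nPj] := boolP (P j).
  rewrite (bigD1 j)//= eqxx !mul1n big1 ?addn0// => i /andP[_ /negPf->].
  by rewrite mul0n muln0.
rewrite big1 // => i Pi; rewrite (_ : i == j = false) ?mul0n ?muln0//.
by apply: contraNF nPj => /eqP <-.
Qed.

Lemma csize_cinc x j s : csize (cinc x j s) = (csize x + s)%N.
Proof.
rewrite /csize (eq_bigr (fun i => 1 * cinc x j s i)%N) => [|i _]; last by rewrite mul1n.
by rewrite sum_cinc !mul1n; congr (_ + _)%N; apply: eq_bigr => i _; rewrite mul1n.
Qed.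

Lemma keys_cinc x j s : keys (cinc x j s) = (keys x + j * s)%N.
Proof. by rewrite /keys sum_cinc mul1n. Qed.

Lemma nodes_cinc x j s : nodes (cinc x j s) = (nodes x + (j != ord0) * s)%N.
Proof.
rewrite /nodes (eq_bigr (fun i => 1 * cinc x j s i)%N) => [|i _]; last by rewrite mul1n.
by rewrite sum_cinc !mul1n; congr (_ + _)%N; apply: eq_bigr => i _; rewrite mul1n.
Qed.

Lemma leq_csize x j : (x j <= csize x)%N.
Proof. by rewrite /csize (bigD1 j)//= leq_addr. Qed.

Lemma leq_keys x j : (j * x j <= keys x)%N.
Proof. by rewrite /keys (bigD1 j)//= leq_addr. Qed.

Lemma csize_nodes x : csize x = (x ord0 + nodes x)%N.
Proof. by rewrite /csize (bigD1 ord0). Qed.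

Lemma nodes_le_keys x : (nodes x <= keys x)%N.
Proof.
rewrite /nodes /keys [leqRHS](bigID (fun j : 'I_m => j != ord0))/=.
apply: leq_trans (leq_addr _ _); apply: leq_sum => j j0.
by rewrite leq_pmull// lt0n; apply: contraNneq j0 => j0; apply/eqP/val_inj.
Qed.

Definition cfg_of (L : nat) (y : {ffun 'I_m -> 'I_L}) : cfg := [ffun i => val (y i)].

Section BoxSum.
Variable V : nmodType.
Implicit Types (psi : cfg -> V).

(** Bounding the counts by [L] makes the index type finite; [L] is taken above every count that the
    summand's support allows. *)
Definition boxsum (L : nat) psi : V := \sum_(y : {ffun 'I_m -> 'I_L}) psi (cfg_of y).

Lemma eq_boxsum L psi1 psi2 : psi1 =1 psi2 -> boxsum L psi1 = boxsum L psi2.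
Proof. by move=> h; apply: eq_bigr => y _. Qed.

(** The substitution [x = y + e_j] fails only at two faces of the box, where the terms vanish by
    hypothesis: [x j = 0] has no preimage, and [y j = L - 1] is sent to [x j = L]. *)
Lemma boxsum_shift L j psi :
  (forall x, x j = 0%N -> psi x = 0) -> (forall x, x j = L -> psi x = 0) ->
  boxsum L psi = boxsum L (fun y => psi (cinc y j 1)).
Proof.
move=> psi0 psiL; case: L psiL => [|L] psiL.
  by apply: eq_bigr => y _; case: (y ord0).
pose up (y : {ffun 'I_m -> 'I_L.+1}) : {ffun 'I_m -> 'I_L.+1} :=
  [ffun i => if i == j then inord (y i).+1 else y i].
pose dn (y : {ffun 'I_m -> 'I_L.+1}) : {ffun 'I_m -> 'I_L.+1} :=
  [ffun i => if i == j then inord (y i).-1 else y i].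
rewrite /boxsum (bigID (fun y : {ffun 'I_m -> 'I_L.+1} => y j != ord0))/=.
rewrite [X in _ + X]big1 ?addr0; last first.
  by move=> y; rewrite negbK => /eqP y0; apply: psi0; rewrite ffunE y0.
rewrite [RHS](bigID (fun y : {ffun 'I_m -> 'I_L.+1} => (y j).+1 < L.+1)%N)/=.
rewrite [X in _ = _ + X]big1 ?addr0; last first.
  move=> y yL; apply: psiL; rewrite !ffunE eqxx mul1n addn1.
  by apply/eqP; rewrite eqn_leq ltn_ord leqNgt yL.
rewrite (reindex_onto up dn)/=; last first.
  move=> y y0; apply/ffunP => i; rewrite !ffunE; case: eqP => // ->.
  rewrite inordK; last by rewrite (leq_ltn_trans (leq_pred _)).
  rewrite prednK ?inord_val// lt0n.
  by apply: contraNneq y0 => y0; apply/eqP/val_inj.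
(* [inord] falls back to 0 out of range, so [up y j] is nonzero exactly when the increment stays in
   the box. *)
apply: eq_big => [y|y].
  rewrite ffunE eqxx; apply/andP/idP => [[+ _]|yL].
    rewrite ltnNge; apply: contraNN => yL.
    by rewrite /inord /insubd insubF// ltnNge yL.
  split; first by apply/eqP => /(congr1 val); rewrite /= inordK.
  apply/eqP/ffunP => i; rewrite !ffunE; case: eqP => // ->.
  by rewrite inordK//= inord_val.
rewrite ffunE eqxx => /andP[yL _].
have {yL} yL : ((y j).+1 < L.+1)%N.
  rewrite ltnNge; apply: contraNN yL => yL.
  by rewrite /inord /insubd insubF// ltnNge yL.
congr psi; apply/ffunP => i; rewrite !ffunE; case: (eqVneq i j) => [->|_].
  by rewrite mul1n addn1 /= inordK.
by rewrite mul0n addn0.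
Qed.

Lemma boxsumD L psi1 psi2 :
  boxsum L (fun x => psi1 x + psi2 x) = boxsum L psi1 + boxsum L psi2.
Proof. by rewrite /boxsum big_split. Qed.

Lemma boxsum_sum (I : finType) L (psi : I -> cfg -> V) :
  boxsum L (fun x => \sum_i psi i x) = \sum_i boxsum L (psi i).
Proof. by rewrite /boxsum exchange_big. Qed.

End BoxSum.

End Configurations.

(** * Generating polynomials of forests and the law of the number of nodes *)

Section ForestPolynomials.
Variables (R : realType) (q : nat).
Local Notation m := q.+2.
Local Notation M := q.+1.
Local Notation cfg := {ffun 'I_m -> nat}.
Implicit Types (x y : cfg) (i j : 'I_m).

Definition invfact x : R := (\prod_j (x j)`!)%:R^-1.

Lemma invfact_cdec x j : x j != 0%N -> invfact (cdec x j 1) = (x j)%:R * invfact x.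
Proof.
move=> xj; rewrite /invfact (bigD1 j)//= [in RHS](bigD1 j)//=.
rewrite (_ : \prod_(i < m | i != j) (cdec x j 1 i)`! = \prod_(i < m | i != j) (x i)`!)%N; last first.
  by apply: eq_bigr => i /negPf ij; rewrite ffunE ij mul0n subn0.
rewrite ffunE eqxx mul1n subn1.
case: (x j) xj => // k _; rewrite factS /= -mulnA [in RHS]natrM invfM mulrA mulfV ?mul1r//.
Qed.

Lemma invfact_cinc x j : (x j).+1%:R * invfact (cinc x j 1) = invfact x.
Proof.
have := @invfact_cdec (cinc x j 1) j; rewrite cincK ffunE eqxx mul1n addn1.
by move=> ->.
Qed.

Definition forest (a n : nat) x : bool :=
  (keys x == n) && (csize x == m * x ord_max + a)%N.

(* By the cycle lemma, [a (|x| - 1)! / prod_j x_j!] is the number of ordered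
   forests of [a] trees having [x_j] nodes with [j] keys. *)
Definition forest_weight (a : nat) x : R :=
  if csize x == 0%N then (a == 0%N)%:R
  else a%:R * (csize x).-1`!%:R * invfact x.

(** Removing the first node of an ordered forest of [a + 1] trees leaves [a] trees, or [a + m] if
    that node is full, since its children become roots. *)
Lemma forest_weight_rec a n x : forest a.+1 n x ->
  \sum_j (if x j == 0%N then 0
          else forest_weight (a + (j == ord_max) * m)%N (cdec x j 1)) =
  forest_weight a.+1 x.
Proof.
move=> /andP[_ /eqP sx]; rewrite /forest_weight.
have sx0 : csize x != 0%N by rewrite sx addnS.
rewrite (negPf sx0).
have cs j : x j != 0%N -> csize (cdec x j 1) = (csize x).-1.
  move=> xj; rewrite (_ : x = cinc (cdec x j 1) j 1) ?cincK ?csize_cinc ?addn1//.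
  by apply/ffunP => i; rewrite !ffunE; case: (eqVneq i j) => [->|_] /=; move: xj; rewrite ?mul1n ?mul0n; lia.
(* A single node leaves the empty configuration, where [forest_weight] takes its separate value. *)
have [s1|s1] := eqVneq (csize x) 1%N.
  have a0 : a = 0%N by move: sx; rewrite s1; lia.
  have xM : x ord_max = 0%N by move: sx; rewrite s1; lia.
  rewrite s1 a0 /= mulr1 mul1r.
  transitivity (\sum_j (x j)%:R : R).
    apply: eq_bigr => j _; case: (eqVneq (x j) 0%N) => [->//|xj].
    rewrite cs// s1 /= (_ : x j = 1%N); last first.
      by apply/eqP; rewrite eqn_leq lt0n xj -{1}s1 leq_csize.
    case: (eqVneq j ord_max) xj => [->|//]; by rewrite xM.
  rewrite -natr_sum -/(csize x) s1 /invfact big1 ?invr1// => j _.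
  have := leq_csize x j; rewrite s1; by case: (x j) => [|[|]].
have s2 : (csize x).-1 != 0%N by lia.
transitivity ((csize x).-2`!%:R * invfact x * \sum_j ((a + (j == ord_max) * m) * x j)%:R).
  rewrite mulr_sumr; apply: eq_bigr => j _; case: (eqVneq (x j) 0%N) => [->|xj].
    by rewrite muln0 mulr0.
  by rewrite cs// (negPf s2) invfact_cdec// natrM; ring.
(* [a |x| + m x_max = (a + 1) (|x| - 1)], because [|x| = m x_max + a + 1]. *)
rewrite -natr_sum (_ : (\sum_j _)%N = (a.+1 * (csize x).-1)%N).
  rewrite -(prednK (n := (csize x).-1)) ?lt0n// factS /= !natrM; ring.
under eq_bigr do rewrite mulnDl.
rewrite big_split /= -big_distrr /= -/(csize x) (bigD1 ord_max)//= big1 ?addn0; last first.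
  by move=> j /negPf ->; rewrite !mul0n.
rewrite eqxx mul1n sx addnS /=; ring.
Qed.

Definition forest_poly (L a n : nat) : {poly R} :=
  boxsum L (fun x => (forest_weight a x * (forest a n x)%:R) *: 'X^(nodes x)).

Lemma forest_lt a n x j : forest a n x -> (x j <= m * n + a)%N.
Proof.
move=> /andP[/eqP kx /eqP sx]; rewrite (leq_trans (leq_csize x j))// sx leq_add2r.
by rewrite leq_pmul2l// -kx (leq_trans _ (leq_keys x ord_max))//= leq_pmull.
Qed.

Lemma forest_cinc a n x j : (j <= n)%N ->
  forest a.+1 n (cinc x j 1) = forest (a + (j == ord_max) * m) (n - j) x.
Proof.
move=> jn; rewrite /forest keys_cinc csize_cinc muln1 ffunE; congr (_ && _).
  by apply/eqP/eqP; lia.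
rewrite (eq_sym j); case: (ord_max == j); rewrite ?mul1n ?mul0n ?mulnDr ?muln1 ?addn0; apply/eqP/eqP; lia.
Qed.

Lemma forest_poly0 L n : (m * n < L)%N -> forest_poly L 0 n = (n == 0%N)%:R.
Proof.
case: L => // L _; rewrite /forest_poly /boxsum (bigD1 [ffun=> ord0])//= big1 ?addr0.
  set x := cfg_of _; have x0 : x = [ffun=> 0%N] by apply/ffunP => i; rewrite !ffunE.
  have s0 : csize x = 0%N by rewrite x0 /csize big1// => i _; rewrite ffunE.
  have k0 : keys x = 0%N by rewrite x0 /keys big1// => i _; rewrite ffunE muln0.
  have -> : nodes x = 0%N by apply/eqP; have := nodes_le_keys x; rewrite k0 leqn0.
  rewrite /forest_weight /forest s0 k0 x0 ffunE muln0 addn0 eqxx mul1r andbT eq_sym.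
  by rewrite expr0; case: (n == 0%N); rewrite ?scale1r ?scale0r.
move=> y /eqP y0; rewrite /forest_weight; case: eqP => [s0|_]; last by rewrite !mul0r scale0r.
case: y0; apply/ffunP => i; apply/val_inj; rewrite ffunE /=.
by have := leq_csize (cfg_of y) i; rewrite s0 leqn0 ffunE => /eqP.
Qed.

(** The weight recursion summed over all forests; ['X^(j != ord0)] records whether the removed node
    is nonempty. *)
Lemma forest_poly_rec L a n : (m * n + a.+1 < L)%N ->
  forest_poly L a.+1 n =
  \sum_(j < m) (if (j <= n)%N then
     'X^(j != ord0) * forest_poly L (a + (j == ord_max) * m) (n - j) else 0).
Proof.
move=> hL.
pose psi (j : 'I_m) x : {poly R} := if x j == 0%N then 0 else
  (forest_weight (a + (j == ord_max) * m) (cdec x j 1) * (forest a.+1 n x)%:R) *: 'X^(nodes x).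
transitivity (\sum_j boxsum L (psi j)).
  rewrite -boxsum_sum; apply: eq_boxsum => x; rewrite /psi.
  have [fx|fx] := boolP (forest a.+1 n x); last first.
    by rewrite mulr0 scale0r big1// => j _; case: ifP => // _; rewrite mulr0 scale0r.
  rewrite mulr1 -(forest_weight_rec fx) scaler_suml; apply: eq_bigr => j _.
  by case: ifP => _; rewrite ?scale0r// mulr1.
apply: eq_bigr => j _; have [jn|nj] := leqP j n; last first.
  rewrite /boxsum big1// => y _; rewrite /psi; case: eqP => // /eqP yj.
  rewrite (_ : forest _ _ _ = false) ?mulr0 ?scale0r//.
  apply: contraTF nj => /andP[/eqP <- _]; rewrite -leqNgt.
  by rewrite (leq_trans _ (leq_keys _ j))// leq_pmulr// lt0n.
rewrite (boxsum_shift (j := j)); last 2 first.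
- by move=> x xj; rewrite /psi xj.
- move=> x xj; rewrite /psi; case: eqP => // _.
  rewrite (_ : forest _ _ _ = false) ?mulr0 ?scale0r//.
  by apply: contraTF hL => /(forest_lt j); rewrite xj -leqNgt.
rewrite /forest_poly /boxsum mulr_sumr; apply: eq_bigr => y _.
rewrite /psi cincK forest_cinc// nodes_cinc ffunE eqxx mul1n addn1 /= muln1.
by rewrite exprD -scalerAr (mulrC (GRing.exp _ (nodes _))).
Qed.

(* Lexicographic induction on [(n, a)]: the first node of a forest either leaves
   fewer keys, or is an empty leaf and leaves one tree less. *)
Lemma forest_poly_conv L n a b : (m * n + (a + b) < L)%N ->
  forest_poly L (a + b) n = \sum_(i < n.+1) forest_poly L a i * forest_poly L b (n - i).
Proof.
elim/ltn_ind: n a => n IHn; elim => [|a IHa] hL.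
  rewrite add0n big_ord_recl subn0 forest_poly0; last by rewrite muln0 (leq_ltn_trans _ hL).
  rewrite mul1r big1 ?addr0// => i _; rewrite forest_poly0 ?mul0r//.
  have hi : (m * lift ord0 i <= m * n)%N by rewrite leq_pmul2l// lift0.
  by apply: leq_ltn_trans hL; exact: (leq_trans hi (leq_addr _ _)).
rewrite addSn forest_poly_rec; last by rewrite addSn in hL.
transitivity (\sum_(i < n.+1) \sum_(j < m) (if (j <= i)%N then
     'X^(j != ord0) * forest_poly L (a + (j == ord_max) * m) (i - j) else 0)
       * forest_poly L b (n - i)); last first.
  apply: eq_bigr => i _; rewrite forest_poly_rec ?mulr_suml//.
  apply: leq_ltn_trans hL; rewrite leq_add ?leq_addr// leq_pmul2l//.
  by rewrite -ltnS.
rewrite exchange_big /=; apply: eq_bigr => j _.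
rewrite -(big_mkord predT (fun i : nat => (if (j <= i)%N then
     'X^(j != ord0) * forest_poly L (a + (j == ord_max) * m) (i - j) else 0)
       * forest_poly L b (n - i))).
have [jn|nj] := leqP j n; last first.
  rewrite big_nat_cond big1// => i /andP[/andP[_ iN] _].
  by rewrite leqNgt (leq_ltn_trans _ nj) ?mul0r.
rewrite (@big_cat_nat _ _ _ j)//=; last by rewrite leqW.
rewrite big_nat_cond big1 ?add0r; last first.
  by move=> i /andP[/andP[_ ij] _]; rewrite leqNgt ij mul0r.
rewrite -[X in index_iota X _]add0n big_addn.
under eq_bigr do rewrite leq_addl addnK.
have -> : (a + b + (j == ord_max) * m = a + (j == ord_max) * m + b)%N by lia.
rewrite subSn// big_mkord.
transitivity ('X^(j != ord0) * \sum_(i < (n - j).+1)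
   forest_poly L (a + (j == ord_max) * m) i * forest_poly L b (n - j - i)).
  congr (_ * _).
  have [j0|j0] := eqVneq j ord0.
    rewrite j0 /= addn0 subn0 IHa//.
    by apply: leq_ltn_trans hL; rewrite addSn leq_add2l.
  apply: IHn.
    by rewrite ltn_subrL lt0n; apply/andP; split; [exact: j0|move: j0; case: (n) jn => //; case: j => -[]].
  apply: leq_ltn_trans hL.
  move: jn; case: (eqVneq j ord_max) => [->|_] /=; rewrite ?mul1n ?mul0n; nia.
rewrite mulr_sumr; apply: eq_bigr => i _; rewrite mulrA; congr (_ * forest_poly _ _ _).
by rewrite addnC subnDA.
Qed.

Lemma coef_exp_forest_poly L B r s : (s < B)%N -> (m * s + r < L)%N ->
  ((\poly_(i < B) forest_poly L 1 i) ^+ r)`_s = forest_poly L r s.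
Proof.
elim: r s => [|r IHr] s sB hL; first by rewrite expr0 coef1 forest_poly0//; lia.
rewrite exprS coefM -[in RHS](add1n r) forest_poly_conv ?add1n//; apply: eq_bigr => i _.
have iS : (i <= s)%N by rewrite -ltnS.
rewrite coef_poly (leq_ltn_trans iS sB) IHr//.
  by rewrite (leq_ltn_trans (leq_subr _ _)).
by apply: leq_ltn_trans hL; rewrite leq_add// leq_pmul2l// leq_subr.
Qed.

(** The recursions for [tau] and for the law sum over maps into ['I_n]; as coefficients of a power
    they meet the forest polynomials. *)
Lemma sum_compositions (A : comNzRingType) (r n s : nat) (phi : nat -> A) :
  \sum_(J : {ffun 'I_r -> 'I_n} | (\sum_i (J i : nat) == s)%N) \prod_i phi (J i) =
  ((\poly_(i < n) phi i) ^+ r)`_s.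
Proof.
rewrite poly_def -[r in RHS]card_ord -prodr_const.
rewrite (bigA_distr_bigA (fun (_ : 'I_r) (i : 'I_n) => phi i *: 'X^i)) /= coef_sum.
rewrite [LHS]big_mkcond; apply: eq_bigr => J _.
by rewrite scaler_prod prodrXr coefZ coefXn eq_sym; case: eqP => _; rewrite ?mulr1 ?mulr0.
Qed.

(** A root that is not full has no subtree, so it must hold all [n] keys. *)
Lemma forest_poly1_small L n : (n < M)%N -> (m * n + 1 < L)%N ->
  forest_poly L 1 n = 'X^(n != 0%N).
Proof.
move=> nM hL; rewrite forest_poly_rec//.
have n_lt : (n < m)%N by rewrite ltnW.
rewrite (bigD1 (Ordinal n_lt))//= leqnn big1 ?addr0; last first.
  move=> j /eqP jn; case: leqP => // jn'.
  have -> : (j == ord_max) = false by apply/eqP => jM; move: jn'; rewrite jM /= leqNgt nM.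
  rewrite mul0n addn0 forest_poly0; last first.
    by rewrite (leq_ltn_trans _ hL)// (leq_trans _ (leq_addr _ _))// leq_pmul2l// leq_subr.
  rewrite (_ : (n - j == 0)%N = false) ?mulr0//.
  apply/eqP => nj; case: jn; apply/val_inj => /=; lia.
have -> : (Ordinal n_lt == ord_max) = false by apply/eqP => /(congr1 val) /=; lia.
rewrite mul0n addn0 subnn forest_poly0 ?muln0 ?mulr1//.
by rewrite (leq_ltn_trans _ hL).
Qed.

Lemma forest_poly1_large L n : (M <= n)%N -> (m * n + 1 < L)%N ->
  forest_poly L 1 n = 'X * forest_poly L m (n - M).
Proof.
move=> nM hL; rewrite forest_poly_rec// (bigD1 ord_max)//= nM eqxx mul1n expr1 add0n.
rewrite big1 ?addr0// => j /negPf jM; case: leqP => // jn.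
rewrite jM mul0n addn0 forest_poly0; last first.
  by rewrite (leq_ltn_trans _ hL)// (leq_trans _ (leq_addr _ _))// leq_pmul2l// leq_subr.
rewrite (_ : (n - j == 0)%N = false) ?mulr0//.
apply/eqP => nj; have := ltn_ord j; rewrite ltnS leq_eqVlt => /orP[/eqP jM'|]; last by lia.
by move: jM; rewrite (_ : j = ord_max) ?eqxx//; apply/val_inj.
Qed.

Lemma tau_aux_forest L f n : (n < f)%N -> (m * n + m < L)%N ->
  (tau_aux m f n)%:R = (forest_poly L 1 n).[1].
Proof.
elim: f n => // f IHf n nf hL /=; have [nM|Mn] := ltnP n M.
  by rewrite forest_poly1_small ?hornerXn ?expr1n//; lia.
rewrite forest_poly1_large//; last by lia.
rewrite hornerM hornerX mul1r -(coef_exp_forest_poly (B := n)); last 2 first.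
- by lia.
- by apply: leq_ltn_trans hL; rewrite leq_add2r leq_pmul2l// leq_subr.
rewrite -sum_compositions natr_sum horner_sum; apply: eq_bigr => J _.
rewrite natr_prod horner_prod; apply: eq_bigr => i _; apply: IHf.
  by rewrite (leq_trans (ltn_ord _)).
by apply: leq_ltn_trans hL; rewrite leq_add2r leq_pmul2l// ltnW.
Qed.

Lemma tau_forest L n : (m * n + m < L)%N -> (tau m n)%:R = (forest_poly L 1 n).[1].
Proof. exact: tau_aux_forest. Qed.

Lemma tau_aux_gt0 f n : (n < f)%N -> (0 < tau_aux m f n)%N.
Proof.
elim: f n => // f IHf n nf /=; have [//|Mn] := ltnP n M.
have n0 : (0 < n)%N by lia.
have nM : (n - M < n)%N by lia.
(* All remaining keys go to the first subtree. *)
pose J : {ffun 'I_m -> 'I_n} := [ffun i => if i == ord0 then Ordinal nM else Ordinal n0].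
rewrite (bigD1 J)/=; last first.
  rewrite (bigD1 ord0)//= ffunE eqxx big1 ?addn0// => i /negPf i0.
  by rewrite ffunE i0.
rewrite ltn_addr// prodn_gt0// => i; apply: IHf.
by rewrite (leq_trans (ltn_ord _)).
Qed.

Lemma tau_gt0 n : (0 < tau m n)%N. Proof. exact: tau_aux_gt0. Qed.

Lemma conv_nat_coef (I : finType) (p : I -> {poly R}) :
  \big[@conv_nat R/@dirac_nat R 0]_(i : I) (fun k => (p i)`_k) =
  (fun k => (\prod_i p i)`_k).
Proof.
rewrite (big_morph (fun (s : {poly R}) k => s`_k) (id1 := @dirac_nat R 0) (op1 := @conv_nat R))//.
- by move=> s t; apply/funext => k; rewrite coefM.
- by apply/funext => k; rewrite coef1 /dirac_nat; case: eqP.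
Qed.

(** By induction the subtrees have normalized forest polynomials as laws. Their normalizing factors
    cancel against the weights of [J], and the toll 1 is the factor ['X] of the root. *)
Lemma law_aux_forest L f n : (n < f)%N -> (m * n + m < L)%N ->
  law_aux R m f n = (fun k => ((tau m n)%:R^-1 *: forest_poly L 1 n)`_k).
Proof.
elim: f n => // f IHf n nf hL /=; have [nM|Mn] := ltnP n M.
  rewrite forest_poly1_small//; last by lia.
  rewrite /tau /= nM invr1; apply/funext => k.
  rewrite scale1r coefXn /dirac_nat; case: (n == 0%N) => /=; by case: (k == _).
apply/funext => k; rewrite forest_poly1_large//; last by lia.
rewrite coefZ coefXM; case: k => [|k] /=.
  by rewrite mulr0 big1// => J _; rewrite mulr0.
rewrite -(coef_exp_forest_poly (B := n)); last 2 first.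
- by lia.
- by apply: leq_ltn_trans hL; rewrite leq_add2r leq_pmul2l// leq_subr.
rewrite -sum_compositions coef_sum mulr_sumr; apply: eq_bigr => J _.
have -> : \big[@conv_nat R/@dirac_nat R 0]_(i < m) law_aux R m f (J i) =
  \big[@conv_nat R/@dirac_nat R 0]_(i < m)
    (fun k => ((tau m (J i))%:R^-1 *: forest_poly L 1 (J i))`_k).
  apply: eq_bigr => i _; apply: IHf.
    by rewrite (leq_trans (ltn_ord _)).
  by apply: leq_ltn_trans hL; rewrite leq_add2r leq_pmul2l// ltnW.
rewrite conv_nat_coef scaler_prod coefZ prodfV mulrA; congr (_ * _).
rewrite mulrAC mulfV ?mul1r// prodf_seq_neq0; apply/allP => i _ /=.
by rewrite pnatr_eq0 -lt0n tau_gt0.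
Qed.

(** Exceeds every count in a forest of at most [m] trees with [n] keys. *)
Definition box (n : nat) : nat := (m * n + m).+1.

(** The probability that a uniformly random tree with [n] keys has node counts [x]. *)
Definition tree_weight n x : R :=
  (forest 1 n x)%:R * ((csize x).-1`!%:R * invfact x) / (tau m n)%:R.

Definition Ecfg n (phi : cfg -> R) : R := boxsum (box n) (fun x => tree_weight n x * phi x).

Lemma tree_weight_ge0 n x : 0 <= tree_weight n x.
Proof. by rewrite /tree_weight /invfact !mulr_ge0// invr_ge0. Qed.

Lemma forest_weight1 n x : forest_weight 1 x * (forest 1 n x)%:R = tree_weight n x * (tau m n)%:R.
Proof.
rewrite /tree_weight mulfVK; last by rewrite pnatr_eq0 -lt0n tau_gt0.
rewrite mulrC; have [/andP[_ /eqP sx]|] := boolP (forest 1 n x); last by rewrite !mul0r.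
by rewrite /forest_weight sx addn1 /= !mul1r.
Qed.

Lemma Elaw_Ecfg n (g : R -> R) : Elaw m n g = Ecfg n (fun x => g (nodes x)%:R).
Proof.
have hL : (m * n + m < box n)%N by [].
rewrite /Elaw /spaceLaw (law_aux_forest _ hL)// /Ecfg /boxsum.
have t0 : (tau m n)%:R != 0 :> R by rewrite pnatr_eq0 -lt0n tau_gt0.
transitivity (\sum_(k < n.+1) \sum_(y : {ffun 'I_m -> 'I_(box n)}) tree_weight n (cfg_of y) *
    ((k == nodes (cfg_of y) :> nat)%:R * g k%:R) : R).
  apply: eq_bigr => k _; rewrite coefZ /forest_poly /boxsum coef_sum mulr_sumr mulr_suml.
  apply: eq_bigr => y _; rewrite coefZ coefXn forest_weight1.
  by field.
rewrite exchange_big; apply: eq_bigr => y _; rewrite -mulr_sumr.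
set x := cfg_of y.
have [/andP[/eqP kx _]|fx] := boolP (forest 1 n x); last first.
  by rewrite /tree_weight (negPf fx) !mul0r.
have xn : (nodes x < n.+1)%N by rewrite ltnS -kx nodes_le_keys.
congr (_ * _); rewrite (bigD1 (Ordinal xn))//= eqxx mul1r big1 ?addr0// => k.
by rewrite -val_eqE /= => /negPf ->; rewrite mul0r.
Qed.

End ForestPolynomials.

(** * The exact exchange identity *)

Section SteinIdentity.
Variables (R : realType) (q : nat).
Local Notation m := q.+2.
Local Notation M := q.+1.
Local Notation cfg := {ffun 'I_m -> nat}.
Implicit Types (x y : cfg) (i j : 'I_m).

Lemma forest_box n x j : forest 1 n x -> (x j < box q n)%N.
Proof.
by move=> /(@forest_lt _ _ _ _ j) /leq_ltn_trans; apply; rewrite ltnS leq_add2l.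
Qed.

Lemma is_mean_Ecfg n : is_mean (@Ecfg R q) (fun n x => forest 1 n x) n.
Proof.
split.
- move=> p r; rewrite /Ecfg -boxsumD; apply: eq_boxsum => x; exact: mulrDr.
- move=> c p; rewrite /Ecfg /boxsum mulr_sumr; apply: eq_bigr => x _; exact: mulrCA.
- have hL : (m * n + m < box q n)%N by [].
  have t0 : (tau m n)%:R != 0 :> R by rewrite pnatr_eq0 -lt0n tau_gt0.
  apply: (mulIf t0); rewrite mul1r [RHS](tau_forest R hL) /forest_poly /boxsum horner_sum.
  rewrite /Ecfg /boxsum mulr_suml; apply: eq_bigr => y _.
  by rewrite hornerZ hornerXn expr1n !mulr1 forest_weight1.
- move=> p r pr; apply: ler_sum => y _.
  have [fx|fx] := boolP (forest 1 n (cfg_of y)).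
    by rewrite ler_wpM2l ?tree_weight_ge0// pr.
  by rewrite /tree_weight (negPf fx) !mul0r.
Qed.

(** [x_j (x_j - 1) ... (x_j - s + 1) / x_j! = 1 / (x_j - s)!], then [x = y + s e_j]: as for Poisson
    variables, a falling factorial turns into a shift. *)
Lemma invfact_ffact L j s (psi : cfg -> R) :
  (forall x, (L <= x j)%N -> psi x = 0) ->
  boxsum L (fun x => invfact R x * (((x j) ^_ s)%:R * psi x)) =
  boxsum L (fun y => invfact R y * psi (cinc y j s)).
Proof.
elim: s psi => [|s IHs] psi psiL.
  apply: eq_boxsum => x; rewrite ffactn0 mul1r; congr (_ * psi _).
  by apply/ffunP => i; rewrite ffunE muln0 addn0.
rewrite (boxsum_shift (j := j)); last 2 first.
- by move=> x ->; rewrite ffact0n mul0r mulr0.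
- by move=> x xj; rewrite psiL ?xj// !mulr0.
transitivity (boxsum L (fun y => invfact R y * ((y j ^_ s)%:R * psi (cinc y j 1)))).
  apply: eq_boxsum => y; rewrite -[in RHS](invfact_cinc R y j).
  rewrite ffunE eqxx mul1n addn1 ffactSS natrM.
  by rewrite mulrA mulrA mulrA; congr (_ * _ * _); rewrite mulrC.
rewrite (IHs (fun y => psi (cinc y j 1))).
  apply: eq_boxsum => y; congr (_ * psi _); apply/ffunP => i; rewrite !ffunE.
  by rewrite muln1 mulnS addnAC addnA.
by move=> x xj; apply: psiL; rewrite ffunE (leq_trans xj)// leq_addr.
Qed.

(* [M] leaves with [b] keys are replaced by as many leaves with [a = b - 1] keys,
   [M] empty leaves, and one full node, which preserves the number of keys. *)
Definition exchange (a b : 'I_m) x : cfg :=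
  cinc (cinc (cinc (cdec x b M) a M) ord0 M) ord_max 1.

(** An exchange adds [m] nodes, so the first factor is the quotient of the new and the old
    [(|x| - 1)!]. The second vanishes when fewer than [M] leaves hold [b] keys, so the truncated
    subtraction in [exchange] is harmless. *)
Definition rate_out (b : 'I_m) x : nat := ((csize x + M) ^_ m * (x b) ^_ M)%N.

(** For [a = 0] both batches of [M] leaves are empty and are drawn one after the other, hence the
    decrement in the second factor. *)
Definition rate_in (a : 'I_m) x : nat :=
  ((x a) ^_ M * (x ord0 - (a == ord0) * M) ^_ M * x ord_max)%N.

(** Both sides reduce to one sum over the configuration [y] without the [M] exchanged leaves: the
    source is [y] with [M] leaves holding [b] keys, the target is [y] with the new nodes, and the
    remaining factorials agree. *)
Lemma Ecfg_exchange n (a b : 'I_m) (f : cfg -> R) :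
  b = a.+1 :> nat -> (b < M)%N ->
  Ecfg n (fun x => f (exchange a b x) * (rate_out b x)%:R) =
  Ecfg n (fun x => f x * (rate_in a x)%:R).
Proof.
move=> ab bM.
have t0 : (tau m n)%:R != 0 :> R by rewrite pnatr_eq0 -lt0n tau_gt0.
apply: (mulIf t0).
have bmax : (ord_max == b) = false by apply/eqP => /(congr1 val) /=; lia.
have amax : (ord_max == a) = false by apply/eqP => /(congr1 val) /=; lia.
have omax : (ord_max == ord0 :> 'I_m) = false by apply/eqP => /(congr1 val).
pose psi1 x : R := (forest 1 n x)%:R * ((csize x).-1`!%:R *
  (((csize x + M) ^_ m)%:R * f (exchange a b x))).
pose psi2 x : R := (forest 1 n x)%:R * ((csize x).-1`!%:R * f x).
have psi2L x j : (box q n <= x j)%N -> psi2 x = 0.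
  move=> xj; rewrite /psi2 (_ : forest _ _ _ = false) ?mul0r//.
  by apply: contraTF xj => /(forest_box j); rewrite -ltnNge.
have psi1L x j : (box q n <= x j)%N -> psi1 x = 0.
  move=> xj; rewrite /psi1 (_ : forest _ _ _ = false) ?mul0r//.
  by apply: contraTF xj => /(forest_box j); rewrite -ltnNge.
transitivity (boxsum (box q n) (fun y => invfact R y * psi1 (cinc y b M))).
  rewrite -invfact_ffact; last by move=> x /psi1L.
  rewrite /Ecfg /boxsum mulr_suml; apply: eq_bigr => y _.
  rewrite /tree_weight /psi1 /rate_out natrM; field; exact: t0.
transitivity (boxsum (box q n) (fun y => invfact R y *
    psi2 (cinc (cinc (cinc y ord_max 1) ord0 M) a M))); last first.
  rewrite -(invfact_ffact (L := box q n) (j := ord_max) 1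
    (psi := fun y => psi2 (cinc (cinc y ord0 M) a M))); last first.
    move=> x xj; apply: (psi2L _ ord_max); rewrite !ffunE; lia.
  transitivity (boxsum (box q n) (fun y => invfact R y *
     (((y ord0) ^_ M)%:R * ((y ord_max)%:R * psi2 (cinc y a M))))).
    rewrite (invfact_ffact (L := box q n) (j := ord0) M
      (psi := fun y => (y ord_max)%:R * psi2 (cinc y a M))); last first.
      move=> x xj; rewrite (psi2L _ ord0) ?mulr0//; rewrite !ffunE; lia.
    by apply: eq_boxsum => y; rewrite ffactn1 ffunE omax mul0n addn0.
  transitivity (boxsum (box q n) (fun y => invfact R y *
     ((y a ^_ M)%:R * (((y ord0 - (a == ord0) * M) ^_ M)%:R * ((y ord_max)%:R * psi2 y))))).
    rewrite (invfact_ffact (L := box q n) (j := a) M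
      (psi := fun y => ((y ord0 - (a == ord0) * M) ^_ M)%:R * ((y ord_max)%:R * psi2 y))); last first.
      by move=> x xj; rewrite (psi2L _ a) ?mulr0.
    apply: eq_boxsum => y; rewrite !ffunE amax mul0n addn0 (eq_sym a) addnK//.
  rewrite /Ecfg /boxsum mulr_suml; apply: eq_bigr => y _.
  rewrite /tree_weight /psi2 /rate_in !natrM; field; exact: t0.
apply: eq_boxsum => y; congr (_ * _); rewrite /psi1 /psi2.
have -> : exchange a b (cinc y b M) = cinc (cinc (cinc y ord_max 1) ord0 M) a M.
  by rewrite /exchange cincK; apply/ffunP => i; rewrite !ffunE; lia.
rewrite /forest !keys_cinc !csize_cinc !ffunE bmax amax omax eqxx !mul0n mul1n !addn0.
have -> : (keys y + b * M = keys y + (ord_max : 'I_m) * 1 + a * M)%N by rewrite ab mulSn muln1 addnA.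
have -> : (csize y + M == m * y ord_max + 1)%N = (csize y + 1 + M + M == m * (y ord_max + 1) + 1)%N.
  by apply/eqP/eqP; lia.
congr (_ * _); rewrite mulrA -natrM; congr (_%:R * _).
have -> : (csize y + M + M = ((csize y + M).-1 + m))%N by lia.
rewrite mulnC -{2}(addnK m (csize y + M).-1) ffact_fact ?leq_addl//; congr (_`!); lia.
Qed.

End SteinIdentity.

(** * Domination calculus and stability of the equilibrium *)

Section Domination.
Variables (R : realFieldType) (T : Type) (D : T -> Prop).
Implicit Types (e p r : T -> R) (c : R).

(** [p = O(e)] uniformly on [D]: errors are compared pointwise, before any expectation is taken. *)
Definition domin e p := exists2 C : R, 0 <= C & forall x, D x -> `|p x| <= C * e x.

Definition gauge e := forall x, D x -> 0 <= e x.

Lemma eq_domin e p r : (forall x, D x -> p x = r x) -> domin e p -> domin e r.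
Proof. by move=> pr [C C0 h]; exists C => // x Dx; rewrite -pr// h. Qed.

Lemma dominW e e' p : domin e' e -> domin e p -> domin e' p.
Proof.
move=> [C C0 h] [C' C'0 h']; exists (C' * C); first exact: mulr_ge0.
move=> x Dx; rewrite (le_trans (h' _ Dx))// -mulrA ler_wpM2l//.
by rewrite (le_trans (ler_norm _))// h.
Qed.

Lemma domin_refl e : gauge e -> domin e e.
Proof. by move=> e0; exists 1 => // x Dx; rewrite mul1r ger0_norm ?e0. Qed.

Lemma dominD e p r : domin e p -> domin e r -> domin e (fun x => p x + r x).
Proof.
move=> [C C0 h] [C' C'0 h']; exists (C + C'); first exact: addr_ge0.
by move=> x Dx; rewrite mulrDl (le_trans (ler_normD _ _))// lerD ?h ?h'.
Qed.

Lemma dominN e p : domin e p -> domin e (fun x => - p x).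
Proof. by move=> [C C0 h]; exists C => // x Dx; rewrite normrN h. Qed.

Lemma dominB e p r : domin e p -> domin e r -> domin e (fun x => p x - r x).
Proof. by move=> hp hr; apply: dominD => //; exact: dominN. Qed.

Lemma dominM e e' p r : domin e p -> domin e' r ->
  domin (fun x => e x * e' x) (fun x => p x * r x).
Proof.
move=> [C C0 h] [C' C'0 h']; exists (C * C'); first exact: mulr_ge0.
by move=> x Dx; rewrite normrM mulrACA ler_pM ?h ?h'.
Qed.

Lemma domin_cst c : domin (fun=> 1) (fun=> c).
Proof. by exists `|c| => // x _; rewrite mulr1. Qed.

Lemma dominMr e p r : domin (fun=> 1) p -> domin e r -> domin e (fun x => p x * r x).
Proof.
move=> hp hr; have [C C0 h] := dominM hp hr; exists C => // x Dx.
by have := h x Dx; rewrite mul1r.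
Qed.

Lemma dominMl e p r : domin (fun=> 1) p -> domin e r -> domin e (fun x => r x * p x).
Proof.
move=> hp hr; apply: eq_domin (dominMr hp hr) => x _; exact: mulrC.
Qed.

Lemma dominZ e c p : domin e p -> domin e (fun x => c * p x).
Proof. by move=> hp; apply: dominMr => //; exact: domin_cst. Qed.

Lemma domin_sum (I : Type) (s : seq I) (P : pred I) e (F : I -> T -> R) : gauge e ->
  (forall i, P i -> domin e (F i)) -> domin e (fun x => \sum_(i <- s | P i) F i x).
Proof.
move=> e0 h; elim: s => [|i s IHs].
  exists 0 => // x Dx; by rewrite big_nil normr0 mul0r.
have [Pi|nPi] := boolP (P i); last first.
  by apply: eq_domin IHs => x _; rewrite big_cons (negPf nPi).
by apply: eq_domin (dominD (h i Pi) IHs) => x _; rewrite big_cons Pi.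
Qed.

Lemma dominX p n : domin (fun=> 1) p -> domin (fun=> 1) (fun x => p x ^+ n).
Proof.
move=> hp; elim: n => [|n IHn]; first exact: domin_cst.
by apply: eq_domin (dominMr hp IHn) => x _; rewrite exprS.
Qed.

Lemma dominBM e p p' r r' : domin (fun=> 1) p -> domin (fun=> 1) r' ->
  domin e (fun x => p x - p' x) -> domin e (fun x => r x - r' x) ->
  domin e (fun x => p x * r x - p' x * r' x).
Proof.
move=> hp hr' h h'; apply: eq_domin (dominD (dominMr hp h') (dominMl hr' h)) => x _; ring.
Qed.

Lemma domin1B e p p' : domin (fun=> 1) e -> domin (fun=> 1) p ->
  domin e (fun x => p x - p' x) -> domin (fun=> 1) p'.
Proof.
move=> he hp h; have h1 : domin (fun=> 1) (fun x => p x - p' x) by exact: dominW h.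
apply: eq_domin (dominB hp h1) => x _; ring.
Qed.

Lemma dominBX e p p' n : domin (fun=> 1) e -> gauge e -> domin (fun=> 1) p ->
  domin e (fun x => p x - p' x) -> domin e (fun x => p x ^+ n - p' x ^+ n).
Proof.
move=> he e0 hp h; have hp' := domin1B he hp h.
elim: n => [|n IHn].
  exists 0 => // x Dx; by rewrite subrr normr0 mul0r.
apply: eq_domin (dominBM hp (dominX n hp') h IHn) => x _.
by rewrite !exprS.
Qed.

End Domination.

Section Stability.
Variables (R : realFieldType) (T : Type) (D : T -> Prop) (M : nat) (c rho kmin : R).
Variables (p : nat -> T -> R) (kap eta : T -> R).
Hypotheses (M0 : (0 < M)%N) (c0 : 0 < c) (rho0 : 0 < rho) (kmin0 : 0 < kmin).
Hypothesis hrho : c * \sum_(k < M) rho ^+ k.+1 = M%:R.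
Hypothesis p_ge0 : forall k x, D x -> 0 <= p k x.
Hypothesis kap_ge : forall x, D x -> kmin <= kap x.
Hypothesis p_bd : forall k, domin D (fun=> 1) (p k).
Hypothesis kap_bd : domin D (fun=> 1) kap.
Hypothesis eta_ge0 : gauge D eta.
Hypothesis eta_bd : domin D (fun=> 1) eta.
Hypothesis leaves : domin D eta (fun x => \sum_(k < M) p k x - M%:R * kap x).
Hypothesis keyed : forall x, D x -> \sum_(k < M) k%:R * p k x + M%:R * kap x = 1.
Hypothesis ratios : forall k, (k.+1 < M)%N ->
  domin D eta (fun x => p k x * p 0%N x - c * kap x * p k.+1 x).

Let S1 := \sum_(k < M) k%:R * rho ^+ k.

Let kapstar := (c * rho * S1 + M%:R)^-1.

(** With [r = p_0 / (c kap)], [ratios] give [p_k ~ c kap r^(k+1)]; then [leaves] reads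
    [c (r + ... + r^M) ~ M], which forces [r ~ rho] by monotonicity, and [keyed] fixes [kap]. Each
    step costs a constant times [eta]. *)
Lemma stability :
  (forall k, (k < M)%N -> domin D eta (fun x => p k x - c * kapstar * rho ^+ k.+1)) /\
  domin D eta (fun x => kap x - kapstar).
Proof.
have kap0 x : D x -> kap x != 0.
  by move=> Dx; rewrite gt_eqF// (lt_le_trans kmin0)// kap_ge.
have c_neq0 : c != 0 by rewrite gt_eqF.
have kapV_bd : domin D (fun=> 1) (fun x => (kap x)^-1).
  exists kmin^-1; first by rewrite invr_ge0 ltW.
  move=> x Dx; have k0 := lt_le_trans kmin0 (kap_ge Dx).
  by rewrite mulr1 gtr0_norm ?invr_gt0// lef_pV2 ?posrE// kap_ge.
pose r x := p 0%N x / (c * kap x).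
have rE x : D x -> p 0%N x = c * kap x * r x.
  by move=> Dx; rewrite /r; field; rewrite kap0.
have r_bd : domin D (fun=> 1) r.
  apply: eq_domin (dominMr (dominZ c^-1 kapV_bd) (p_bd 0)) => x Dx.
  by rewrite /r; field; rewrite kap0.
have r_ge0 x : D x -> 0 <= r x.
  move=> Dx; rewrite /r divr_ge0 ?p_ge0// mulr_ge0 ?(ltW c0)//.
  by rewrite (le_trans (ltW kmin0))// kap_ge.
have geo k : (k < M)%N -> domin D eta (fun x => p k x - r x ^+ k * p 0%N x).
  elim: k => [|k IHk] kM.
    by exists 0 => // x _; rewrite expr0 mul1r subrr normr0 mul0r.
  apply: eq_domin (dominB (dominMr r_bd (IHk (ltnW kM)))
    (dominMr (dominZ c^-1 kapV_bd) (ratios kM))) => x Dx.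
  by rewrite exprS /r; field; rewrite kap0.
have h2 : domin D eta (fun x => c * \sum_(k < M) r x ^+ k.+1 - M%:R).
  have h1 : domin D eta (fun x => \sum_(k < M) (p k x - r x ^+ k * p 0%N x)).
    by apply: domin_sum => // k _; exact: geo.
  apply: eq_domin (dominMr kapV_bd (dominB leaves h1)) => x Dx.
  rewrite sumrB -mulr_suml rE//.
  under [in RHS]eq_bigr do rewrite exprSr.
  by rewrite -mulr_suml; field; rewrite kap0.
have h3 : domin D eta (fun x => r x - rho).
  have [C C0 h] := h2; exists (C / c); first by rewrite divr_ge0// ltW.
  move=> x Dx; rewrite mulrAC ler_pdivlMr//.
  apply: le_trans (h x Dx); rewrite -hrho -mulrBr normrM (gtr0_norm c0) mulrC ler_pM2l//.
  (* All differences [r^(k+1) - rho^(k+1)] have the sign of [r - rho], so the sum is in absolute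
     value at least its first term. *)
  rewrite -sumrB; case: M M0 => // M' _.
  rewrite big_ord_recl !expr1.
  have [rr|rr] := leP rho (r x).
    have hs : 0 <= \sum_(i < M') (r x ^+ (lift ord0 i).+1 - rho ^+ (lift ord0 i).+1).
      by apply: sumr_ge0 => i _; rewrite subr_ge0 lerXn2r ?nnegrE ?r_ge0// ltW.
    have rr' : 0 <= r x - rho by rewrite subr_ge0.
    by rewrite (ger0_norm rr') (ger0_norm (addr_ge0 rr' hs)) lerDl.
  have hs : \sum_(i < M') (r x ^+ (lift ord0 i).+1 - rho ^+ (lift ord0 i).+1) <= 0.
    by apply: sumr_le0 => i _; rewrite subr_le0 lerXn2r ?nnegrE ?r_ge0// ltW.
  have rr' : r x - rho <= 0 by rewrite subr_le0 ltW.
  by rewrite (ler0_norm rr') ler0_norm ?lerN2 ?gerDl// -[leRHS]addr0 lerD.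
have h4 k : domin D eta (fun x => r x ^+ k - rho ^+ k) by exact: dominBX.
have h5 k : (k < M)%N -> domin D eta (fun x => p k x - c * rho ^+ k.+1 * kap x).
  move=> kM; apply: eq_domin (dominD (geo k kM) (dominMr (dominZ c kap_bd) (h4 k.+1))) => x Dx.
  by rewrite rE// exprS; ring.
have S1_ge0 : 0 <= S1.
  by apply: sumr_ge0 => k _; rewrite mulr_ge0// exprn_ge0// ltW.
have M0' : 0 < M%:R :> R by rewrite ltr0n.
have den0 : 0 < c * rho * S1 + M%:R by rewrite ltr_wpDl// !mulr_ge0// ltW.
have h6 : domin D eta (fun x => kap x - kapstar).
  have h : domin D eta (fun x => \sum_(k < M) k%:R * (p k x - c * rho ^+ k.+1 * kap x)).
    by apply: domin_sum => // k _; apply: dominZ; exact: h5.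
  (* By [keyed] the weighted sum equals [1 - kap / kapstar]. *)
  apply: eq_domin (dominZ (- kapstar) h) => x Dx.
  have -> : \sum_(k < M) k%:R * (p k x - c * rho ^+ k.+1 * kap x) =
     1 - M%:R * kap x - c * rho * S1 * kap x.
    rewrite -[X in X - _ - _](keyed Dx) addrK /S1 mulr_sumr mulr_suml -sumrB.
    by apply: eq_bigr => k _; rewrite exprS; ring.
  by rewrite /kapstar; field; rewrite gt_eqF.
split => // k kM; apply: eq_domin (dominD (h5 k kM) (dominZ (c * rho ^+ k.+1) h6)) => x Dx.
ring.
Qed.

End Stability.

Lemma exprB_ge (R : realDomainType) (a b : R) n : 0 <= b -> b <= a ->
  (a - b) ^+ n.+1 <= a ^+ n.+1 - b ^+ n.+1.
Proof.
move=> b0 ba; rewrite -subr_ge0; have ab0 : 0 <= a - b by rewrite subr_ge0.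
elim: n => [|n IHn]; first by rewrite !expr1; lra.
have a0 : 0 <= a by exact: le_trans ba.
have := addr_ge0 (mulr_ge0 a0 IHn) (addr_ge0 (mulr_ge0 ab0 (exprn_ge0 n.+1 b0))
  (mulr_ge0 b0 (exprn_ge0 n.+1 ab0))).
by rewrite !(exprS _ n.+1); congr (_ <= _); ring.
Qed.

Lemma norm_exprB_ge (R : realDomainType) (a b : R) n : 0 <= a -> 0 <= b ->
  `|a - b| ^+ n.+1 <= `|a ^+ n.+1 - b ^+ n.+1|.
Proof.
move=> a0 b0; wlog ba : a b a0 b0 / b <= a => [h|].
  have [ba|/ltW ab] := leP b a; first exact: h.
  by rewrite distrC [leRHS]distrC h.
rewrite !ger0_norm ?subr_ge0//; first exact: exprB_ge.
by rewrite lerXn2r.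
Qed.

(** Inverts the power at Lipschitz rate where [a] is bounded below, whereas [norm_exprB_ge] gives a
    Hoelder rate everywhere. *)
Lemma norm_exprB_ge_max (R : realDomainType) (a b : R) n : 0 <= a -> 0 <= b ->
  `|a - b| * a ^+ n <= `|a ^+ n.+1 - b ^+ n.+1|.
Proof.
move=> a0 b0; have [ba|/ltW ab] := leP b a.
  rewrite !ger0_norm ?subr_ge0//; last by rewrite lerXn2r.
  rewrite mulrBl -exprS lerD2l lerN2 exprS ler_wpM2l//.
  by rewrite lerXn2r.
rewrite distrC [leRHS]distrC !ger0_norm ?subr_ge0//; last by rewrite lerXn2r.
rewrite mulrBl -exprS lerD2r exprS ler_wpM2l//.
by rewrite lerXn2r.
Qed.

Section Root.
Variables (R : realType) (T : Type) (D : T -> Prop).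

Lemma domin_root (n : nat) (e a b : T -> R) : gauge D e ->
  (forall x, D x -> 0 <= a x) -> (forall x, D x -> 0 <= b x) ->
  domin D e (fun x => a x ^+ n.+1 - b x ^+ n.+1) ->
  domin D (fun x => e x `^ n.+1%:R^-1) (fun x => a x - b x).
Proof.
move=> e0 a0 b0 [C C0 h].
have root (z : R) : 0 <= z -> (z ^+ n.+1) `^ n.+1%:R^-1 = z.
  by move=> z0; rewrite -powR_mulrn// -powRrM mulfV ?powRr1// pnatr_eq0.
exists (C `^ n.+1%:R^-1); first exact: powR_ge0.
move=> x Dx; rewrite -[leLHS]root// -powRM ?e0//.
apply: ge0_ler_powR; rewrite ?invr_ge0// ?nnegrE ?exprn_ge0//; first by rewrite mulr_ge0 ?e0.
by apply: le_trans (h x Dx); rewrite norm_exprB_ge ?a0 ?b0.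
Qed.

Lemma powR_root_expr (n : nat) (z : R) : 0 <= z -> (z `^ n.+1%:R^-1) ^+ n.+1 = z.
Proof.
by move=> z0; rewrite -powR_mulrn ?powR_ge0// -powRrM mulVf ?powRr1// pnatr_eq0.
Qed.

(* Near a nonzero value [A], [a ^ n - b ^ n] controls [a - b]; away from it,
   [e] is bounded below. *)
Lemma domin_root_nondegenerate (n : nat) (A : R) (e a b : T -> R) : 0 < A -> gauge D e ->
  (forall x, D x -> 0 <= a x) -> (forall x, D x -> 0 <= b x) ->
  domin D (fun=> 1) (fun x => a x - b x) ->
  domin D e (fun x => a x ^+ n.+1 - b x ^+ n.+1) ->
  domin D (fun x => e x `^ n.+1%:R^-1) (fun x => a x - A) ->
  domin D e (fun x => a x - b x).
Proof.
move=> A0 e0 a0 b0 [C3 C30 h3] [C2 C20 h2] [C1 C10 h1].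
have A20 : 0 < A / 2 by rewrite divr_gt0.
exists (C2 / (A / 2) ^+ n + C3 * C1 ^+ n.+1 / (A / 2) ^+ n.+1).
  by rewrite addr_ge0// ?divr_ge0 ?mulr_ge0 ?exprn_ge0// ltW.
move=> x Dx; have [aA|aA] := leP (A / 2) (a x).
  rewrite mulrDl (@le_trans _ _ (C2 / (A / 2) ^+ n * e x))//; last first.
    by rewrite lerDl mulr_ge0 ?e0// divr_ge0 ?mulr_ge0 ?exprn_ge0// ltW.
  rewrite mulrAC ler_pdivlMr ?exprn_gt0//.
  apply: le_trans (h2 x Dx); apply: le_trans (norm_exprB_ge_max n (a0 _ Dx) (b0 _ Dx)).
  by rewrite ler_wpM2l// lerXn2r ?nnegrE ?a0 ?(ltW A20).
rewrite mulrDl (@le_trans _ _ (C3 * C1 ^+ n.+1 / (A / 2) ^+ n.+1 * e x))//; last first.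
  by rewrite lerDr mulr_ge0 ?e0// divr_ge0 ?mulr_ge0 ?exprn_ge0// ltW.
have hA : A / 2 <= C1 * e x `^ n.+1%:R^-1.
  apply: le_trans (h1 x Dx); rewrite ler0_norm; lra.
have {}hA : (A / 2) ^+ n.+1 <= C1 ^+ n.+1 * e x.
  rewrite -[e x](@powR_root_expr n) ?e0// -exprMn lerXn2r ?nnegrE ?(ltW A20)//.
  by rewrite mulr_ge0// powR_ge0.
apply: le_trans (h3 x Dx) _; rewrite mulr1 -!mulrA ler_peMr// mulrCA.
by rewrite ler_pdivlMl ?exprn_gt0// mulr1.
Qed.

End Root.

(** * Proportions of the node types *)

Section Proportions.
Variables (R : realType) (q : nat).
Local Notation m := q.+2.
Local Notation M := q.+1.
Local Notation cfg := {ffun 'I_m -> nat}.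
Implicit Types (x y : cfg) (i j : 'I_m).

Definition num_keys x : R := (keys x)%:R.
(** Indexed by [nat], so that inductions on [k] avoid ordinals; full nodes are kept apart in
    [full]. *)
Definition prop (k : nat) x : R := (x (inord k))%:R / num_keys x.
Definition full x : R := (x ord_max)%:R / num_keys x.

(* The lower bound on the number of keys keeps [full x] away from 0. *)
Definition large_tree x : bool :=
  (csize x == m * x ord_max + 1)%N && (2 * m <= keys x)%N.

Local Notation D := large_tree.
Local Notation invN := (fun x => (num_keys x)^-1).
Local Notation dom := (domin D).

Lemma num_keys_ge x : D x -> 2 * m%:R <= num_keys x.
Proof. by move=> /andP[_ h]; rewrite /num_keys -natrM ler_nat. Qed.

Lemma num_keys_gt0 x : D x -> 0 < num_keys x.
Proof. by move=> Dx; apply: lt_le_trans (num_keys_ge Dx); rewrite mulr_gt0. Qed.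

Lemma num_keys_neq0 x : D x -> num_keys x != 0.
Proof. by move=> Dx; rewrite gt_eqF ?num_keys_gt0. Qed.

Lemma invN_ge0 : gauge D invN.
Proof. by move=> x Dx; rewrite invr_ge0 ltW ?num_keys_gt0. Qed.

Lemma invN_bd : dom (fun=> 1) invN.
Proof.
exists 1 => // x Dx; rewrite mulr1 ger0_norm ?invN_ge0//.
rewrite invf_le1 ?num_keys_gt0//; apply: le_trans (num_keys_ge Dx).
by rewrite -natrM ler1n.
Qed.

Lemma count_bd j : dom (fun=> 1) (fun x => (x j)%:R / num_keys x).
Proof.
exists (m%:R + 1); first by rewrite addr_ge0.
move=> x Dx; rewrite mulr1 ger0_norm ?divr_ge0// ?(ltW (num_keys_gt0 Dx))//.
rewrite ler_pdivrMr ?num_keys_gt0// /num_keys natr1 -natrM ler_nat.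
case/andP: Dx => /eqP sx kx; rewrite (leq_trans (leq_csize x j))// sx.
have := leq_keys x ord_max => /= h; nia.
Qed.

Lemma prop_bd k : dom (fun=> 1) (prop k). Proof. exact: count_bd. Qed.
Lemma full_bd : dom (fun=> 1) full. Proof. exact: count_bd. Qed.

Lemma prop_ge0 k x : D x -> 0 <= prop k x.
Proof. by move=> Dx; rewrite divr_ge0// ltW ?num_keys_gt0. Qed.

Lemma full_ge0 x : D x -> 0 <= full x.
Proof. by move=> Dx; rewrite divr_ge0// ltW ?num_keys_gt0. Qed.

Lemma sum_inord (F : nat -> nat -> nat) x :
  (\sum_(j < m) F j (x j) = \sum_(k < M) F k (x (inord k)) + F M (x ord_max))%N.
Proof.
rewrite big_ord_recr /=; congr (_ + _)%N; apply: eq_bigr => k _; congr (F _ (x _)).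
by apply/val_inj; rewrite /= inordK// ltnW// ltnS.
Qed.

Lemma csizeE x : D x -> (csize x)%:R / num_keys x = m%:R * full x + invN x.
Proof. by move=> /andP[/eqP -> _]; rewrite natrD natrM mulrDl mul1r mulrA. Qed.

Lemma sum_prop x : D x -> \sum_(k < M) prop k x = M%:R * full x + invN x.
Proof.
move=> Dx; have := csizeE Dx; rewrite /csize (sum_inord (fun _ => id)) natrD natr_sum.
rewrite mulrDl mulr_suml -/(full x) => /(canRL (addrK _)) ->.
by rewrite -natr1; ring.
Qed.

Lemma sum_keyed_prop x : D x -> \sum_(k < M) k%:R * prop k x + M%:R * full x = 1.
Proof.
move=> Dx; rewrite -[RHS](divff (num_keys_neq0 Dx)) {1}/num_keys /keys.
rewrite (sum_inord (fun k n => k * n)%N) natrD natr_sum mulrDl natrM mulr_suml.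
by congr (_ + _); rewrite ?mulrA//; apply: eq_bigr => k _; rewrite natrM mulrA.
Qed.

Definition full_min : R := (2 * M%:R ^+ 2)^-1.

Lemma full_min_gt0 : 0 < full_min.
Proof. by rewrite invr_gt0 mulr_gt0 ?exprn_gt0. Qed.

(** A leaf holds at most [q = m - 2] keys, so the two constraints give [1 <= M^2 * full x + q / N],
    with [q / N <= 1 / 2] for a large tree. *)
Lemma full_ge x : D x -> full_min <= full x.
Proof.
move=> Dx; have h1 := sum_keyed_prop Dx; have h2 := sum_prop Dx.
have h3 : \sum_(k < M) k%:R * prop k x <= q%:R * \sum_(k < M) prop k x.
  rewrite mulr_sumr; apply: ler_sum => k _; rewrite ler_wpM2r ?prop_ge0//.
  by rewrite ler_nat -ltnS.
have Nx := num_keys_ge Dx; have N0 := num_keys_gt0 Dx.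
have h4 : q%:R * invN x <= 2^-1.
  rewrite ler_pdivrMr// mulrC ler_pdivlMr// (le_trans _ Nx)//.
  by rewrite -!natrM ler_nat; lia.
rewrite /full_min -[leLHS]mul1r ler_pdivrMr ?mulr_gt0 ?exprn_gt0//.
have : M%:R = q%:R + 1 :> R by rewrite natr1.
move: h1 h2 h3 h4; move: (full x) (\sum_(k < M) _) (\sum_(k < M) _) => f a b.
by move=> h1 h2 h3 h4 hM; rewrite hM in h1 h2 h3 h4 *; rewrite h2 in h3; nra.
Qed.

Lemma fullV_bd : dom (fun=> 1) (fun x => (full x)^-1).
Proof.
exists full_min^-1; first by rewrite invr_ge0 ltW ?full_min_gt0.
move=> x Dx; have k0 := lt_le_trans full_min_gt0 (full_ge Dx).
by rewrite mulr1 gtr0_norm ?invr_gt0// lef_pV2 ?posrE ?full_min_gt0// full_ge.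
Qed.

Lemma domin_ffact (cc : cfg -> nat) (s : nat) (phi : cfg -> R) :
  dom (fun=> 1) phi -> dom invN (fun x => (cc x)%:R / num_keys x - phi x) ->
  dom invN (fun x => ((cc x) ^_ s)%:R / num_keys x ^+ s - phi x ^+ s).
Proof.
move=> bphi h; elim: s => [|s IHs].
  by exists 0 => // x _; rewrite !expr0 divr1 subrr normr0 mul0r.
have h' : dom invN (fun x => (cc x - s)%:R / num_keys x - phi x).
  have h2 : dom invN (fun x => (cc x - s)%:R / num_keys x - (cc x)%:R / num_keys x).
    exists s%:R => // x Dx; rewrite -mulrBl normrM (ger0_norm (invN_ge0 Dx)).
    rewrite ler_wpM2r ?invN_ge0// ler_norml.
    have [sc|/ltnW cs] := leqP s (cc x).
      by rewrite natrB//; have : 0 <= s%:R :> R by []; lra.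
    rewrite (eqP (_ : (cc x - s)%N == 0%N)) ?subn_eq0// sub0r lerN2 ler_nat cs /=.
    by have : 0 <= s%:R :> R by []; have : 0 <= (cc x)%:R :> R by []; lra.
  by apply: eq_domin (dominD h2 h) => x Dx; ring.
have bs : dom (fun=> 1) (fun x => ((cc x) ^_ s)%:R / num_keys x ^+ s).
  apply: eq_domin (dominD (dominW invN_bd IHs) (dominX s bphi)) => x Dx; ring.
apply: eq_domin (dominBM bs bphi IHs h') => x Dx.
rewrite ffactnSr natrM !exprSr; have := num_keys_neq0 Dx.
by move: (num_keys x) => N N0; field; rewrite expf_neq0 N0.
Qed.

(** Both rates have degree [m + M = 2 M + 1] in the counts, which explains the power of
    [num_keys]. *)
Definition out_rate (k : nat) x : R :=
  (rate_out (inord k.+1) x)%:R / num_keys x ^+ (m + M).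
Definition in_rate (k : nat) x : R :=
  (rate_in (inord k) x)%:R / num_keys x ^+ (m + M).
Definition imbalance (k : nat) x : R := in_rate k x - out_rate k x.

Lemma out_rateE k x : out_rate k x =
  (((csize x + M) ^_ m)%:R / num_keys x ^+ m) * ((x (inord k.+1) ^_ M)%:R / num_keys x ^+ M).
Proof. by rewrite /out_rate natrM exprD invfM mulrACA. Qed.

Lemma in_rateE k x : D x -> in_rate k x =
  ((x (inord k) ^_ M)%:R / num_keys x ^+ M) *
  (((x ord0 - (inord k == ord0 :> 'I_m) * M) ^_ M)%:R / num_keys x ^+ M) * full x.
Proof.
move=> Dx; rewrite /in_rate /full !natrM (_ : m + M = M + M + 1)%N; last by lia.
rewrite !exprD expr1; have := num_keys_neq0 Dx.
by move: (num_keys x) => N N0; field; rewrite expf_neq0 N0.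
Qed.

Lemma csize_approx : dom invN (fun x => (csize x + M)%:R / num_keys x - m%:R * full x).
Proof.
exists m%:R => // x Dx; rewrite natrD mulrDl csizeE//.
rewrite (_ : _ - _ = m%:R * invN x) ?ger0_norm ?mulr_ge0 ?invN_ge0//.
by rewrite -[m%:R]natr1; ring.
Qed.

Lemma prop_approx k : dom invN (fun x => (x (inord k))%:R / num_keys x - prop k x).
Proof. by exists 0 => // x Dx; rewrite subrr normr0 mul0r. Qed.

Lemma prop0_approx (b : bool) :
  dom invN (fun x => (x ord0 - b * M)%:R / num_keys x - prop 0 x).
Proof.
exists M%:R => // x Dx; rewrite /prop (_ : inord 0 = ord0); last by apply/val_inj; rewrite /= inordK.
rewrite -mulrBl normrM (ger0_norm (invN_ge0 Dx)) ler_wpM2r ?invN_ge0//.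
rewrite ler_norml; case: b; rewrite ?mul1n ?mul0n ?subn0; last first.
  by rewrite subrr oppr_le0 ler0n.
have [sc|/ltnW cs] := leqP M (x ord0).
  by rewrite natrB//; have : 0 <= M%:R :> R by []; lra.
rewrite (eqP (_ : (x ord0 - M)%N == 0%N)) ?subn_eq0// sub0r lerN2 ler_nat cs /=.
by have : 0 <= M%:R :> R by []; have : 0 <= (x ord0)%:R :> R by []; lra.
Qed.

Lemma scaled_full_bd (c : R) : dom (fun=> 1) (fun x => c * full x).
Proof. by apply: dominZ; exact: full_bd. Qed.

Lemma out_rate_approx k :
  dom invN (fun x => out_rate k x - (m%:R * full x) ^+ m * prop k.+1 x ^+ M).
Proof.
have h1 := domin_ffact m (scaled_full_bd _) csize_approx.
have h2 := domin_ffact M (prop_bd k.+1) (prop_approx k.+1).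
have b1 : dom (fun=> 1) (fun x => ((csize x + M) ^_ m)%:R / num_keys x ^+ m).
  by apply: eq_domin (dominD (dominW invN_bd h1) (dominX m (scaled_full_bd m%:R))) => x Dx; ring.
by apply: eq_domin (dominBM b1 (dominX M (prop_bd k.+1)) h1 h2) => x Dx; rewrite out_rateE.
Qed.

Lemma in_rate_approx k :
  dom invN (fun x => in_rate k x - prop k x ^+ M * prop 0 x ^+ M * full x).
Proof.
have h1 := domin_ffact M (prop_bd k) (prop_approx k).
have h2 := domin_ffact M (prop_bd 0) (prop0_approx (inord k == ord0 :> 'I_m)).
have b1 : dom (fun=> 1) (fun x => ((x (inord k)) ^_ M)%:R / num_keys x ^+ M).
  by apply: eq_domin (dominD (dominW invN_bd h1) (dominX M (prop_bd k))) => x Dx; ring.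
have h3 := dominBM b1 (dominX M (prop_bd 0)) h1 h2.
apply: eq_domin (dominMl full_bd h3) => x Dx; rewrite in_rateE//; ring.
Qed.

Lemma out_rate_bd k : dom (fun=> 1) (out_rate k).
Proof.
apply: eq_domin (dominD (dominW invN_bd (out_rate_approx k))
  (dominMr (dominX m (scaled_full_bd m%:R)) (dominX M (prop_bd k.+1)))) => x Dx; ring.
Qed.

Lemma in_rate_bd k : dom (fun=> 1) (in_rate k).
Proof.
apply: eq_domin (dominD (dominW invN_bd (in_rate_approx k))
  (dominMl full_bd (dominMr (dominX M (prop_bd k)) (dominX M (prop_bd 0))))) => x Dx; ring.
Qed.

Lemma imbalance_bd k : dom (fun=> 1) (imbalance k).
Proof. exact: dominB (in_rate_bd k) (out_rate_bd k). Qed.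

End Proportions.

(** * The equilibrium proportions and their stability *)

Section Equilibrium.
Variables (R : realType) (q : nat) (rho : R).
Local Notation m := q.+2.
Local Notation M := q.+1.
Local Notation cfg := {ffun 'I_m -> nat}.
Implicit Types (x y : cfg) (i j : 'I_m).
Hypothesis rho_gt0 : 0 < rho.
Hypothesis rho_eq :
  (m%:R : R) ^+ m * (\sum_(1 <= j < m) rho ^+ j) ^+ m.-1 = m.-1%:R ^+ m.-1.

Local Notation D := (@large_tree q).
Local Notation dom := (domin D).
Local Notation num_keys := (@num_keys R q).
Local Notation prop := (@prop R q).
Local Notation full := (@full R q).
Local Notation imbalance := (@imbalance R q).
Local Notation invN := (fun x => (num_keys x)^-1).

Definition geo_moment (r : nat) : R := \sum_(k < M) k%:R ^+ r * rho ^+ k.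
Local Notation S0 := (geo_moment 0).
Local Notation S1 := (geo_moment 1).

(** The geometric proportions scaled to meet, with [full_eq], the limiting constraints
    [sum_k mu_k = M full_eq] and [sum_k k mu_k + M full_eq = 1]. *)
Definition leaf_eq (k : nat) : R := (S0 + S1)^-1 * rho ^+ k.
Definition full_eq : R := (S0 + S1)^-1 * S0 / M%:R.
Local Notation mu := leaf_eq.

Lemma geo_moment_ge0 r : 0 <= geo_moment r.
Proof. by apply: sumr_ge0 => k _; rewrite mulr_ge0 ?exprn_ge0// ltW. Qed.

Lemma geo_moment0_gt0 : 0 < S0.
Proof.
rewrite /geo_moment big_ord_recl !expr0 mul1r ltr_wpDr//.
by apply: sumr_ge0 => k _; rewrite mulr_ge0 ?exprn_ge0// ltW.
Qed.

Lemma geo_moment01_gt0 : 0 < S0 + S1.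
Proof. by rewrite ltr_wpDr ?geo_moment_ge0// geo_moment0_gt0. Qed.

Lemma leaf_eq_gt0 k : 0 < mu k.
Proof. by rewrite mulr_gt0 ?invr_gt0 ?geo_moment01_gt0// exprn_gt0. Qed.

Lemma full_eq_gt0 : 0 < full_eq.
Proof. by rewrite divr_gt0// mulr_gt0 ?invr_gt0 ?geo_moment01_gt0// geo_moment0_gt0. Qed.

(** This is [m^(m / (m - 1))], by the equation for [rho]: the constant in
    [p_k p_0 = c full p_(k+1)], the [M]-th root of the balance equation. *)
Definition ratio_const : R := M%:R / (rho * S0).
Local Notation c := ratio_const.

Lemma ratio_const_gt0 : 0 < c.
Proof. by rewrite divr_gt0// mulr_gt0// geo_moment0_gt0. Qed.

Lemma geo_moment0E : S0 = \sum_(k < M) rho ^+ k.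
Proof. by apply: eq_bigr => k _; rewrite expr0 mul1r. Qed.

Lemma sum_powers : \sum_(1 <= j < m) rho ^+ j = rho * S0.
Proof.
rewrite big_add1 big_mkord geo_moment0E mulr_sumr.
by apply: eq_bigr => k _; rewrite exprS.
Qed.

Lemma ratio_const_expr : c ^+ M = m%:R ^+ m.
Proof.
have h := rho_eq; rewrite sum_powers /= in h.
have h0 : (rho * S0) ^+ M != 0 by rewrite expf_neq0// gt_eqF// mulr_gt0// geo_moment0_gt0.
by rewrite /c expr_div_n -h mulfK.
Qed.

(** The gauge of the distance to equilibrium; [1 / N] absorbs the replacement of falling factorials
    by powers. *)
Definition residual x : R := \sum_(k < q) `|imbalance k x| + invN x.

Lemma sum_imbalance_ge0 x : 0 <= \sum_(k < q) `|imbalance k x|.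
Proof. exact: sumr_ge0. Qed.

Lemma residual_ge0 : gauge D residual.
Proof.
by move=> x Dx; rewrite addr_ge0 ?sum_imbalance_ge0// (@invN_ge0 R q).
Qed.

Lemma residual_bd : dom (fun=> 1) residual.
Proof.
apply: dominD (invN_bd R q); apply: domin_sum => // k _.
have [C C0 h] := imbalance_bd R q k.
by exists C => // x Dx; rewrite normr_id h.
Qed.

Lemma invN_le_residual x : invN x <= residual x.
Proof. by rewrite lerDr sum_imbalance_ge0. Qed.

Lemma domin_residual_invN (p : cfg -> R) : dom invN p -> dom residual p.
Proof.
apply: dominW; exists 1 => // x Dx.
by rewrite mul1r ger0_norm ?(@invN_ge0 R q)// invN_le_residual.
Qed.

Lemma domin_imbalance k : (k < q)%N -> dom residual (imbalance k).
Proof.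
move=> kq; exists 1 => // x Dx; rewrite mul1r /residual (bigD1 (Ordinal kq))//= -addrA lerDl.
by rewrite addr_ge0 ?sumr_ge0// (@invN_ge0 R q).
Qed.

Let a k x := prop k x * prop 0 x.
Let b k x := c * full x * prop k.+1 x.

(** Dividing [imbalance] by [full], which is bounded below, leaves
    [(p_k p_0)^M - m^m (full p_(k+1))^M], and [m^m = c^M]. *)
Lemma prop_ratio_pow k : (k < q)%N -> dom residual (fun x => a k x ^+ M - b k x ^+ M).
Proof.
move=> kq.
have h1 := domin_residual_invN (in_rate_approx R q k).
have h2 := domin_residual_invN (out_rate_approx R q k).
have h3 := dominB (domin_imbalance kq) (dominB h1 h2).
apply: eq_domin (dominMr (fullV_bd R q) h3) => x Dx.
have f0 : full x != 0 by rewrite gt_eqF// (lt_le_trans _ (full_ge R Dx))// full_min_gt0.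
rewrite /a /b /imbalance; move: (in_rate _ _ _) (out_rate _ _ _) (full x) f0 => u v f f0.
move: (prop k x) (prop 0 x) (prop k.+1 x) => p1 p0 p2.
by rewrite (exprMn _ p1) (exprMn _ (c * f)) (exprMn _ c) ratio_const_expr (exprMn _ m%:R) (exprS f M); field.
Qed.

Lemma prop_stability (e : cfg -> R) : gauge D e -> dom (fun=> 1) e -> dom e invN ->
  (forall k, (k < q)%N -> dom e (fun x => a k x - b k x)) ->
  (forall k, (k < M)%N -> dom e (fun x => prop k x - mu k)) /\
  dom e (fun x => full x - full_eq).
Proof.
move=> e0 eb eN h.
have S0n := geo_moment0_gt0; have S01 := geo_moment01_gt0.
have h1 : c * \sum_(k < M) rho ^+ k.+1 = M%:R.
  under eq_bigr do rewrite exprS.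
  rewrite -mulr_sumr -geo_moment0E /c; field.
  by rewrite !gt_eqF.
have h2 : dom e (fun x => \sum_(k < M) prop k x - M%:R * full x).
  by apply: eq_domin eN => x Dx; rewrite sum_prop//; ring.
have h3 k : (k.+1 < M)%N -> dom e (fun x => prop k x * prop 0 x - c * full x * prop k.+1 x).
  exact: h.
have [k1 k2] := stability (ltn0Sn q) ratio_const_gt0 rho_gt0 (full_min_gt0 R q) h1
  (fun k x => @prop_ge0 R q k x) (@full_ge R q) (@prop_bd R q) (full_bd R q) e0 eb
  h2 (@sum_keyed_prop R q) h3.
have ks : (c * rho * (\sum_(k < M) k%:R * rho ^+ k) + M%:R)^-1 = full_eq.
  rewrite (_ : \sum_(k < M) _ = S1); last by apply: eq_bigr => k _; rewrite expr1.
  rewrite /full_eq /c; field.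
  have q1 : 0 < 1 + q%:R :> R by rewrite ltr_wpDr.
  by rewrite -mulrDr (addrC S1) !gt_eqF ?mulr_gt0.
rewrite ks in k1 k2; split => // k kM; apply: eq_domin (k1 k kM) => x Dx.
rewrite /full_eq /mu /c exprS; field.
have q1 : 0 < 1 + q%:R :> R by rewrite ltr_wpDr.
by rewrite !gt_eqF.
Qed.

(** Two passes. Direct [M]-th roots only give the gauge [residual^(1/M)], which suffices to place
    [p_k p_0] near the positive number [mu_k mu_0]; there the power is inverted without loss, and
    the second pass reaches the gauge [residual]. *)
Lemma prop_equilibrium :
  (forall k, (k < M)%N -> dom residual (fun x => prop k x - mu k)) /\
  dom residual (fun x => full x - full_eq).
Proof.
have a_ge0 k x : D x -> 0 <= a k x by move=> Dx; rewrite mulr_ge0// prop_ge0.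
have b_ge0 k x : D x -> 0 <= b k x.
  move=> Dx; apply: mulr_ge0; last exact: prop_ge0.
  by apply: mulr_ge0; [exact: ltW ratio_const_gt0|exact: full_ge0].
have a_bd k : dom (fun=> 1) (a k) := dominMr (prop_bd R q k) (prop_bd R q 0).
have b_bd k : dom (fun=> 1) (b k) := dominMr (scaled_full_bd q c) (prop_bd R q k.+1).
pose e x := residual x `^ M%:R^-1.
have e0 : gauge D e by move=> x _; exact: powR_ge0.
have eb : dom (fun=> 1) e.
  have [C C0 h] := residual_bd; exists (C `^ M%:R^-1); first exact: powR_ge0.
  move=> x Dx; rewrite ger0_norm ?powR_ge0// mulr1.
  apply: ge0_ler_powR; rewrite ?invr_ge0// ?nnegrE ?residual_ge0//.
  by rewrite -[leRHS]mulr1 (le_trans _ (h x Dx))// ler_norm.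
(* [1 / N <= residual = e * e ^+ q], and [e] is bounded. *)
have eN : dom e invN.
  have h1 : dom e (fun x => e x * e x ^+ q).
    by apply: dominMl; [exact: dominX|exact: domin_refl].
  apply: dominW h1 _; have [C C0 h] := domin_residual_invN (domin_refl (@invN_ge0 R q)).
  by exists C => // x Dx; rewrite -exprS powR_root_expr ?residual_ge0// h.
have kM k : (k < q)%N -> dom e (fun x => a k x - b k x).
  by move=> kq; apply: domin_root => //; [exact: residual_ge0|exact: a_ge0|exact: b_ge0|exact: prop_ratio_pow].
have [h1 h2] := prop_stability e0 eb eN kM.
apply: prop_stability residual_ge0 residual_bd (domin_residual_invN (domin_refl (@invN_ge0 R q))) _ => k kq.
apply: (@domin_root_nondegenerate _ _ _ q (mu k * mu 0)).
- by rewrite mulr_gt0// leaf_eq_gt0.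
- exact: residual_ge0.
- exact: a_ge0.
- exact: b_ge0.
- by apply: dominB.
- exact: prop_ratio_pow.
- have mu_bd (j : nat) : dom (fun=> 1) (fun=> mu j) := domin_cst _ (mu j).
  have h3 := dominBM (prop_bd R q k) (mu_bd 0%N) (h1 k (ltnW kq)) (h1 0%N (ltn0Sn q)).
  exact: h3.
Qed.

End Equilibrium.

(** * Moment bounds *)

Section DominChange.
Variables (R : realFieldType) (T : Type) (D D' : T -> Prop).
Implicit Types (e p : T -> R).

Lemma domin_comp (h : T -> T) e p : (forall x, D' x -> D (h x)) ->
  (forall x, D' x -> e (h x) = e x) -> domin D e p -> domin D' e (fun x => p (h x)).
Proof. by move=> hD he [C C0 hp]; exists C => // x Dx; rewrite -(he _ Dx); exact/hp/hD. Qed.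

Lemma domin_sub e p : (forall x, D' x -> D x) -> domin D e p -> domin D' e p.
Proof. by move=> hD [C C0 hp]; exists C => // x Dx; exact/hp/hD. Qed.

Lemma domin_off e p : gauge D e -> (forall x, D x -> p x = 0 \/ D' x) ->
  domin D' e p -> domin D e p.
Proof.
move=> e0 h [C C0 hp]; exists C => // x Dx; have [->|/hp//] := h x Dx.
by rewrite normr0 mulr_ge0 ?e0.
Qed.

End DominChange.

Lemma exprD_le (R : realDomainType) (a b : R) n : 0 <= a -> 0 <= b ->
  (a + b) ^+ n <= 2 ^+ n * (a ^+ n + b ^+ n).
Proof.
move=> a0 b0; wlog ab : a b a0 b0 / a <= b => [h|].
  have [ab|/ltW ba] := leP a b; first exact: h.
  by rewrite addrC [X in _ * X]addrC h.
rewrite (@le_trans _ _ ((2 * b) ^+ n))//.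
  by rewrite lerXn2r ?nnegrE ?addr_ge0 ?mulr_ge0//; lra.
by rewrite exprMn ler_wpM2l ?exprn_ge0// lerDr exprn_ge0.
Qed.

Section Moments.
Variables (R : realType) (q : nat).
Local Notation m := q.+2.
Local Notation M := q.+1.
Local Notation cfg := {ffun 'I_m -> nat}.
Implicit Types (x y : cfg).

Local Notation D := (@large_tree q).
Local Notation dom := (domin D).
Local Notation num_keys := (@num_keys R q).
Local Notation prop := (@prop R q).
Local Notation full := (@full R q).
Local Notation imbalance := (@imbalance R q).
Local Notation out_rate := (@out_rate R q).
Local Notation in_rate := (@in_rate R q).
Local Notation invN := (fun x => (num_keys x)^-1).
Local Notation E := (@Ecfg R q).

Let N_ge0 : gauge D invN := @invN_ge0 R q.

Lemma forest_large n x : (2 * m <= n)%N -> forest 1 n x -> D x.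
Proof. by move=> mn /andP[/eqP kx sx]; rewrite /large_tree sx kx. Qed.

Lemma forest_num_keys n x : forest 1 n x -> num_keys x = n%:R.
Proof. by move=> /andP[/eqP kx _]; rewrite /num_keys kx. Qed.

Lemma is_mean_E n : is_mean E (fun n x => forest 1 n x) n.
Proof. exact: is_mean_Ecfg. Qed.

Definition mv (k : nat) x : cfg := exchange (inord k) (inord k.+1) x.

Definition movable (k : nat) x : bool := D x && (M <= x (inord k.+1))%N.

Lemma mvE k x : (k < q)%N -> (M <= x (inord k.+1))%N ->
  cinc (mv k x) (inord k.+1) M = cinc (cinc (cinc x (inord k) M) ord0 M) ord_max 1.
Proof.
move=> kq xk; apply/ffunP => i; rewrite !ffunE.
case: (eqVneq i (inord k.+1)) xk => [->|_]; lia.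
Qed.

Lemma keys_mv k x : (k < q)%N -> (M <= x (inord k.+1))%N -> keys (mv k x) = keys x.
Proof.
move=> kq xk; have := congr1 (@keys q) (mvE kq xk); rewrite !keys_cinc.
by rewrite !inordK//=; nia.
Qed.

Lemma csize_mv k x : (k < q)%N -> (M <= x (inord k.+1))%N -> csize (mv k x) = (csize x + m)%N.
Proof.
move=> kq xk; have := congr1 (@csize q) (mvE kq xk); rewrite !csize_cinc; lia.
Qed.

Lemma mv_max k x : (k < q)%N -> mv k x ord_max = (x ord_max).+1.
Proof.
move=> kq; rewrite !ffunE.
rewrite (_ : ord_max == inord k = false); last by apply/eqP => /(congr1 val); rewrite /= inordK; lia.
rewrite (_ : ord_max == inord k.+1 = false); last by apply/eqP => /(congr1 val); rewrite /= inordK; lia.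
by rewrite eqxx !mul0n subn0 !addn0 mul1n addn1.
Qed.

Lemma mv_large k x : (k < q)%N -> movable k x -> D (mv k x).
Proof.
move=> kq /andP[/andP[/eqP sx kx] xk]; rewrite /large_tree keys_mv// kx andbT.
by rewrite csize_mv// mv_max// sx; apply/eqP; lia.
Qed.

Lemma mv_num_keys k x : (k < q)%N -> movable k x -> num_keys (mv k x) = num_keys x.
Proof. by move=> kq /andP[_ xk]; rewrite /num_keys keys_mv. Qed.

Lemma count_mv k x (i : 'I_m) :
  `|(mv k x i)%:R - (x i)%:R| <= 2 * m%:R :> R.
Proof.
have h1 : (mv k x i <= x i + 2 * m)%N by rewrite !ffunE; case: eqP; case: eqP; case: eqP; case: eqP; lia.
have h2 : (x i <= mv k x i + 2 * m)%N by rewrite !ffunE; case: eqP; case: eqP; case: eqP; case: eqP; lia.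
move: h1 h2; rewrite -!(ler_nat R) !natrD !natrM => h1 h2.
by rewrite ler_norml; apply/andP; split; lra.
Qed.

Section Move.
Variables (k : nat) (kq : (k < q)%N).
Local Notation D' := (movable k).
Local Notation dom' := (domin D').

Lemma count_mv_approx (i : 'I_m) :
  dom' invN (fun x => (mv k x i)%:R / num_keys (mv k x) - (x i)%:R / num_keys x).
Proof.
exists (2 * m%:R) => [|x D'x]; first by rewrite mulr_ge0.
have /andP[Dx _] := D'x; rewrite mv_num_keys// -mulrBl normrM (ger0_norm (N_ge0 Dx)).
by rewrite ler_wpM2r ?N_ge0 ?count_mv.
Qed.

Lemma movable_large x : D' x -> D x. Proof. by case/andP. Qed.

Lemma invN_bd' : dom' (fun=> 1) invN.
Proof. exact: domin_sub movable_large (invN_bd R q). Qed.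

Lemma N_ge0' : gauge D' invN.
Proof. by move=> x /movable_large Dx; exact: N_ge0. Qed.

Lemma domin_mv e : (forall x, D' x -> e (mv k x) = e x) -> forall p : cfg -> R,
  dom e p -> dom' e (fun x => p (mv k x)).
Proof. by move=> he p; apply: domin_comp => // x; exact: mv_large. Qed.

Lemma invN_mv x : D' x -> invN (mv k x) = invN x.
Proof. by move=> D'x; rewrite /= mv_num_keys. Qed.

(** An exchange moves each proportion by [O(1 / N)], and the rates are polynomials in the
    proportions up to [O(1 / N)]. *)
Lemma imbalance_mv : dom' invN (fun x => imbalance k (mv k x) - imbalance k x).
Proof.
have bd (p : cfg -> R) : dom (fun=> 1) p -> dom' (fun=> 1) p := domin_sub movable_large.
have bdm (p : cfg -> R) : dom (fun=> 1) p -> dom' (fun=> 1) (fun x => p (mv k x)).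
  by apply: domin_mv.
have hp j : dom' invN (fun x => prop j (mv k x) - prop j x) := count_mv_approx (inord j).
have hf : dom' invN (fun x => full (mv k x) - full x) := count_mv_approx ord_max.
have hX j n : dom' invN (fun x => prop j (mv k x) ^+ n - prop j x ^+ n).
  exact: dominBX invN_bd' N_ge0' (bdm _ (prop_bd R q j)) (hp j).
have hin : dom' invN (fun x => in_rate k (mv k x) - in_rate k x).
  have h1 := domin_mv invN_mv (in_rate_approx R q k).
  have h2 := domin_sub movable_large (in_rate_approx R q k).
  have h3 := dominBM (bdm _ (dominX M (prop_bd R q k))) (bd _ (dominX M (prop_bd R q 0))) (hX k M) (hX 0%N M).
  have h4 := dominBM (bdm _ (dominMr (dominX M (prop_bd R q k)) (dominX M (prop_bd R q 0))))
     (bd _ (full_bd R q)) h3 hf.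
  by apply: eq_domin (dominD (dominB h1 h2) h4) => x _; ring.
have hout : dom' invN (fun x => out_rate k (mv k x) - out_rate k x).
  have h1 := domin_mv invN_mv (out_rate_approx R q k).
  have h2 := domin_sub movable_large (out_rate_approx R q k).
  have h3 : dom' invN (fun x => (m%:R * full (mv k x)) ^+ m - (m%:R * full x) ^+ m).
    apply: dominBX invN_bd' N_ge0' (bdm _ (scaled_full_bd q m%:R)) _.
    by apply: eq_domin (dominZ m%:R hf) => x _; rewrite mulrBr.
  have h4 := dominBM (bdm _ (dominX m (scaled_full_bd q (m%:R : R))))
    (bd _ (dominX M (prop_bd R q k.+1))) h3 (hX k.+1 M).
  by apply: eq_domin (dominD (dominB h1 h2) h4) => x _; ring.
by apply: eq_domin (dominB hin hout) => x _; rewrite /imbalance; ring.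
Qed.

Lemma out_rate_off x : D x -> out_rate k x = 0 \/ D' x.
Proof.
move=> Dx; have [h|h] := leqP M (x (inord k.+1)); first by right; apply/andP.
by left; rewrite /out_rate /rate_out (ffact_small h) muln0 mul0r.
Qed.

(** A discrete integration by parts: the exchange identity, minus [E[f out_rate]] on both sides,
    trades the factor [imbalance] for an increment of [f]. *)
Lemma E_imbalance n (f : cfg -> R) : (2 * m <= n)%N ->
  E n (fun x => f x * imbalance k x) =
  E n (fun x => (f (mv k x) - f x) * out_rate k x).
Proof.
move=> mn; have En := is_mean_E n.
have nn : n%:R != 0 :> R by rewrite pnatr_eq0; lia.
have h : E n (fun x => f (mv k x) * out_rate k x) = E n (fun x => f x * in_rate k x).
  have h0 := @Ecfg_exchange R q n (inord k) (inord k.+1) f.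
  rewrite !inordK in h0; [|lia..].
  rewrite (eq_expect (q := fun x => n%:R ^- (m + M) * (f (mv k x) * (rate_out (inord k.+1) x)%:R)) En); last first.
    by move=> x fx; rewrite /out_rate (forest_num_keys fx) mulrA mulrC.
  rewrite (eq_expect (p := fun x => f x * _) (q := fun x => n%:R ^- (m + M) * (f x * (rate_in (inord k) x)%:R)) En); last first.
    by move=> x fx; rewrite /in_rate (forest_num_keys fx) mulrA mulrC.
  by rewrite !(expectZ En) h0.
transitivity (E n (fun x => f x * in_rate k x - f x * out_rate k x)).
  by congr (E n); apply/funext => x; rewrite /imbalance mulrBr.
rewrite (expectB _ _ En) -h -(expectB _ _ En).
by congr (E n); apply/funext => x; rewrite mulrBl.
Qed.

End Move.

Definition mean_le (r : nat) (p : cfg -> R) : Prop :=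
  exists2 C : R, 0 <= C & forall n, (2 * m <= n)%N -> E n p <= C / n%:R ^+ r.

Lemma mean_le_domin r e p : mean_le r e -> dom e p ->
  exists2 C : R, 0 <= C & forall n, (2 * m <= n)%N -> `|E n p| <= C / n%:R ^+ r.
Proof.
move=> [C C0 h] [C' C'0 h']; exists (C' * C); first exact: mulr_ge0.
move=> n mn; have En := is_mean_E n.
apply: (@le_trans _ _ (E n (fun x => C' * e x))).
  by apply: (ler_norm_expect En) => x fx; apply: h'; exact: forest_large fx.
by rewrite (expectZ En) -mulrA ler_wpM2l// h.
Qed.

Lemma domin_mean_le r e p : mean_le r e -> dom e p -> mean_le r p.
Proof.
move=> he hp; have [C C0 h] := mean_le_domin he hp; exists C => // n mn.
by rewrite (le_trans (ler_norm _))// h.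
Qed.

Lemma mean_leD r p p' : mean_le r p -> mean_le r p' -> mean_le r (fun x => p x + p' x).
Proof.
move=> [C C0 h] [C' C'0 h']; exists (C + C'); first exact: addr_ge0.
by move=> n mn; rewrite (expectD (is_mean_E n)) mulrDl lerD ?h ?h'.
Qed.

Lemma mean_le_invN r s p : mean_le s p -> mean_le (r + s) (fun x => invN x ^+ r * p x).
Proof.
move=> [C C0 h]; exists C => // n mn; have En := is_mean_E n.
rewrite (eq_expect (q := fun x => n%:R ^- r * p x) En); last first.
  by move=> x fx; rewrite (forest_num_keys fx) exprVn.
rewrite (expectZ En) exprD invfM mulrCA ler_wpM2l ?invr_ge0 ?exprn_ge0// h//.
Qed.

Lemma mean_le_invNX r : mean_le r (fun x => invN x ^+ r).
Proof.
have h : mean_le 0 (fun=> 1).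
  by exists 1 => // n mn; rewrite (expect1 (is_mean_E n)) expr0 divr1.
have [C C0 hC] := mean_le_invN r h; exists C => // n mn.
by have := hC n mn; rewrite addn0; congr (E n _ <= _); apply/funext => x; rewrite mulr1.
Qed.

Lemma imbalance_mean2 k : (k < q)%N -> mean_le 1 (fun x => imbalance k x ^+ 2).
Proof.
move=> kq.
have h : dom invN (fun x => (imbalance k (mv k x) - imbalance k x) * out_rate k x).
  apply: (domin_off (D' := movable k)); first exact: N_ge0.
    by move=> x /(out_rate_off k) [->|]; [left; rewrite mulr0|right].
  apply: dominMl; last exact: imbalance_mv.
  exact: domin_sub (@movable_large k) (out_rate_bd R q k).
have [C C0 hC] := mean_le_domin (mean_le_invNX 1) h; exists C => // n mn.
apply: le_trans (hC n mn); rewrite -E_imbalance//.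
by rewrite (le_trans _ (ler_norm _)).
Qed.

(** The increment of the cube is [d (d^2 + 3 d e + 3 e^2)] with [d = O(1 / N)]; the bracket is
    dominated by [e^2 + N^(-2)], whose mean is [O(1 / n)] by the second moment. *)
Lemma imbalance_mean4 k : (k < q)%N -> mean_le 2 (fun x => imbalance k x ^+ 4).
Proof.
move=> kq.
pose g x : R := imbalance k x ^+ 2 + invN x ^+ 2.
have gm : mean_le 2 (fun x => invN x ^+ 1 * g x).
  apply: (@mean_le_invN 1 1).
  apply: mean_leD (imbalance_mean2 kq) _.
  apply: domin_mean_le (mean_le_invNX 1) _.
  apply: eq_domin (dominMl (invN_bd R q) (domin_refl N_ge0)) => x _.
  by rewrite expr2.
have hd := imbalance_mv kq.
have h : dom (fun x => invN x ^+ 1 * g x)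
    (fun x => (imbalance k (mv k x) ^+ 3 - imbalance k x ^+ 3) * out_rate k x).
  apply: (domin_off (D' := movable k)).
  - move=> x Dx; rewrite /g expr1 mulr_ge0 ?N_ge0// addr_ge0 ?sqr_ge0//.
  - by move=> x /(out_rate_off k) [->|]; [left; rewrite mulr0|right].
  have hg : domin (movable k) g (fun x => (imbalance k (mv k x) - imbalance k x) ^+ 2 +
     3 * ((imbalance k (mv k x) - imbalance k x) * imbalance k x + imbalance k x ^+ 2)).
    (* From [2 |d e| <= d^2 + e^2] and [d^2 <= C^2 u^2]; the constant is generous. *)
    have [C C0 hC] := hd; exists (5 + 3 * C ^+ 2).
      by rewrite addr_ge0 ?mulr_ge0 ?exprn_ge0.
    move=> x D'x; have := hC x D'x; set d := _ - _; set e := imbalance k x.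
    have := N_ge0 (movable_large D'x); rewrite /g -/e.
    move: (invN x) => u u0 hdu.
    have hd2 : d ^+ 2 <= C ^+ 2 * u ^+ 2.
      by rewrite -exprMn -(real_normK (num_real d)) lerXn2r ?nnegrE ?mulr_ge0.
    have u2 : 0 <= u ^+ 2 := sqr_ge0 _.
    have e2 : 0 <= e ^+ 2 := sqr_ge0 _.
    have C2 : 0 <= C ^+ 2 := sqr_ge0 _.
    have C2e : 0 <= C ^+ 2 * e ^+ 2 by exact: mulr_ge0.
    have := sqr_ge0 (d - e); have := sqr_ge0 (d + e); rewrite sqrrB sqrrD ler_norml => p1 p2.
    by apply/andP; split; nra.
  have h1 := dominM hd hg.
  have h2 := dominMl (domin_sub (@movable_large k) (out_rate_bd R q k)) h1.
  apply: eq_domin h2 => x _; ring.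
have [C C0 hC] := mean_le_domin gm h; exists C => // n mn.
apply: le_trans (hC n mn); rewrite -E_imbalance//.
rewrite (le_trans _ (ler_norm _))// le_eqVlt; apply/orP; left; apply/eqP.
by congr (E n); apply/funext => x; rewrite exprSr.
Qed.

Lemma mean_le_norm_sum (r k : nat) (I : Type) (s : seq I) (F : I -> cfg -> R) (g : cfg -> R) :
  (forall i, mean_le r (fun x => `|F i x| ^+ k)) -> mean_le r (fun x => `|g x| ^+ k) ->
  mean_le r (fun x => (\sum_(i <- s) `|F i x| + `|g x|) ^+ k).
Proof.
move=> hF hg; elim: s => [|i s IHs].
  apply: domin_mean_le hg _; exists 1 => // x _.
  by rewrite big_nil add0r mul1r normrX normr_id.
apply: domin_mean_le (mean_leD (hF i) IHs) _; exists (2 ^+ k) => [|x _]; first exact: exprn_ge0.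
have s0 : 0 <= \sum_(j <- s) `|F j x| + `|g x| by rewrite addr_ge0// sumr_ge0.
rewrite big_cons -addrA normrX ger0_norm; last by rewrite addr_ge0.
exact: exprD_le.
Qed.

End Moments.

(** * Linearization and Stein's identity *)

Section Increments.
Variables (R : realType) (f df : R -> R) (K : R).
Hypothesis f_df : forall x : R, is_derive x 1 f (df x).
Hypothesis df_le : forall x, `|df x| <= K.

Lemma mvt_between (y z : R) :
  exists2 u, `|u - y| <= `|z - y| & f z - f y = df u * (z - y).
Proof.
have cf := is_derive_continuous f_df.
have [yz|/ltW zy] := leP y z.
  have [u hu e] := MVT_segment yz (fun x _ => f_df x) (continuous_subspaceT cf).
  exists u => //; move: hu; rewrite in_itv/= => /andP[yu uz].
  by rewrite !ger0_norm ?subr_ge0// lerD2r.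
have [u hu e] := MVT_segment zy (fun x _ => f_df x) (continuous_subspaceT cf).
exists u; last by rewrite -opprB e -mulrN opprB.
move: hu; rewrite in_itv/= => /andP[zu uy].
by rewrite distrC [leRHS]distrC !ger0_norm ?subr_ge0// lerD2l lerN2.
Qed.

Lemma lipschitz_bound (y z : R) : `|f z - f y| <= K * `|z - y|.
Proof. by have [u _ ->] := mvt_between y z; rewrite normrM ler_wpM2r. Qed.

(** The remainder is [h (df u - df y)] with [u] between [y] and [y + h]; the weight is that of the
    modulus of [df]. *)
Lemma increment_approx (e : R) : continuous df -> 0 < e ->
  exists2 d, 0 < d & forall y h : R, `|h| <= d -> `|f (y + h) - f y - h * df y| <=
    `|h| * (e * (1 + y ^+ 2)).
Proof.
move=> cdf e0; have [d d0 hd] := bounded_continuous_modulus cdf df_le e0.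
exists d => // y h hd'; have [u] := mvt_between y (y + h).
rewrite (addrC y h) addrK => uy ->; rewrite mulrC -mulrBr normrM ler_wpM2l// hd//.
by rewrite (le_trans uy)// (le_trans hd')// ler_peMr ?(ltW d0)// lerDl.
Qed.

End Increments.

Lemma cvg_div_sqrt (R : realType) (C : R) :
  (fun n : nat => C / Num.sqrt n%:R) @ \oo --> (0 : R).
Proof.
apply/cvgrPdist_le => e e0; near=> n.
rewrite sub0r normrN normrM normfV (ger0_norm (sqrtr_ge0 _)).
have n0 : (0 < n)%N by near: n; exact: nbhs_infty_gt.
rewrite ler_pdivrMr ?sqrtr_gt0 ?ltr0n// mulrC -ler_pdivrMr//.
rewrite -[leLHS]ger0_norm ?divr_ge0// ?(ltW e0)// -sqrtr_sqr ler_wsqrtr//.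
by near: n; exact: nbhs_infty_ger.
Unshelve. all: by end_near. Qed.

Section Linearization.
Variables (R : realFieldType) (T : Type) (D : T -> Prop) (eta s : T -> R).
Hypothesis eta_ge0 : gauge D eta.
Hypothesis eta_bd : domin D (fun=> 1) eta.
Hypothesis s_bd : domin D (fun=> 1) s.
Hypothesis s_eta2 : domin D s (fun x => eta x ^+ 2).
Implicit Types p L : T -> R.

(** First-order expansion [p = 1 + L + O(s)] with [L = O(eta)]; as [eta^2 = O(s)], products only add
    the linear parts. *)
Definition linear_approx p L : Prop :=
  domin D eta L /\ domin D s (fun x => p x - 1 - L x).

Lemma domin_mul_eta p L : domin D eta p -> domin D eta L -> domin D s (fun x => p x * L x).
Proof.
move=> hp hL; apply: dominW (dominM hp hL).
by apply: eq_domin s_eta2 => x _; rewrite expr2.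
Qed.

Lemma linear_approx_bd p L : linear_approx p L -> domin D (fun=> 1) p.
Proof.
move=> [hL hp]; apply: eq_domin (dominD (dominW s_bd hp) (dominD (domin_cst D 1) (dominW eta_bd hL))).
by move=> x _; ring.
Qed.

Lemma linear_approxM p L p' L' : linear_approx p L -> linear_approx p' L' ->
  linear_approx (fun x => p x * p' x) (fun x => L x + L' x).
Proof.
move=> h h'; have bp' := linear_approx_bd h'; case: h => hL hp; case: h' => hL' hp'.
split; first exact: dominD.
have b1 := dominD (domin_cst D 1) (dominW eta_bd hL).
apply: eq_domin (dominD (domin_mul_eta hL hL') (dominD (dominMr b1 hp') (dominMl bp' hp))) => x _.
ring.
Qed.

Lemma linear_approxX p L n : linear_approx p L ->
  linear_approx (fun x => p x ^+ n) (fun x => n%:R * L x).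
Proof.
move=> h; elim: n => [|n [hL hp]].
  by split; exists 0 => // x _; rewrite ?expr0 ?subrr ?mul0r ?subr0 normr0.
have [hL' hp'] := linear_approxM h (conj hL hp); split.
  apply: eq_domin hL' => x _; rewrite -natr1; ring.
apply: eq_domin hp' => x _; rewrite exprS -natr1; ring.
Qed.

Lemma linear_approxB p L p' : linear_approx p L -> domin D s (fun x => p x - p' x) ->
  linear_approx p' L.
Proof.
move=> [hL hp] h; split => //; apply: eq_domin (dominB hp h) => x _; ring.
Qed.

End Linearization.

Section SteinLimit.
Variables (R : realType) (q : nat) (rho : R).
Local Notation m := q.+2.
Local Notation M := q.+1.
Local Notation cfg := {ffun 'I_m -> nat}.
Implicit Types (x y : cfg).
Hypothesis rho_gt0 : 0 < rho.
Hypothesis rho_eq :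
  (m%:R : R) ^+ m * (\sum_(1 <= j < m) rho ^+ j) ^+ m.-1 = m.-1%:R ^+ m.-1.

Local Notation D := (@large_tree q).
Local Notation dom := (domin D).
Local Notation num_keys := (@num_keys R q).
Local Notation prop := (@prop R q).
Local Notation full := (@full R q).
Local Notation imbalance := (@imbalance R q).
Local Notation out_rate := (@out_rate R q).
Local Notation in_rate := (@in_rate R q).
Local Notation invN := (fun x => (num_keys x)^-1).
Local Notation E := (@Ecfg R q).
Local Notation residual := (@residual R q).
Local Notation geo_moment := (geo_moment q rho).
Local Notation mu := (leaf_eq q rho).
Local Notation kst := (full_eq q rho).

Let N_ge0 : gauge D invN := @invN_ge0 R q.

Definition dev (k : nat) x : R := prop k x / mu k - 1.
Definition dev_full x : R := full x / kst - 1.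
(** The linear part at equilibrium of [log (p_k p_0 / (c full p_(k+1)))], that is, of the [k]-th
    balance equation. *)
Definition ell (k : nat) x : R := dev k x + dev 0 x - dev_full x - dev k.+1 x.
Definition s2 x : R := residual x ^+ 2 + invN x.

Lemma mu_gt0 k : 0 < mu k. Proof. exact: leaf_eq_gt0. Qed.
Lemma kst_gt0 : 0 < kst. Proof. exact: full_eq_gt0. Qed.

Lemma dev_eta k : (k < M)%N -> dom residual (dev k).
Proof.
move=> kM; have [h _] := prop_equilibrium rho_gt0 rho_eq.
apply: eq_domin (dominZ (mu k)^-1 (h k kM)) => x _; rewrite /dev.
by have := mu_gt0 k; move: (mu k) (prop k x) => a b a0; field; rewrite gt_eqF.
Qed.

Lemma dev_full_eta : dom residual dev_full.
Proof.
have [_ h] := prop_equilibrium rho_gt0 rho_eq.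
apply: eq_domin (dominZ kst^-1 h) => x _; rewrite /dev_full.
by have := kst_gt0; move: kst (full x) => a b a0; field; rewrite gt_eqF.
Qed.

Let eta_1 : dom (fun=> 1) residual := residual_bd R q.

Lemma s2_bd : dom (fun=> 1) s2.
Proof. by apply: dominD (invN_bd R q); apply: dominX. Qed.

Lemma s2_eta2 : dom s2 (fun x => residual x ^+ 2).
Proof.
exists 1 => // x Dx; rewrite mul1r ger0_norm ?sqr_ge0// lerDl.
exact: N_ge0.
Qed.

Lemma s2_invN p : dom invN p -> dom s2 p.
Proof.
apply: dominW; exists 1 => // x Dx; rewrite mul1r ger0_norm ?N_ge0// lerDr.
exact: sqr_ge0.
Qed.

Local Notation lin := (linear_approx D residual s2).

Lemma lin_prop k : (k < M)%N -> lin (fun x => prop k x / mu k) (dev k).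
Proof.
move=> kM; split; first exact: dev_eta.
by exists 0 => // x _; rewrite /dev subrr normr0 mul0r.
Qed.

Lemma lin_full : lin (fun x => full x / kst) dev_full.
Proof.
split; first exact: dev_full_eta.
by exists 0 => // x _; rewrite /dev_full subrr normr0 mul0r.
Qed.

Definition rate_eq (k : nat) : R := mu k ^+ M * mu 0 ^+ M * kst.

Lemma rate_eq_gt0 k : 0 < rate_eq k.
Proof.
apply: mulr_gt0; last exact: kst_gt0.
by apply: mulr_gt0; apply: exprn_gt0; exact: mu_gt0.
Qed.

(** The balance equation: [rate_eq] is the limiting [in_rate], the right-hand side the limiting
    [out_rate]. *)
Lemma rate_eqE k : rate_eq k = (m%:R * kst) ^+ m * mu k.+1 ^+ M.
Proof.
rewrite (exprMn _ m%:R) -(ratio_const_expr rho_gt0 rho_eq) (exprSr kst) /rate_eq.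
rewrite [RHS](_ : _ = (ratio_const q rho * kst * mu k.+1) ^+ M * kst); last first.
  by rewrite !exprMn; ring.
rewrite -exprMn; congr (_ ^+ _ * _).
have := geo_moment0_gt0 q rho_gt0; have := geo_moment01_gt0 q rho_gt0.
rewrite /ratio_const /leaf_eq /full_eq exprS expr0 mulr1.
move: (geo_moment 0) (geo_moment 1) => a b ab a0; field.
have q1 : 0 < 1 + q%:R :> R by rewrite ltr_wpDr.
by rewrite !gt_eqF.
Qed.

Lemma lin_in_rate k : (k < M)%N -> lin (fun x => in_rate k x / rate_eq k)
  (fun x => M%:R * dev k x + M%:R * dev 0 x + dev_full x).
Proof.
move=> kM; have lX := linear_approxX eta_1 s2_bd s2_eta2 M.
have lM := linear_approxM eta_1 s2_bd s2_eta2.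
apply: linear_approxB (lM _ _ _ _ (lM _ _ _ _ (lX _ _ (lin_prop kM)) (lX _ _ (lin_prop (ltn0Sn q)))) lin_full) _.
apply: s2_invN; apply: eq_domin (dominZ (- (rate_eq k)^-1) (in_rate_approx R q k)) => x _.
rewrite /rate_eq.
have := mu_gt0 k; have := mu_gt0 0; have := kst_gt0.
move: (prop k x) (prop 0 x) (full x) (in_rate k x) (mu k) (mu 0) kst.
move=> a b c u ma mb mc mc0 mb0 ma0; rewrite !expr_div_n; field.
by rewrite !expf_neq0 ?gt_eqF.
Qed.

Lemma lin_out_rate k : (k < q)%N -> lin (fun x => out_rate k x / rate_eq k)
  (fun x => m%:R * dev_full x + M%:R * dev k.+1 x).
Proof.
move=> kM; have lX := @linear_approxX _ _ _ _ _ eta_1 s2_bd s2_eta2.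
have lM := linear_approxM eta_1 s2_bd s2_eta2.
have kM' : (k.+1 < M)%N by [].
apply: linear_approxB (lM _ _ _ _ (lX _ _ m lin_full) (lX _ _ M (lin_prop kM'))) _.
apply: s2_invN; apply: eq_domin (dominZ (- (rate_eq k)^-1) (out_rate_approx R q k)) => x _.
rewrite rate_eqE.
have := mu_gt0 k.+1; have := kst_gt0.
have : 0 < m%:R :> R by [].
move: (prop k.+1 x) (full x) (out_rate k x) (mu k.+1) kst (m%:R : R).
move=> a c u ma mc mm mm0 mc0 ma0; rewrite !expr_div_n !exprMn; field.
by rewrite !expf_neq0 ?gt_eqF.
Qed.

(** The linear parts [M dev_k + M dev_0 + dev_full] and [m dev_full + M dev_(k+1)] differ by
    [M ell_k], since [m - 1 = M]. *)
Lemma imbalance_lin k : (k < q)%N ->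
  dom s2 (fun x => imbalance k x / rate_eq k - M%:R * ell k x).
Proof.
move=> kq; have [_ h1] := lin_in_rate (ltnW kq); have [_ h2] := lin_out_rate kq.
apply: eq_domin (dominB h1 h2) => x _; rewrite /imbalance /ell.
move: (in_rate k x) (out_rate k x) (dev k x) (dev 0 x) (dev k.+1 x) (dev_full x) (rate_eq k).
move=> u v a b c d e; rewrite -[m%:R]natr1; ring.
Qed.

End SteinLimit.

Section NormalizedNodes.
Variables (R : realType) (q : nat) (rho : R).
Local Notation m := q.+2.
Local Notation M := q.+1.
Local Notation cfg := {ffun 'I_m -> nat}.
Implicit Types (x y : cfg).
Hypothesis rho_gt0 : 0 < rho.
Hypothesis rho_eq :
  (m%:R : R) ^+ m * (\sum_(1 <= j < m) rho ^+ j) ^+ m.-1 = m.-1%:R ^+ m.-1.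

Local Notation D := (@large_tree q).
Local Notation dom := (domin D).
Local Notation num_keys := (@num_keys R q).
Local Notation prop := (@prop R q).
Local Notation full := (@full R q).
Local Notation imbalance := (@imbalance R q).
Local Notation out_rate := (@out_rate R q).
Local Notation invN := (fun x => (num_keys x)^-1).
Local Notation E := (@Ecfg R q).
Local Notation residual := (@residual R q).
Local Notation geo_moment := (geo_moment q rho).
Local Notation mu := (leaf_eq q rho).
Local Notation kst := (full_eq q rho).
Local Notation dev := (dev rho).
Local Notation dev_full := (dev_full rho).
Local Notation ell := (ell rho).
Local Notation rate_eq := (rate_eq q rho).

Definition sqrt_keys x : R := Num.sqrt (num_keys x).
(** The nonempty nodes number [m x_max + 1 - x_0]; this is their limiting proportion, later
    identified with [d1c]. *)
Definition drift : R := m%:R * kst - mu 0.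
Definition scaled_nodes x : R := sqrt_keys x * ((nodes x)%:R / num_keys x - drift).
Local Notation t := sqrt_keys.
Local Notation Y := scaled_nodes.

Lemma sqrt_keys_gt0 x : D x -> 0 < t x.
Proof. by move=> Dx; rewrite sqrtr_gt0 num_keys_gt0. Qed.

Lemma invN_sqrt x : D x -> invN x = (t x)^-1 ^+ 2.
Proof. by move=> Dx; rewrite exprVn sqr_sqrtr// ltW ?num_keys_gt0. Qed.

Lemma nodesE x : D x -> (nodes x)%:R / num_keys x = m%:R * full x + invN x - prop 0 x.
Proof.
move=> Dx; rewrite -csizeE// csize_nodes natrD mulrDl /prop.
rewrite (_ : inord 0 = ord0); last by apply/val_inj; rewrite /= inordK.
ring.
Qed.

Lemma scaled_nodesE x : D x ->
  Y x = t x * (m%:R * kst * dev_full x - mu 0 * dev 0 x + invN x).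
Proof.
move=> Dx; rewrite /scaled_nodes nodesE// /drift /dev /dev_full.
have := leaf_eq_gt0 q rho_gt0 0; have := full_eq_gt0 q rho_gt0.
move: (prop 0 x) (full x) (mu 0) kst (t x) (num_keys x)^-1 => a b ma mb tt u mb0 ma0.
by field; rewrite !gt_eqF.
Qed.

(** The three terms have means of order [n^(1/2) / n], [n^(3/2) / n^2] and [n^(-1/2)], so whatever
    this dominates is negligible. *)
Definition error_weight x : R :=
  t x * residual x ^+ 2 + t x ^+ 3 * residual x ^+ 4 + (t x)^-1.
Local Notation w := error_weight.

Let r_ge0 : gauge D residual := @residual_ge0 R q.

(** [2 r <= t r^2 + 1 / t]. *)
Lemma residual_error : dom w residual.
Proof.
exists 1 => // x Dx; rewrite mul1r ger0_norm ?r_ge0// /w.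
have t0 := sqrt_keys_gt0 Dx; have := r_ge0 Dx.
have tu : t x * (t x)^-1 = 1 by rewrite mulfV// gt_eqF.
have u0 : 0 < (t x)^-1 by rewrite invr_gt0.
move: (t x) (t x)^-1 (residual x) t0 tu u0 => a u r a0 au u0 rr.
have h1 : 0 <= u * (a * r - 1) ^+ 2 by rewrite mulr_ge0 ?sqr_ge0// ltW.
have -> : a * r ^+ 2 + a ^+ 3 * r ^+ 4 + u =
   (u * (a * r - 1) ^+ 2 + 2 * r) + a ^+ 3 * r ^+ 4.
  have -> : u * (a * r - 1) ^+ 2 = (a * u) * (a * r ^+ 2) - 2 * (a * u) * r + u by ring.
  by rewrite au; ring.
have h2 : 0 <= a ^+ 3 * r ^+ 4 by rewrite mulr_ge0 ?exprn_ge0// ltW.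
lra.
Qed.

(** The left factor will bound [f (Y x)], the right one a scaled second-order error. The cubic term
    obeys [2 t^2 r^3 <= t r^2 + t^3 r^4], which is where the fourth moment enters. *)
Lemma product_error : dom w (fun x => (1 + t x * residual x) * (t x * s2 R x)).
Proof.
exists 3 => // x Dx; rewrite /s2 invN_sqrt// /w.
have t0 := sqrt_keys_gt0 Dx; have := r_ge0 Dx.
have tu : t x * (t x)^-1 = 1 by rewrite mulfV// gt_eqF.
have u0 : 0 < (t x)^-1 by rewrite invr_gt0.
move: (t x) (t x)^-1 (residual x) t0 tu u0 => a u r a0 au u0 rr.
have -> : (1 + a * r) * (a * (r ^+ 2 + u ^+ 2)) =
  a * r ^+ 2 + a ^+ 2 * r ^+ 3 + (a * u) * u + (a * u) ^+ 2 * r by ring.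
rewrite au expr1n !mul1r.
have h1 : 0 <= u * (a * r - 1) ^+ 2 by rewrite mulr_ge0 ?sqr_ge0// ltW.
have e1 : u * (a * r - 1) ^+ 2 = a * r ^+ 2 - 2 * r + u.
  have -> : u * (a * r - 1) ^+ 2 = (a * u) * (a * r ^+ 2) - 2 * (a * u) * r + u by ring.
  by rewrite au; ring.
have h2 : 0 <= a * r ^+ 2 * (a * r - 1) ^+ 2.
  by apply: mulr_ge0 (sqr_ge0 _); apply: mulr_ge0 (sqr_ge0 _); exact: ltW.
have e2 : a * r ^+ 2 * (a * r - 1) ^+ 2 = a ^+ 3 * r ^+ 4 - 2 * (a ^+ 2 * r ^+ 3) + a * r ^+ 2 by ring.
have h3 : 0 <= a ^+ 3 * r ^+ 4 by rewrite mulr_ge0 ?exprn_ge0// ltW.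
have h4 : 0 <= a * r ^+ 2 by rewrite mulr_ge0 ?exprn_ge0// ltW.
have h5 : 0 <= a ^+ 2 * r ^+ 3 by rewrite mulr_ge0 ?exprn_ge0// ltW.
rewrite ger0_norm ?addr_ge0// ?(ltW u0)//; lra.
Qed.

Lemma residual_mean2 : mean_le 1 (fun x => residual x ^+ 2).
Proof.
have hF (i : 'I_q) : mean_le 1 (fun x => `|imbalance i x| ^+ 2).
  apply: domin_mean_le (imbalance_mean2 R (ltn_ord i)) _.
  by exists 1 => // x _; rewrite mul1r real_normK ?num_real// ger0_norm ?sqr_ge0.
have hg : mean_le 1 (fun x => `|invN x| ^+ 2).
  apply: domin_mean_le (mean_le_invNX R q 1) _.
  apply: eq_domin (dominMl (invN_bd R q) (domin_refl (@invN_ge0 R q))) => x Dx.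
  by rewrite ger0_norm ?invr_ge0 ?ltW ?num_keys_gt0// expr2.
apply: domin_mean_le (mean_le_norm_sum (index_enum 'I_q) hF hg) _; exists 1 => // x Dx.
by rewrite mul1r /residual (ger0_norm (@invN_ge0 R q _ Dx)) ger0_norm ?sqr_ge0.
Qed.

Lemma residual_mean4 : mean_le 2 (fun x => residual x ^+ 4).
Proof.
have hF (i : 'I_q) : mean_le 2 (fun x => `|imbalance i x| ^+ 4).
  apply: domin_mean_le (imbalance_mean4 R (ltn_ord i)) _.
  exists 1 => // x _; rewrite mul1r normrX normr_id.
  rewrite -[4%N]/(2 * 2)%N !exprM real_normK ?num_real//.
have hg : mean_le 2 (fun x => `|invN x| ^+ 4).
  apply: domin_mean_le (mean_le_invNX R q 2) _.
  apply: eq_domin (dominMl (dominX 2 (invN_bd R q)) (dominM (domin_refl (@invN_ge0 R q)) (domin_refl (@invN_ge0 R q)))) => x Dx.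
  rewrite ger0_norm ?invr_ge0 ?ltW ?num_keys_gt0//; ring.
apply: domin_mean_le (mean_le_norm_sum (index_enum 'I_q) hF hg) _; exists 1 => // x Dx.
rewrite mul1r /residual (ger0_norm (@invN_ge0 R q _ Dx)).
by rewrite -[4%N]/(2 * 2)%N !exprM ger0_norm ?sqr_ge0.
Qed.

Lemma error_weight_mean (p : cfg -> R) : dom w p ->
  exists2 C : R, 0 <= C & forall n, (2 * m <= n)%N -> `|E n p| <= C / Num.sqrt n%:R.
Proof.
clear rho_eq rho_gt0.
move=> [C C0 hC]; have [C2 C20 h2] := residual_mean2; have [C4 C40 h4] := residual_mean4.
exists (C * (C2 + C4 + 1)); first by rewrite mulr_ge0 ?addr_ge0.
move=> n mn; have En := is_mean_E R q n.
have n0 : 0 < n%:R :> R by rewrite ltr0n; lia.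
have s0 : 0 < Num.sqrt n%:R :> R by rewrite sqrtr_gt0.
apply: (@le_trans _ _ (E n (fun x => C * w x))).
  by apply: (ler_norm_expect En) => x fx; apply: hC; exact: forest_large fx.
rewrite (expectZ En) -mulrA ler_wpM2l//.
set s := Num.sqrt _ in s0 *; have ss : n%:R = s ^+ 2 :> R by rewrite sqr_sqrtr ?ler0n.
rewrite (eq_expect (q := fun x => (s * residual x ^+ 2 + s ^+ 3 * residual x ^+ 4) + s^-1 * 1) En); last first.
  by move=> x fx; rewrite /w /t (forest_num_keys R fx) mulr1.
rewrite 2!(expectD En) !(expectZ En) (expect1 En) mulr1 mulrDl mul1r lerD2r mulrDl.
have {}h2 := h2 n mn; have {}h4 := h4 n mn; rewrite ss expr1 in h2 h4.
apply: lerD.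
  apply: le_trans (ler_wpM2l (ltW s0) h2) _; rewrite le_eqVlt; apply/orP; left; apply/eqP.
  by field; rewrite gt_eqF.
apply: le_trans (ler_wpM2l (exprn_ge0 3 (ltW s0)) h4) _; rewrite le_eqVlt; apply/orP; left; apply/eqP.
by field; rewrite gt_eqF.
Qed.

Lemma scaled_nodes_bound : dom (fun x => t x * residual x) Y.
Proof.
have h1 := dev_full_eta rho_gt0 rho_eq; have h2 := dev_eta rho_gt0 rho_eq (ltn0Sn q).
have h3 := domin_residual_invN (domin_refl (@invN_ge0 R q)).
have h := dominD (dominB (dominZ (m%:R * kst) h1) (dominZ (mu 0) h2)) h3.
have t0 : gauge D t by move=> x Dx; rewrite ltW ?sqrt_keys_gt0.
by apply: eq_domin (dominM (domin_refl t0) h) => x Dx; rewrite scaled_nodesE.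
Qed.

Lemma scaled_nodes_mean2 :
  exists2 C : R, 0 <= C & forall n, (2 * m <= n)%N -> E n (fun x => Y x ^+ 2) <= C.
Proof.
have [C C0 hC] := scaled_nodes_bound; have [C2 C20 h2] := residual_mean2.
exists (C ^+ 2 * C2); first by rewrite mulr_ge0 ?sqr_ge0.
move=> n mn; have En := is_mean_E R q n.
have n0 : 0 < n%:R :> R by rewrite ltr0n; lia.
apply: (@le_trans _ _ (E n (fun x => (C ^+ 2 * n%:R) * residual x ^+ 2))).
  apply: (le_expect En) => x fx; have Dx := forest_large mn fx.
  rewrite -(forest_num_keys R fx) -[Y x ^+ 2](real_normK (num_real _)).
  have -> : num_keys x = t x ^+ 2 by rewrite sqr_sqrtr// ltW ?num_keys_gt0.
  rewrite -mulrA -!exprMn lerXn2r ?nnegrE ?hC//.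
  by rewrite !mulr_ge0 ?r_ge0// ltW ?sqrt_keys_gt0.
rewrite (expectZ En) -mulrA ler_wpM2l ?sqr_ge0// mulrC -ler_pdivlMr//.
by have := h2 n mn; rewrite expr1.
Qed.

End NormalizedNodes.

(** * Asymptotic Stein identity for a single exchange *)

Section SteinLimits.
Variables (R : realType) (q : nat) (rho : R).
Local Notation m := q.+2.
Local Notation M := q.+1.
Local Notation cfg := {ffun 'I_m -> nat}.
Implicit Types (x y : cfg).
Hypothesis rho_gt0 : 0 < rho.
Hypothesis rho_eq :
  (m%:R : R) ^+ m * (\sum_(1 <= j < m) rho ^+ j) ^+ m.-1 = m.-1%:R ^+ m.-1.

Local Notation D := (@large_tree q).
Local Notation dom := (domin D).
Local Notation num_keys := (@num_keys R q).
Local Notation prop := (@prop R q).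
Local Notation full := (@full R q).
Local Notation imbalance := (@imbalance R q).
Local Notation out_rate := (@out_rate R q).
Local Notation invN := (fun x => (num_keys x)^-1).
Local Notation E := (@Ecfg R q).
Local Notation residual := (@residual R q).
Local Notation geo_moment := (geo_moment q rho).
Local Notation mu := (leaf_eq q rho).
Local Notation kst := (full_eq q rho).
Local Notation dev := (dev rho).
Local Notation dev_full := (dev_full rho).
Local Notation ell := (ell rho).
Local Notation rate_eq := (rate_eq q rho).

Local Notation t := (@sqrt_keys R q).
Local Notation Y := (@scaled_nodes R q rho).
Local Notation w := (@error_weight R q).

(** The change of the number of nonempty nodes: one full node appears, and for [k = 0] the [M]
    leaves with one key become empty. *)
Definition jump (k : nat) : R := if k == 0%N then 1 - M%:R else 1.

Lemma nodes_mv k x : (k < q)%N -> movable k x ->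
  (nodes (mv k x))%:R = (nodes x)%:R + jump k :> R.
Proof.
move=> kq /andP[_ xk]; have := congr1 (@nodes q) (mvE kq xk); rewrite !nodes_cinc.
have -> : (ord_max != ord0 :> 'I_m) by apply/eqP => /(congr1 val).
have -> : (inord k.+1 != ord0 :> 'I_m).
  by apply/eqP => /(congr1 val); rewrite /= inordK//; lia.
have -> : (inord k != ord0 :> 'I_m) = (k != 0%N).
  by rewrite -val_eqE /= inordK//; lia.
rewrite eqxx /jump => /(congr1 (fun n : nat => n%:R : R)).
case: (k == 0%N) => /=; rewrite ?mul0n ?mul1n ?addn0 !natrD ?muln1 => h; lra.
Qed.

Section Functional.
Variables (f df : R -> R) (K : R).
Hypothesis f_df : forall x : R, is_derive x 1 f (df x).
Hypothesis df_cont : continuous df.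
Hypothesis df_le : forall x : R, `|df x| <= K.

Lemma K_ge0 : 0 <= K. Proof. exact: le_trans (normr_ge0 _) (df_le 0). Qed.

Lemma functional_bound : dom (fun x => 1 + t x * residual x) (fun x => f (Y x)).
Proof.
have [C C0 hC] := scaled_nodes_bound rho_gt0 rho_eq.
exists (`|f 0| + K * C); first by rewrite addr_ge0 ?mulr_ge0 ?K_ge0.
move=> x Dx; have h := lipschitz_bound f_df df_le 0 (Y x); rewrite subr0 in h.
have h2 := hC x Dx; have tr : 0 <= t x * residual x.
  by rewrite mulr_ge0 ?residual_ge0// ltW ?sqrt_keys_gt0.
rewrite -(subrK (f 0) (f (Y x))) (le_trans (ler_normD _ _))// mulrDl addrC.
rewrite lerD//; first by rewrite ler_peMr// lerDl.
rewrite (le_trans h)// -mulrA ler_wpM2l ?K_ge0// (le_trans h2)//.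
by rewrite ler_wpM2l// lerDr.
Qed.

Lemma domin_error_functional p : dom (@s2 R q) p -> dom w (fun x => f (Y x) * (t x * p x)).
Proof.
move=> hp; apply: dominW (product_error R q) _.
have t0 : gauge D t by move=> x Dx; rewrite ltW ?sqrt_keys_gt0.
exact: dominM functional_bound (dominM (domin_refl t0) hp).
Qed.

Let step k x : R := jump k / t x.

(** Three errors: linearizing [imbalance] ([T1]), replacing [out_rate] by its equilibrium value
    ([T2]), and expanding [f] to first order ([T3]). *)
Let T1 k x : R := f (Y x) * (t x * (M%:R * ell k x - imbalance k x / rate_eq k)).
Let T2 k x : R := t x * (f (Y x + step k x) - f (Y x)) * (out_rate k x / rate_eq k - 1).
Let T3 k x : R := t x * (f (Y x + step k x) - f (Y x)) - jump k * df (Y x).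

Lemma functional_mv k x : (k < q)%N -> D x ->
  (f (Y (mv k x)) - f (Y x)) * out_rate k x = (f (Y x + step k x) - f (Y x)) * out_rate k x.
Proof.
move=> kq Dx; have [->|hx] := out_rate_off R k Dx; first by rewrite !mulr0.
congr ((f _ - _) * _); rewrite /scaled_nodes /step /sqrt_keys mv_num_keys// nodes_mv//.
rewrite -/(t x); have tx := sqrt_keys_gt0 R Dx.
have -> : num_keys x = t x ^+ 2 by rewrite sqr_sqrtr// ltW ?num_keys_gt0.
by move: (t x) tx => s s0; field; rewrite gt_eqF.
Qed.

(** The two sides differ by [sqrt n / rate_eq k] times the mean of [f(Y) imbalance - (f(Y + step) -
    f(Y)) out_rate], which is zero by [E_imbalance]. *)
Lemma stein_decomposition k n : (k < q)%N -> (2 * m <= n)%N ->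
  E n (fun x => f (Y x) * (t x * (M%:R * ell k x))) - jump k * E n (fun x => df (Y x)) =
  E n (T1 k) + E n (T2 k) + E n (T3 k).
Proof.
move=> kq mn; have En := is_mean_E R q n.
have g0 : rate_eq k != 0 by rewrite gt_eqF// rate_eq_gt0.
pose A x := f (Y x) * imbalance k x.
pose B x := (f (Y x + step k x) - f (Y x)) * out_rate k x.
have AB : E n A = E n B.
  rewrite /A (E_imbalance kq (fun x => f (Y x)) mn); apply: (eq_expect En) => x fx.
  by apply: functional_mv => //; exact: forest_large fx.
rewrite -(expectZ En) -(expectB _ _ En) -!(expectD En).
apply/eqP; rewrite -subr_eq0 -(expectB _ _ En); apply/eqP.
transitivity (E n (fun x => (Num.sqrt n%:R / rate_eq k) * (A x - B x))).
  apply: (eq_expect En) => x fx; rewrite /T1 /T2 /T3 /A /B /sqrt_keys (forest_num_keys R fx).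
  by move: (rate_eq k) g0 => g g0; field.
by rewrite (expectZ En) (expectB _ _ En) AB subrr mulr0.
Qed.

Lemma T1_error k : (k < q)%N -> dom w (T1 k).
Proof.
move=> kq; apply: domin_error_functional.
by apply: eq_domin (dominN (imbalance_lin rho_gt0 rho_eq kq)) => x _; rewrite opprB.
Qed.

Lemma T2_error k : (k < q)%N -> dom w (T2 k).
Proof.
move=> kq; apply: dominW (residual_error R q) _.
have [_ h] := lin_out_rate rho_gt0 rho_eq kq.
have s2r : dom residual (@s2 R q).
  apply: dominD (domin_residual_invN (domin_refl (@invN_ge0 R q))).
  apply: eq_domin (dominMl (residual_bd R q) (domin_refl (@residual_ge0 R q))) => x _.
  by rewrite expr2.
have h1 : dom residual (fun x => out_rate k x / rate_eq k - 1).
  apply: eq_domin (dominD (dominW s2r h) (dominD (dominZ m%:R (dev_full_eta rho_gt0 rho_eq))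
    (dominZ M%:R (dev_eta rho_gt0 rho_eq (k := k.+1) _)))) => [x _|//]; ring.
apply: dominMr h1; exists (K * `|jump k|); first by rewrite mulr_ge0 ?K_ge0.
move=> x Dx; have tx := sqrt_keys_gt0 R Dx.
have := lipschitz_bound f_df df_le (Y x) (Y x + step k x).
rewrite (addrC (Y x)) addrK /step normrM normfV (gtr0_norm tx) => h2.
rewrite mulr1 normrM (gtr0_norm tx) (le_trans (ler_wpM2l (ltW tx) h2))//.
by rewrite le_eqVlt; apply/orP; left; apply/eqP; field; rewrite gt_eqF.
Qed.

(** No rate is available, as [df] has only the weighted modulus; the weight is paid for by the
    bounded second moment of [Y]. *)
Lemma T3_cvg k : (fun n => E n (T3 k)) @ \oo --> (0 : R).
Proof.
have [C C0 hC] := scaled_nodes_mean2 rho_gt0 rho_eq.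
apply/cvgrPdist_le => e e0.
have e'0 : 0 < e / ((`|jump k| + 1) * (1 + C)).
  by rewrite divr_gt0// mulr_gt0// ltr_wpDr// ?ltr_wpDl.
have [d d0 hd] := increment_approx f_df df_le df_cont e'0.
near=> n; have En := is_mean_E R q n.
have mn : (2 * m <= n)%N by near: n; exact: nbhs_infty_ge.
rewrite sub0r normrN.
apply: (@le_trans _ _ (E n (fun x => `|jump k| * (e / ((`|jump k| + 1) * (1 + C))) * (1 + Y x ^+ 2)))).
  apply: (ler_norm_expect En) => x fx; have Dx := forest_large mn fx.
  have tx := sqrt_keys_gt0 R Dx.
  have -> : T3 k x = t x * (f (Y x + step k x) - f (Y x) - step k x * df (Y x)).
    by rewrite /T3 /step; field; rewrite gt_eqF.
  rewrite normrM (gtr0_norm tx).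
  have hs : `|step k x| = `|jump k| / t x by rewrite /step normrM normfV (gtr0_norm tx).
  apply: le_trans (ler_wpM2l (ltW tx) (hd (Y x) (step k x) _)) _.
    rewrite hs ler_pdivrMr// mulrC -ler_pdivrMr// /sqrt_keys (forest_num_keys R fx).
    rewrite -[leLHS]ger0_norm ?divr_ge0// ?(ltW d0)// -sqrtr_sqr ler_wsqrtr//.
    by near: n; exact: nbhs_infty_ger.
  rewrite hs le_eqVlt; apply/orP; left; apply/eqP.
  by set a := e / _; move: (Y x) (t x) tx => y s s0; field; rewrite gt_eqF.
rewrite (expectZ En) (expectD En) (expect1 En).
have j1 : 0 < `|jump k| + 1 by rewrite ltr_wpDl.
have C1 : 0 < 1 + C by rewrite ltr_wpDr.
apply: (@le_trans _ _ ((`|jump k| * (e / ((`|jump k| + 1) * (1 + C)))) * (1 + C))).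
  by apply: ler_wpM2l; [apply: mulr_ge0 => //; exact: ltW|rewrite lerD2l hC].
rewrite (_ : `|jump k| * (e / ((`|jump k| + 1) * (1 + C))) * (1 + C) = e * (`|jump k| / (`|jump k| + 1))); last by field; rewrite !gt_eqF.
by rewrite ler_piMr ?(ltW e0)// ler_pdivrMr// mul1r lerDl.
Unshelve. all: by end_near. Qed.

Lemma error_cvg p : dom w p -> (fun n => E n p) @ \oo --> (0 : R).
Proof.
move=> hp; have [C C0 hC] := error_weight_mean hp.
apply/cvgrPdist_le => e e0; near=> n; rewrite sub0r normrN.
have mn : (2 * m <= n)%N by near: n; exact: nbhs_infty_ge.
apply: le_trans (hC n mn) _; rewrite (le_trans (ler_norm _))// -normrN -sub0r.
by near: n; move: (@cvg_div_sqrt R C) => /cvgrPdist_le; exact.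
Unshelve. all: by end_near. Qed.

Lemma stein_limit_ell k : (k < q)%N ->
  (fun n => E n (fun x => f (Y x) * (t x * (M%:R * ell k x))) -
            jump k * E n (fun x => df (Y x))) @ \oo --> (0 : R).
Proof.
move=> kq.
have h : (fun n => E n (T1 k) + E n (T2 k) + E n (T3 k)) @ \oo --> (0 : R).
  rewrite -[0 : R]addr0; apply: cvgD; last exact: T3_cvg.
  rewrite -[0 : R]addr0; apply: cvgD; apply: error_cvg; [exact: T1_error|exact: T2_error].
apply: cvg_trans h; apply: near_eq_cvg; near=> n.
by rewrite stein_decomposition//; near: n; exact: nbhs_infty_ge.
Unshelve. all: by end_near. Qed.

End Functional.
End SteinLimits.

(** * The number of nodes as a combination of the balance equations *)

Section Combination.
Variables (R : realType) (q : nat) (rho : R).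
Local Notation m := q.+2.
Local Notation M := q.+1.
Local Notation cfg := {ffun 'I_m -> nat}.
Implicit Types (x y : cfg).
Hypothesis rho_gt0 : 0 < rho.
Hypothesis rho_eq :
  (m%:R : R) ^+ m * (\sum_(1 <= j < m) rho ^+ j) ^+ m.-1 = m.-1%:R ^+ m.-1.

Local Notation D := (@large_tree q).
Local Notation dom := (domin D).
Local Notation num_keys := (@num_keys R q).
Local Notation prop := (@prop R q).
Local Notation full := (@full R q).
Local Notation imbalance := (@imbalance R q).
Local Notation out_rate := (@out_rate R q).
Local Notation invN := (fun x => (num_keys x)^-1).
Local Notation E := (@Ecfg R q).
Local Notation residual := (@residual R q).
Local Notation geo_moment := (geo_moment q rho).
Local Notation mu := (leaf_eq q rho).
Local Notation kst := (full_eq q rho).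
Local Notation dev := (dev rho).
Local Notation dev_full := (dev_full rho).
Local Notation ell := (ell rho).
Local Notation rate_eq := (rate_eq q rho).

Local Notation t := (@sqrt_keys R q).
Local Notation Y := (@scaled_nodes R q rho).
Local Notation w := (@error_weight R q).
Local Notation drift := (drift q rho).
Local Notation jump := (jump R q).

Lemma expect_sum (X : Type) (F : nat -> (X -> R) -> R) (DX : nat -> X -> Prop) n
    (I : Type) (s : seq I) (p : I -> X -> R) : is_mean F DX n ->
  F n (fun x : X => \sum_(i <- s) p i x) = \sum_(i <- s) F n (p i).
Proof.
move=> hF; elim: s => [|i s IHs].
  rewrite big_nil (eq_expect (q := fun=> 0) hF) ?(expect_cst _ hF)// => x _; exact: big_nil.
rewrite big_cons -IHs -(expectD hF); apply: (eq_expect hF) => x _; exact: big_cons.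
Qed.

Lemma cvg0_sum (n : nat) (u : nat -> nat -> R) :
  (forall k, (k < n)%N -> u k @ \oo --> (0 : R)) ->
  (fun l => \sum_(k < n) u k l) @ \oo --> (0 : R).
Proof.
elim: n => [|n IHn] h.
  by under eq_fun do rewrite big_ord0; exact: cvg_cst.
under eq_fun do rewrite big_ord_recr /=.
have := cvgD (IHn (fun k kn => h k (ltnW kn))) (h n (ltnSn n)).
by rewrite addr0 => h2; exact: h2.
Qed.

Definition ell_sum (j : nat) x : R := \sum_(k < j) ell k x.

(** Summed over [k < j], the definition of [ell] telescopes: all deviations are expressed by
    [dev 0], [dev_full] and the [ell k]. *)
Lemma dev_ell_sum j x :
  dev j x = j.+1%:R * dev 0 x - j%:R * dev_full x - ell_sum j x.
Proof.
elim: j => [|j IHj]; first by rewrite /ell_sum big_ord0; ring.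
rewrite /ell_sum big_ord_recr /= -/(ell_sum j x) /ell IHj -!natr1; ring.
Qed.

Lemma leaf_eqE k : mu k = mu 0 * rho ^+ k.
Proof. by rewrite /leaf_eq expr0 mulr1. Qed.

Lemma sum_leaf_eq : \sum_(k < M) mu k = M%:R * kst.
Proof.
under eq_bigr do rewrite leaf_eqE.
rewrite -mulr_sumr -geo_moment0E /full_eq /leaf_eq expr0 mulr1; field.
have q1 : 0 < 1 + q%:R :> R by rewrite ltr_wpDr.
by rewrite !gt_eqF ?geo_moment01_gt0.
Qed.

Lemma sum_keyed_leaf_eq : \sum_(k < M) k%:R * mu k + M%:R * kst = 1.
Proof.
have -> : \sum_(k < M) k%:R * mu k = mu 0 * geo_moment 1.
  by rewrite /geo_moment mulr_sumr; apply: eq_bigr => k _; rewrite leaf_eqE expr1 mulrCA.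
rewrite /full_eq /leaf_eq expr0 mulr1.
have := geo_moment01_gt0 q rho_gt0; move: (geo_moment 0) (geo_moment 1) => a b ab; field.
have q1 : 0 < 1 + q%:R :> R by rewrite ltr_wpDr.
by rewrite !gt_eqF.
Qed.

Lemma prop_dev k x : prop k x = mu k * (1 + dev k x).
Proof.
rewrite /dev; have := leaf_eq_gt0 q rho_gt0 k; move: (mu k) (prop k x) => a b a0.
by field; rewrite gt_eqF.
Qed.

Lemma full_dev x : full x = kst * (1 + dev_full x).
Proof.
rewrite /dev_full; have := full_eq_gt0 q rho_gt0; move: kst (full x) => a b a0.
by field; rewrite gt_eqF.
Qed.

Lemma sum_dev x : D x ->
  \sum_(k < M) mu k * dev k x = M%:R * kst * dev_full x + invN x.
Proof.
move=> Dx; have := sum_prop R Dx; rewrite full_dev.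
under eq_bigr do rewrite prop_dev mulrDr mulr1.
rewrite big_split /= sum_leaf_eq => h.
have -> : \sum_(k < M) mu k * dev k x =
  (M%:R * kst + \sum_(k < M) mu k * dev k x) - M%:R * kst by ring.
by rewrite h; ring.
Qed.

Lemma sum_keyed_dev x : D x ->
  \sum_(k < M) k%:R * (mu k * dev k x) + M%:R * kst * dev_full x = 0.
Proof.
move=> Dx; have := sum_keyed_prop R Dx; rewrite full_dev.
under eq_bigr do rewrite prop_dev mulrDr mulr1 mulrDr.
rewrite big_split /= => h.
have -> : \sum_(k < M) k%:R * (mu k * dev k x) + M%:R * kst * dev_full x =
  (\sum_(k < M) k%:R * mu k + \sum_(k < M) k%:R * (mu k * dev k x) +
   M%:R * (kst * (1 + dev_full x))) - (\sum_(k < M) k%:R * mu k + M%:R * kst) by ring.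
by rewrite h sum_keyed_leaf_eq subrr.
Qed.

(** For [r = 0] and [r = 1] the two constraints evaluate the left-hand side, which leaves two
    equations for [dev 0] and [dev_full]. *)
Lemma sum_moment_dev r x :
  \sum_(k < M) k%:R ^+ r * rho ^+ k * dev k x =
  (geo_moment r.+1 + geo_moment r) * dev 0 x - geo_moment r.+1 * dev_full x -
  \sum_(k < M) k%:R ^+ r * rho ^+ k * ell_sum k x.
Proof.
rewrite /geo_moment mulrDl !mulr_suml -big_split -!sumrB /=; apply: eq_bigr => k _.
rewrite dev_ell_sum -natr1 exprS; ring.
Qed.

(** [slope] and [intercept] solve a 2 by 2 system: they write [m kst dev_full - mu_0 dev_0] as
    [slope * B + intercept * A] up to [O(1 / N)], where [A = sum_k rho^k ell_sum_k] and
    [B = sum_k k rho^k ell_sum_k]. *)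
Definition slope : R := drift * mu 0.
Definition intercept : R :=
  mu 0 * (drift * mu 0 * (geo_moment 0 - geo_moment 2) - m%:R * kst).

Definition ell_coef (j : nat) : R := rho ^+ j * (slope * j%:R + intercept).

(** Exact, because both constraints are linear; the last term collects the [1 / N] of the node
    count, once from [Y] itself and once from the constraint behind [A]. *)
Lemma scaled_nodes_ell x : D x ->
  Y x = t x * (\sum_(j < M) ell_coef j * ell_sum j x) + (intercept / mu 0 + 1) * (t x * invN x).
Proof.
move=> Dx; rewrite scaled_nodesE//.
have h0 := sum_dev Dx; have h1 := sum_keyed_dev Dx.
have kstE : M%:R * kst = mu 0 * geo_moment 0.
  rewrite -sum_leaf_eq geo_moment0E mulr_sumr.
  by apply: eq_bigr => k _; rewrite leaf_eqE.
have mu0 := leaf_eq_gt0 q rho_gt0 0; have mu0n : mu 0 != 0 by rewrite gt_eqF.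
pose A := \sum_(k < M) rho ^+ k * ell_sum k x.
pose B := \sum_(k < M) k%:R * rho ^+ k * ell_sum k x.
have hA : A = (geo_moment 0 + geo_moment 1) * (dev 0 x - dev_full x) - invN x / mu 0.
  have e0 : \sum_(k < M) k%:R ^+ 0 * rho ^+ k * dev k x = geo_moment 0 * dev_full x + invN x / mu 0.
    apply: (mulfI mu0n); rewrite mulrDr mulrA -kstE [mu 0 * (_ / _)]mulrC mulfVK// -h0 mulr_sumr.
    by apply: eq_bigr => k _; rewrite (leaf_eqE k) expr0; ring.
  have := sum_moment_dev 0 x; rewrite e0.
  rewrite (_ : \sum_(k < M) k%:R ^+ 0 * rho ^+ k * ell_sum k x = A).
    by move=> h; rewrite -[A](subKr (invN x / mu 0 + geo_moment 0 * dev_full x)) addrC; lra.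
  by apply: eq_bigr => k _; rewrite expr0 mul1r.
have hB : B = (geo_moment 2 + geo_moment 1) * dev 0 x + (geo_moment 0 - geo_moment 2) * dev_full x.
  have e1 : \sum_(k < M) k%:R ^+ 1 * rho ^+ k * dev k x = - (geo_moment 0 * dev_full x).
    apply: (mulfI mu0n); rewrite mulrN mulrA -kstE; apply/eqP; rewrite -addr_eq0 -[X in _ == X]h1.
    apply/eqP; congr (_ + _); rewrite mulr_sumr.
    by apply: eq_bigr => k _; rewrite (leaf_eqE k) expr1; ring.
  have := sum_moment_dev 1 x; rewrite e1.
  rewrite (_ : \sum_(k < M) k%:R ^+ 1 * rho ^+ k * ell_sum k x = B).
    by move=> h; lra.
  by apply: eq_bigr => k _; rewrite expr1.
have -> : \sum_(j < M) ell_coef j * ell_sum j x = slope * B + intercept * A.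
  by rewrite /A /B !mulr_sumr -big_split /=; apply: eq_bigr => k _; rewrite /ell_coef; ring.
have mu0E : mu 0 = (geo_moment 0 + geo_moment 1)^-1 by rewrite /leaf_eq expr0 mulr1.
have s01 := geo_moment01_gt0 q rho_gt0.
rewrite hA hB /slope /intercept /drift mu0E.
move: (dev 0 x) (dev_full x) (invN x) (t x) kst (geo_moment 0) (geo_moment 1) (geo_moment 2) s01.
move=> a b u s c s0 s1 s2 s01; field.
by rewrite gt_eqF.
Qed.

Section Functional.
Variables (f df : R -> R) (K : R).
Hypothesis f_df : forall x : R, is_derive x 1 f (df x).
Hypothesis df_cont : continuous df.
Hypothesis df_le : forall x : R, `|df x| <= K.

(** In the limit [f(Y) t M ell_k] has the mean of [jump k * df(Y)]; this is what the coefficients of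
    [Y] make of it. *)
Definition limit_variance : R :=
  (\sum_(j < M) ell_coef j * \sum_(k < j) jump k) / M%:R.

Let G k n : R := E n (fun x => f (Y x) * (t x * (M%:R * ell k x))) -
            jump k * E n (fun x => df (Y x)).

Lemma limit_decomposition n : (2 * m <= n)%N ->
  E n (fun x => limit_variance * df (Y x) - Y x * f (Y x)) =
  - (M%:R^-1 * \sum_(j < M) ell_coef j * (\sum_(k < j) G k n)) -
  (intercept / mu 0 + 1) * E n (fun x => f (Y x) * (t x * invN x)).
Proof.
move=> mn; have En := is_mean_E R q n.
rewrite (expectB _ _ En) (expectZ En).
rewrite (eq_expect (p := fun x => Y x * _) (q := fun x =>
    M%:R^-1 * (\sum_(j < M) ell_coef j * (\sum_(k < j) f (Y x) * (t x * (M%:R * ell k x)))) +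
    (intercept / mu 0 + 1) * (f (Y x) * (t x * invN x))) En); last first.
  move=> x fx; have Dx := forest_large mn fx.
  rewrite {1}scaled_nodes_ell// mulrDl; congr (_ + _); last by ring.
  rewrite -mulrA mulr_suml [LHS]mulr_sumr [RHS]mulr_sumr; apply: eq_bigr => j _.
  rewrite /ell_sum !mulr_sumr mulr_suml mulr_sumr; apply: eq_bigr => k _.
  have M0 : M%:R != 0 :> R by [].
  by move: (f (Y x)) (t x) (ell k x) (ell_coef j) (M%:R : R) M0 => a b c d e e0; field.
rewrite (expectD En) !(expectZ En) (expect_sum _ _ En).
under eq_bigr do rewrite (expectZ En) (expect_sum _ _ En).
rewrite opprD addrA; congr (_ - _).
rewrite /limit_variance mulrAC mulrC mulr_suml -mulrBr -mulrN -sumrB -sumrN.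
congr (_ * _); apply: eq_bigr => j _.
by rewrite -mulrA -mulrBr -mulrN mulr_suml -sumrB -sumrN; congr (_ * _); apply: eq_bigr => k _; rewrite /G opprB.
Qed.

Lemma stein_limit :
  (fun n => E n (fun x => limit_variance * df (Y x) - Y x * f (Y x))) @ \oo --> (0 : R).
Proof.
have hG k : (k < q)%N -> G k @ \oo --> (0 : R).
  exact: (stein_limit_ell rho_gt0 rho_eq f_df df_cont df_le).
have h1 j : (j < M)%N -> (fun n => ell_coef j * \sum_(k < j) G k n) @ \oo --> (0 : R).
  move=> jM; suff : (fun n => ell_coef j * \sum_(k < j) G k n) @ \oo --> ell_coef j * (0 : R).
    by rewrite mulr0.
  apply: cvgM; first exact: cvg_cst.
  by apply: cvg0_sum => k kj; apply: hG; rewrite (leq_trans kj).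
have h2 : (fun n => E n (fun x => f (Y x) * (t x * invN x))) @ \oo --> (0 : R).
  apply: error_cvg.
  apply: (domin_error_functional rho_gt0 rho_eq f_df df_le).
  exact: s2_invN (domin_refl (@invN_ge0 R q)).
have h3 : (fun n => - (M%:R^-1 * \sum_(j < M) ell_coef j * (\sum_(k < j) G k n)) -
  (intercept / mu 0 + 1) * E n (fun x => f (Y x) * (t x * invN x))) @ \oo --> (0 : R).
  suff : (fun n => - (M%:R^-1 * \sum_(j < M) ell_coef j * (\sum_(k < j) G k n)) -
    (intercept / mu 0 + 1) * E n (fun x => f (Y x) * (t x * invN x))) @ \oo -->
    - (M%:R^-1 * (0 : R)) - (intercept / mu 0 + 1) * 0.
    by rewrite !mulr0 oppr0 addr0.
  apply: cvgB.
    apply: cvgN; apply: cvgM; first exact: cvg_cst.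
    by apply: (cvg0_sum (u := fun j n => ell_coef j * \sum_(k < j) G k n)); exact: h1.
  by apply: cvgM; [exact: cvg_cst|exact: h2].
apply: cvg_trans h3; apply: near_eq_cvg; near=> n.
by rewrite limit_decomposition//; near: n; exact: nbhs_infty_ge.
Unshelve. all: by end_near. Qed.

End Functional.
End Combination.

(** * Constants *)

Section Constants.
Variables (R : realType) (q : nat) (rho : R).
Local Notation m := q.+2.
Local Notation M := q.+1.
Local Notation cfg := {ffun 'I_m -> nat}.
Implicit Types (x y : cfg).
Hypothesis rho_gt0 : 0 < rho.
Hypothesis rho_eq :
  (m%:R : R) ^+ m * (\sum_(1 <= j < m) rho ^+ j) ^+ m.-1 = m.-1%:R ^+ m.-1.

Local Notation D := (@large_tree q).
Local Notation dom := (domin D).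
Local Notation num_keys := (@num_keys R q).
Local Notation prop := (@prop R q).
Local Notation full := (@full R q).
Local Notation imbalance := (@imbalance R q).
Local Notation out_rate := (@out_rate R q).
Local Notation geo_moment := (geo_moment q rho).
Local Notation S0 := (geo_moment 0).
Local Notation S1 := (geo_moment 1).
Local Notation S2 := (geo_moment 2).
Local Notation drift := (drift q rho).
Hypothesis rho_lt1 : rho < 1.

Let b : R := m%:R `^ (1 / (m%:R - 1)).

Let m0 : 0 < m%:R :> R. Proof. by []. Qed.
Let M0 : 0 < M%:R :> R. Proof. by []. Qed.
Let mM : m%:R - 1 = M%:R :> R. Proof. by rewrite -natr1 addrK. Qed.

Lemma root_const_gt0 : 0 < b. Proof. exact: powR_gt0. Qed.

Lemma powR_full : m%:R `^ (m%:R / (m%:R - 1)) = m%:R * b.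
Proof.
have -> : m%:R / (m%:R - 1) = 1 + 1 / (m%:R - 1) :> R.
  by rewrite mM -[m%:R]natr1; field; rewrite gt_eqF// ltr_wpDr.
by rewrite powRD ?gt_eqF ?implybT// powRr1// ltW.
Qed.

(** Both sides are positive with [M]-th power [m^m], the right one by the equation for [rho]. *)
Lemma root_constE : m%:R * b = M%:R / (rho * S0).
Proof.
rewrite -/(ratio_const q rho); apply: (@pexpIrn _ M) => //.
- by rewrite nnegrE mulr_ge0// ltW// root_const_gt0.
- by rewrite nnegrE ltW// ratio_const_gt0.
rewrite (ratio_const_expr rho_gt0 rho_eq) exprMn [in RHS]exprSr; congr (_ * _).
rewrite /b -powR_mulrn ?powR_ge0// -powRrM mM mul1r mulVf ?powRr1 ?ltW//.
Qed.

Lemma geo_sum0 : (1 - rho) * S0 = 1 - rho ^+ M.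
Proof.
rewrite geo_moment0E; elim: (M) => [|n IHn]; first by rewrite big_ord0 expr0; ring.
by rewrite big_ord_recr /= mulrDr IHn exprS; ring.
Qed.

Lemma geo_sum01 : (1 - rho) * (S0 + S1) = S0 - M%:R * rho ^+ M.
Proof.
rewrite geo_moment0E /geo_moment; elim: (M) => [|n IHn].
  by rewrite !big_ord0; ring.
rewrite !big_ord_recr /= expr1.
set u := \sum_(i < n) rho ^+ i in IHn *; set v := \sum_(i < n) _ in IHn *.
have -> : (1 - rho) * (u + rho ^+ n + (v + n%:R * rho ^+ n)) =
  (1 - rho) * (u + v) + (1 - rho) * (1 + n%:R) * rho ^+ n by ring.
by rewrite IHn -natr1 exprS; ring.
Qed.

Lemma alphaStarE : alphaStar m rho = (S0 + S1) / S0.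
Proof.
have S00 := geo_moment0_gt0 q rho_gt0.
have r1 : 1 - rho != 0 by rewrite subr_eq0 gt_eqF.
have r0 : rho != 0 by rewrite gt_eqF.
rewrite /alphaStar /mR powR_full root_constE.
have -> : S0 + S1 = (S0 - M%:R * rho ^+ M) / (1 - rho).
  by rewrite -geo_sum01 mulrC mulKf.
have -> : rho ^+ M = 1 - (1 - rho) * S0 by rewrite geo_sum0; ring.
rewrite -[m%:R]natr1; move: S0 S00 (M%:R : R) => s s0 k; field.
rewrite r1 r0 gt_eqF//=.
Qed.

Lemma d1cE : d1c m rho = drift.
Proof.
have S00 := geo_moment0_gt0 q rho_gt0; have S01 := geo_moment01_gt0 q rho_gt0.
have S1p : 0 <= S1 by exact: geo_moment_ge0.
rewrite /d1c /mR alphaStarE -/b mM.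
have -> : b = M%:R / (rho * S0) / m%:R by rewrite -root_constE mulrC mulKf// gt_eqF.
rewrite /drift /full_eq /leaf_eq expr0 mulr1 -[m%:R]natr1.
move: S0 S1 S00 S01 (M%:R : R) M0 => s u s0 us k k0; field.
by rewrite !gt_eqF// ltr_wpDr// ltW.
Qed.

(** Used with [z = 1] for [delta1c] and [z = 1 + M^-1] for its completed squares; each [- 1] removes
    the term [j = 0]. *)
Lemma sum_square (z d : R) :
  \sum_(1 <= j < M) (z - j.+1%:R * d) ^+ 2 * rho ^+ j =
  z ^+ 2 * (S0 - 1) - 2 * z * d * (S0 + S1 - 1) + d ^+ 2 * (S2 + 2 * S1 + S0 - 1).
Proof.
have : \sum_(0 <= j < M) (z - j.+1%:R * d) ^+ 2 * rho ^+ j =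
  z ^+ 2 * S0 - 2 * z * d * (S0 + S1) + d ^+ 2 * (S2 + 2 * S1 + S0).
  rewrite big_mkord /geo_moment !mulrDr !mulr_sumr -!big_split /= -sumrB -big_split /=.
  by apply: eq_bigr => k _; rewrite -natr1 expr0 expr1; ring.
rewrite big_ltn// expr0 mulr1 mul1r => /(canRL (addKr _)) ->; ring.
Qed.

Definition sigma2 : R := (delta1c m rho - S0 / M%:R ^+ 2) / (S0 + S1).

(** By [root_constE] and [alphaStarE], [a0 / (m (m - 1)) = S0 / M^2] and
    [2 a0 / (a1^2 (m - 1)) = 1 / (S0 + S1)]. *)
Lemma sigma2cE : sigma2c m rho = sigma2.
Proof.
have S00 := geo_moment0_gt0 q rho_gt0; have S01 := geo_moment01_gt0 q rho_gt0.
rewrite /sigma2c /B2c /sigma2; set dl := delta1c _ _.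
rewrite /a1c /a0c /mR powRN powR_full alphaStarE powRN -/b mM.
have al0 : 0 < 2 * m%:R * ((S0 + S1) / S0) by rewrite !mulr_gt0 ?invr_gt0.
have := sqr_sqrtr (ltW al0); have : Num.sqrt (2 * m%:R * ((S0 + S1) / S0)) != 0.
  by rewrite gt_eqF// sqrtr_gt0.
move: (Num.sqrt _) => r rn0 r2.
have bE : b = M%:R / (rho * S0) / m%:R by rewrite -root_constE mulrC mulKf// gt_eqF.
have -> : S0 + S1 = r ^+ 2 * S0 / (2 * m%:R) by rewrite r2; field; rewrite !gt_eqF.
rewrite bE; move: (M%:R : R) M0 (m%:R : R) m0 S0 S00 => k k0 mm mm0 s s0; field.
by rewrite rn0 !gt_eqF.
Qed.

(** A sum of squares, which shows the sign of the variance: since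
    [drift * (S0 + S1) = m S0 / M - 1], the cross terms with [M^-1] add up to [- 2 S0 / M^2]. *)
Lemma delta1E : delta1c m rho - S0 / M%:R ^+ 2 =
  (M%:R^-1 - drift) ^+ 2 + \sum_(1 <= j < M) (1 + M%:R^-1 - j.+1%:R * drift) ^+ 2 * rho ^+ j.
Proof.
have S00 := geo_moment0_gt0 q rho_gt0; have S01 := geo_moment01_gt0 q rho_gt0.
rewrite /delta1c d1cE !sum_square.
rewrite /drift /full_eq /leaf_eq expr0 mulr1 -[m%:R]natr1.
move: S0 S1 S2 S00 S01 (M%:R : R) M0 => s u v s0 us k k0; field.
by rewrite !gt_eqF.
Qed.

(** If the first square vanishes then [drift = M^-1], and the term [j = 1], present since [q > 0],
    contains [1 - M^-1], which is nonzero. *)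
Lemma sigma2_gt0 : (0 < q)%N -> 0 < sigma2.
Proof.
move=> q0; have S01 := geo_moment01_gt0 q rho_gt0.
rewrite divr_gt0// delta1E.
have h (j : nat) : 0 <= (1 + M%:R^-1 - j.+1%:R * drift) ^+ 2 * rho ^+ j.
  by rewrite mulr_ge0 ?sqr_ge0 ?exprn_ge0// ltW.
rewrite big_ltn// lt_neqAle addr_ge0 ?sqr_ge0 ?addr_ge0 ?sumr_ge0 ?andbT//.
apply/negP => /eqP /esym /eqP; rewrite paddr_eq0 ?sqr_ge0 ?addr_ge0 ?sumr_ge0//.
rewrite paddr_eq0 ?sumr_ge0// sqrf_eq0 subr_eq0 => /andP[/eqP <- /andP[]].
rewrite expr1 mulf_eq0 (gt_eqF rho_gt0) orbF sqrf_eq0 => /eqP h1 _.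
have k2 : 2 <= M%:R :> R by rewrite ler_nat.
have : M%:R * (1 + M%:R^-1 - 2 * M%:R^-1) = 0 :> R by rewrite h1 mulr0.
rewrite (_ : M%:R * _ = M%:R - 1); last by field; rewrite gt_eqF.
lra.
Qed.

Lemma sum_jump j : \sum_(k < j) jump R q k = j%:R - M%:R + (j == 0%N)%:R * M%:R.
Proof.
elim: j => [|j IHj]; first by rewrite big_ord0 /= mul1r; ring.
rewrite big_ord_recr /= IHj /jump -[j.+1%:R]natr1; case: (j == 0%N) / eqP => [->|_] /=; ring.
Qed.

Lemma limit_varianceE : limit_variance q rho = sigma2.
Proof.
have S00 := geo_moment0_gt0 q rho_gt0; have S01 := geo_moment01_gt0 q rho_gt0.
rewrite /limit_variance.
have -> : \sum_(j < M) ell_coef q rho j * \sum_(k < j) jump R q k =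
  slope q rho * S2 + (intercept q rho - slope q rho * M%:R) * S1 - intercept q rho * M%:R * (S0 - 1).
  rewrite big_ord_recl big_ord0 mulr0 add0r.
  have -> : S0 - 1 = \sum_(j < q) rho ^+ j.+1.
    by rewrite geo_moment0E big_ord_recl expr0; ring.
  have -> : S1 = \sum_(j < q) j.+1%:R * rho ^+ j.+1.
    by rewrite /geo_moment big_ord_recl expr1 mul0r add0r.
  have -> : S2 = \sum_(j < q) j.+1%:R ^+ 2 * rho ^+ j.+1.
    by rewrite /geo_moment big_ord_recl expr2 !mul0r add0r.
  rewrite !mulr_sumr -big_split -sumrB /=; apply: eq_bigr => k _.
  by rewrite /bump leq0n add1n sum_jump /ell_coef /=; ring.
rewrite /sigma2 /delta1c d1cE sum_square /slope /intercept.
rewrite /drift /full_eq /leaf_eq expr0 mulr1 -[m%:R]natr1.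
move: S0 S1 S2 S00 S01 (M%:R : R) M0 => s u v s0 us k k0; field.
by rewrite !gt_eqF.
Qed.

End Constants.

(** * The two limit theorems *)

Section Conclusion.
Variables (R : realType) (q : nat) (rho : R).
Local Notation m := q.+2.
Local Notation cfg := {ffun 'I_m -> nat}.
Hypothesis q0 : (0 < q)%N.
Hypothesis rho_gt0 : 0 < rho.
Hypothesis rho_lt1 : rho < 1.
Hypothesis rho_eq :
  (m%:R : R) ^+ m * (\sum_(1 <= j < m) rho ^+ j) ^+ m.-1 = m.-1%:R ^+ m.-1.

Local Notation E := (@Ecfg R q).
Local Notation Y := (@scaled_nodes R q rho).
Local Notation sd := (Num.sqrt (sigma2c m rho)).

Let var_gt0 : 0 < sigma2c m rho.
Proof. by rewrite (sigma2cE rho_gt0 rho_eq rho_lt1) sigma2_gt0. Qed.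

Let sd_gt0 : 0 < sd. Proof. by rewrite sqrtr_gt0. Qed.

Lemma stein_limit_sd (f df : R -> R) : (forall x : R, is_derive x 1 f (df x)) ->
  continuous df -> (exists L : R, forall x : R, `|df x| <= L) ->
  (fun n => E n (fun x => sd ^+ 2 * df (Y x) - Y x * f (Y x))) @ \oo --> (0 : R).
Proof.
move=> h1 h2 [L h3]; rewrite sqr_sqrtr ?ltW// (sigma2cE rho_gt0 rho_eq rho_lt1).
rewrite -(limit_varianceE rho_gt0 rho_eq rho_lt1).
exact: (stein_limit rho_gt0 rho_eq h1 h2 h3).
Qed.

Lemma scaled_nodes_clt (al be : nat -> R) (a : R) : 0 < a ->
  al @ \oo --> a -> be @ \oo --> (0 : R) ->
  conv_law_normal (fun n g => E n (fun x => g (al n * Y x + be n))) (a * sd).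
Proof.
move=> a0 ala be0 g cg [K gK].
have [C C0 hC] := scaled_nodes_mean2 rho_gt0 rho_eq.
apply: (@stein_clt R cfg E (fun n x => forest 1 n x) (fun x _ => Y x) sd C a al be g K) => //.
- by near=> n; exact: is_mean_E.
- by near=> n; apply: hC; near: n; exact: nbhs_infty_ge.
- exact: stein_limit_sd.
Unshelve. all: by end_near. Qed.

Lemma scaled_nodes_inv n x : (0 < n)%N -> forest 1 n x ->
  (nodes x)%:R = Num.sqrt n%:R * Y x + n%:R * d1c m rho :> R.
Proof.
move=> n0 fx; rewrite (d1cE rho_gt0 rho_eq rho_lt1) /scaled_nodes /sqrt_keys (forest_num_keys R fx).
have n1 : n%:R != 0 :> R by rewrite pnatr_eq0 -lt0n.
rewrite mulrA -expr2 sqr_sqrtr ?ler0n//.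
by move: (n%:R : R) n1 (drift q rho) => k k0 d; field.
Qed.

Lemma space_clt : conv_law_normal
  (fun n g => Elaw m n (fun x => g ((x - d1c m rho * (n.+1)%:R) / Num.sqrt n%:R))) sd.
Proof.
rewrite -[sd]mul1r => g cg gK.
(* [Y] is centered at [d1c * n] and the statement at [d1c * (n + 1)]; the gap vanishes after
   scaling. *)
have be0 : (fun n : nat => - (d1c m rho) / Num.sqrt n%:R) @ \oo --> (0 : R) by exact: cvg_div_sqrt.
have h : (fun n => E n (fun x => g (1 * Y x + - d1c m rho / Num.sqrt n%:R))) @ \oo -->
    Enormal (1 * sd) g.
  by apply: (scaled_nodes_clt ltr01 _ be0 cg gK); exact: cvg_cst.
apply: cvg_trans h; apply: near_eq_cvg; near=> n.
have n0 : (0 < n)%N by near: n; exact: nbhs_infty_gt.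
have s0 : Num.sqrt n%:R != 0 :> R by rewrite gt_eqF// sqrtr_gt0 ltr0n.
rewrite Elaw_Ecfg; apply: (eq_expect (is_mean_E R q n)) => x fx; congr g.
rewrite (scaled_nodes_inv n0 fx) -natr1.
by move: (Num.sqrt n%:R) s0 => s s0; field.
Unshelve. all: by end_near. Qed.

Lemma scaled_nodes_mean_cvg : (fun n => E n Y) @ \oo --> (0 : R).
Proof.
have h : (fun n => E n (fun x => sd ^+ 2 * (fun=> 0) (Y x) - Y x * (fun=> 1) (Y x))) @ \oo --> (0 : R).
  apply: (@stein_limit_sd (fun=> 1) (fun=> 0)).
  - by move=> x; exact: cvg_cst.
  - by exists 0 => x; rewrite normr0.
suff : (fun n => - E n (fun x => sd ^+ 2 * (fun=> 0) (Y x) - Y x * (fun=> 1) (Y x))) @ \oo --> - (0 : R).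
  rewrite oppr0; apply: cvg_trans; apply: near_eq_cvg; near=> n.
  rewrite -(expectN _ (is_mean_E R q n)); apply: (eq_expect (is_mean_E R q n)) => x _.
  by rewrite /= mulr0 mulr1 sub0r opprK.
exact: cvgN.
Unshelve. all: by end_near. Qed.

Lemma scaled_nodes_square_cvg : (fun n => E n (fun x => Y x ^+ 2)) @ \oo --> sd ^+ 2.
Proof.
have h : (fun n => E n (fun x => sd ^+ 2 * (fun=> 1) (Y x) - Y x * id (Y x))) @ \oo --> (0 : R).
  apply: (@stein_limit_sd id (fun=> 1)).
  - by move=> x; exact: cvg_cst.
  - by exists 1 => x; rewrite normr1.
suff : (fun n => sd ^+ 2 - E n (fun x => sd ^+ 2 * (fun=> 1) (Y x) - Y x * id (Y x))) @ \oo -->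
    sd ^+ 2 - (0 : R).
  rewrite subr0; apply: cvg_trans; apply: near_eq_cvg; near=> n.
  have En := is_mean_E R q n; rewrite -[X in X - _](expect_cst _ En) -(expectB _ _ En).
  by apply: (eq_expect En) => x _; rewrite /=; ring.
by apply: cvgB => //; exact: cvg_cst.
Unshelve. all: by end_near. Qed.

Definition scaled_var n : R := E n (fun x => Y x ^+ 2) - E n Y ^+ 2.

Lemma scaled_var_cvg : scaled_var @ \oo --> sd ^+ 2.
Proof.
suff : scaled_var @ \oo --> sd ^+ 2 - (0 : R) * 0 by rewrite mulr0 subr0.
apply: cvgB; first exact: scaled_nodes_square_cvg.
under eq_fun do rewrite expr2.
by apply: cvgM; exact: scaled_nodes_mean_cvg.
Qed.

Lemma sqrt_var_cvg : (fun n => (Num.sqrt (scaled_var n))^-1) @ \oo --> sd^-1.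
Proof.
apply: cvgV; first by rewrite gt_eqF.
rewrite -[sd]ger0_norm ?ltW// -sqrtr_sqr.
by apply: continuous_cvg scaled_var_cvg; exact: sqrt_continuous.
Qed.

Lemma space_mean n : (0 < n)%N -> meanX R m n = Num.sqrt n%:R * E n Y + n%:R * d1c m rho.
Proof.
move=> n0; have En := is_mean_E R q n.
rewrite /meanX Elaw_Ecfg (eq_expect (q := fun x => Num.sqrt n%:R * Y x + n%:R * d1c m rho) En).
  by rewrite (expectD En) (expectZ En _ Y) (expect_cst _ En).
by move=> x fx; rewrite /= (scaled_nodes_inv n0 fx).
Qed.

Lemma space_var n : (0 < n)%N -> varX R m n = n%:R * scaled_var n.
Proof.
move=> n0; have En := is_mean_E R q n.
rewrite /varX Elaw_Ecfg (eq_expect (q := fun x => n%:R * (Y x ^+ 2 - 2 * E n Y * Y x + E n Y ^+ 2)) En).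
  rewrite (expectZ En) (expectD En) (expectB _ _ En) (expectZ En) (expect_cst _ En) /scaled_var.
  by congr (_ * _); ring.
move=> x fx; rewrite space_mean// (scaled_nodes_inv n0 fx).
rewrite opprD addrACA subrr addr0 -mulrBr exprMn sqr_sqrtr ?ler0n//.
by congr (_ * _); ring.
Qed.

(** Standardizing is an affine map of [Y] whose slope tends to [1 / sd] and whose shift vanishes,
    because [E n Y] and [scaled_var] converge to 0 and [sd ^+ 2]. *)
Lemma standardized_space_clt : conv_law_normal
  (fun n g => Elaw m n (fun x => g ((x - meanX R m n) / Num.sqrt (varX R m n)))) 1.
Proof.
rewrite -[1](@mulVf _ sd) ?gt_eqF// => g cg gK.
have be0 : (fun n => - (E n Y * (Num.sqrt (scaled_var n))^-1)) @ \oo --> (0 : R).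
  suff : (fun n => - (E n Y * (Num.sqrt (scaled_var n))^-1)) @ \oo --> - ((0 : R) * sd^-1).
    by rewrite mul0r oppr0.
  by apply: cvgN; apply: cvgM; [exact: scaled_nodes_mean_cvg|exact: sqrt_var_cvg].
have sdV : 0 < sd^-1 by rewrite invr_gt0.
have h : (fun n => E n (fun x => g ((Num.sqrt (scaled_var n))^-1 * Y x +
    - (E n Y * (Num.sqrt (scaled_var n))^-1)))) @ \oo --> Enormal (sd^-1 * sd) g.
  exact: (scaled_nodes_clt sdV sqrt_var_cvg be0 cg gK).
apply: cvg_trans h; apply: near_eq_cvg; near=> n.
have n0 : (0 < n)%N by near: n; exact: nbhs_infty_gt.
have s0 : Num.sqrt n%:R != 0 :> R by rewrite gt_eqF// sqrtr_gt0 ltr0n.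
rewrite Elaw_Ecfg; apply: (eq_expect (is_mean_E R q n)) => x fx; congr g.
rewrite space_var// space_mean// (scaled_nodes_inv n0 fx) sqrtrM ?ler0n// invfM.
move: (Num.sqrt n%:R) s0 (Num.sqrt (scaled_var n))^-1 => s s0 v; field.
exact: s0.
Unshelve. all: by end_near. Qed.

End Conclusion.

Theorem theorem6p1 (R : realType) (m : nat) (rho : R) :
  (3 <= m)%N -> 0 < rho < 1 ->
  (m%:R : R) ^+ m * (\sum_(1 <= j < m) rho ^+ j) ^+ m.-1 = (m.-1)%:R ^+ m.-1 ->
  conv_law_normal
    (fun n g => Elaw m n (fun x => g ((x - d1c m rho * (n.+1)%:R) / Num.sqrt n%:R)))
    (Num.sqrt (sigma2c m rho))
  /\
  conv_law_normal
    (fun n g => Elaw m n (fun x => g ((x - meanX R m n) / Num.sqrt (varX R m n))))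
    1.
Proof.
case: m => [|[|q]]// q0 /andP[rho_gt0 rho_lt1] rho_eq.
by split; [exact: space_clt|exact: (standardized_space_clt (rho := rho))].
Qed.
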